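(* Let $\Omega\in\mathfrak g^n$ satisfy $\sum_{i=1}^n\Omega_i=0$, and consider the quantum Kuramoto system with forcing $\epsilon\Omega_i$, $$X_i'X_i^{-1}=\epsilon\Omega_i+\frac12\sum_{j=1}^n\gamma_{ij}\bigl(f(X_jX_i^{-1})-f(X_iX_j^{-1})\bigr),\qquad X_i\in G.$$ Assume that $f'(0)>0$ and that $\mathrm{Lap}(\Gamma)$ is negative semidefinite with a single zero eigenvalue. Then, for $\epsilon$ sufficiently small, there is a near-constant solution $Y=(Y_1,\dots,Y_n)$ that is asymptotically stable, i.e. there is a stable fixed point with $Y_jY_i^{-1}=I+O(\epsilon)$ for all $i,j$. Moreover, this solution can be obtained by the formula $Y_i=\exp(\epsilon Q_i)$, where $Q=(Q_1,\dots,Q_n)$ is given by $$Q=-\mathrm{Lap}^+(\Gamma)\,\Omega.$$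
   Context: Let $G$ be a matrix Lie group (closed subgroup of the general linear group over $\mathbb R$ or $\mathbb C$) with Lie algebra $\mathfrak g$, with the Lohe closure property: $Z-Z^{-1}\in\mathfrak g$ for all $Z\in G$. Let $\Gamma$ be an undirected weighted graph on $n$ vertices with edge weights $\gamma_{ij}=\gamma_{ji}\ge 0$. Let $f(x)=\sum_{p\ge1}a_px^p$ be a real analytic function, applied to elements of $G$ through its power series. The graph Laplacian is $\mathrm{Lap}(\Gamma)_{ij}=\gamma_{ij}$ for $i\neq j$ and $\mathrm{Lap}(\Gamma)_{ii}=-\sum_{k\ne i}\gamma_{ik}$; it acts on $\mathfrak g^n$ by $(\mathrm{Lap}(\Gamma)Q)_i=\sum_j\mathrm{Lap}(\Gamma)_{ij}Q_j$. Put $\mathfrak g_0^n=\{Q\in\mathfrak g^n:\sum_iQ_i=0\}$. When $\mathrm{Lap}(\Gamma)$ has a simple zero eigenvalue it restricts to an invertible map of $\mathfrak g_0^n$ to itself, and $\mathrm{Lap}^+(\Gamma):\mathfrak g_0^n\to\mathfrak g_0^n$ denotes the inverse of this restriction (the Moore--Penrose pseudoinverse). A fixed point is a solution with $X_i'=0$ for all $i$. The system is invariant under simultaneous right multiplication $X_i\mapsto X_iZ$, $Z\in G$, and fixed points and their stability are understood up to this action: a fixed point is asymptotically stable if its equivalence class (orbit under right multiplication) is an asymptotically stable equilibrium of the induced flow on $G^n/G$.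
   Formalization: As printed the claim is false: f'(0)>0 is replaced by f'(1)>0 (derivative at the identity), Q by -(1/f'(1)) Lap^+ Omega, and Y_i=exp(eps Q_i) holds to leading order: Y_i=exp(eps P_i), P=Q+O(eps); the power series of f has radius of convergence > 1. *)

(* Defs.v *)
From HB Require Import structures.
From mathcomp Require Import all_boot all_order all_algebra.
From mathcomp Require Import all_classical all_reals all_analysis.
From mathcomp Require Import complex.

Set Implicit Arguments.
Unset Strict Implicit.
Unset Printing Implicit Defensive.

Import Order.TTheory GRing.Theory Num.Theory.
Import numFieldNormedType.Exports.

Local Open Scope classical_set_scope.
Local Open Scope ring_scope.

Variant base_field := Reals | Complexes.

Definition scalars (R : realType) (k : base_field) : numFieldType :=
  match k with Reals => R | Complexes => R[i] end.

Definition of_real (R : realType) (k : base_field) : R -> scalars R k :=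
  match k with Reals => idfun | Complexes => real_complex R end.
Arguments of_real {R} k.

Section ScalarFunction.
Variables (R : realType) (a : nat -> R).

Definition scalar_series (x : R) : nat -> R :=
  fun N => \sum_(1 <= p < N) a p * x ^+ p.

Definition scalar_fun (x : R) : R := limn (scalar_series x).

(* The power series is applied to matrices arbitrarily close to the identity,
   hence the radius of convergence has to be larger than 1. *)
Definition analytic_past_one : Prop :=
  exists2 r : R, 1 < r & cvgn (fun N => \sum_(1 <= p < N) `|a p| * r ^+ p).

End ScalarFunction.

Section Laplacian.
Variables (R : realType) (n : nat) (gamma : 'I_n -> 'I_n -> R).

Definition laplacian : 'M[R]_n :=
  \matrix_(i, j) (if i == j then - \sum_(k < n | k != i) gamma i k
                  else gamma i j).

End Laplacian.

Definition negative_semidefinite (R : realType) (n : nat) (L : 'M[R]_n) : Prop :=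
  forall v : 'cV[R]_n, (v^T *m L *m v) 0 0 <= 0.

Definition simple_eigenvalue (R : realType) (n : nat) (L : 'M[R]_n) (x : R) :
    Prop :=
  mup x (char_poly L) = 1%N.

Section MatrixGroups.
Variables (R : realType) (k : base_field) (m : nat).
Local Notation K := (scalars R k).
Local Notation "x %:K" := (of_real k x) (at level 2, format "x %:K").
Implicit Types (G : set 'M[K]_m) (Z A : 'M[K]_m).

Definition expmx A : 'M[K]_m :=
  limn (fun N => \sum_(0 <= p < N) ((p`!%:R)^-1 : K) *: A ^+ p).

Definition matrix_series (a : nat -> R) Z : nat -> 'M[K]_m :=
  fun N => \sum_(1 <= p < N) (a p)%:K *: Z ^+ p.

Definition matrix_fun (a : nat -> R) Z : 'M[K]_m := limn (matrix_series a Z).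

(* The last clause says that G is closed in GL_m (not necessarily in M_m). *)
Definition matrix_lie_group G : Prop :=
  [/\ G `<=` [set Z | Z \in unitmx],
      G 1%:M,
      (forall A Z, G A -> G Z -> G (A *m Z)),
      (forall Z, G Z -> G (invmx Z)) &
      closure G `&` [set Z | Z \in unitmx] `<=` G].

Definition lie_algebra G : set 'M[K]_m :=
  [set A | forall t : R, G (expmx (t%:K *: A))].

Definition lohe_closed G : Prop :=
  forall Z, G Z -> lie_algebra G (Z - invmx Z).

Section Configurations.
Variable n : nat.
Implicit Types (Q : 'I_n -> 'M[K]_m) (gamma : 'I_n -> 'I_n -> R).

Definition lie_algebra0 G : set ('I_n -> 'M[K]_m) :=
  [set Q | (forall i, lie_algebra G (Q i)) /\ \sum_i Q i = 0].

Definition lap_act gamma Q : 'I_n -> 'M[K]_m :=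
  fun i => \sum_j (laplacian gamma i j)%:K *: Q j.

(* The inverse of the restriction of lap_act gamma to lie_algebra0 G. *)
Definition lap_pinv G gamma : ('I_n -> 'M[K]_m) -> ('I_n -> 'M[K]_m) :=
  'pinv_(fun=> 0) (lie_algebra0 G) (lap_act gamma).

End Configurations.

Section Kuramoto.
Variables (n : nat) (G : set 'M[K]_m) (gamma : 'I_n -> 'I_n -> R).
Variables (a : nat -> R) (eps : R) (Omega : 'I_n -> 'M[K]_m).
Implicit Types (Y : 'I_n -> 'M[K]_m) (U V : set ('I_n -> 'M[K]_m)).

(* Right-hand side of the equation for X_i' X_i^-1. *)
Definition kuramoto_rhs (X : 'I_n -> 'M[K]_m) (i : 'I_n) : 'M[K]_m :=
  eps%:K *: Omega i +
  (2^-1)%:K *: \sum_j (gamma i j)%:K *: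
     (matrix_fun a (X j *m invmx (X i)) - matrix_fun a (X i *m invmx (X j))).

(* Points of G^n at which all the power series in the system converge. *)
Definition phase_space : set ('I_n -> 'M[K]_m) :=
  [set X | (forall i, G (X i)) /\
           forall i j, cvgn (matrix_series a (X j *m invmx (X i)))].

(* D is the derivative at t of c restricted to [0, +oo[, one-sided at 0. *)
Definition is_velocity (c : R -> 'M[K]_m) (t : R) (D : 'M[K]_m) : Prop :=
  ((s - t)^-1)%:K *: (c s - c t) @[s --> within (fun s => 0 <= s) t^'] --> D.

Definition solution (X : R -> 'I_n -> 'M[K]_m) : Prop :=
  forall t, 0 <= t -> phase_space (X t) /\
    forall i, exists2 D : 'M[K]_m, is_velocity (fun s => X s i) t D &
      D *m invmx (X t i) = kuramoto_rhs (X t) i.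

Definition fixed_point Y : Prop :=
  phase_space Y /\ forall i, kuramoto_rhs Y i = 0.

(* An open subset of the quotient G^n / G is represented by its preimage in
   G^n: a relatively open set invariant under simultaneous right
   multiplication. *)
Definition quotient_open U : Prop :=
  [/\ (forall X, U X -> forall i, G (X i)),
      (forall X Z, U X -> G Z -> U (fun i => X i *m Z)) &
      forall X, U X -> exists2 d : R, 0 < d &
        forall X' : 'I_n -> 'M[K]_m, (forall i, G (X' i)) ->
          (forall i, `|X' i - X i| < d%:K) -> U X'].

Definition class_nbhs Y U : Prop := quotient_open U /\ U Y.

Definition lyapunov_stable Y : Prop :=
  forall U, class_nbhs Y U -> exists2 V, class_nbhs Y V &
    forall X0, V X0 ->
      (exists2 X : R -> 'I_n -> 'M[K]_m, solution X & X 0 = X0) /\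
      (forall X, solution X -> X 0 = X0 -> forall t, 0 <= t -> U (X t)).

Definition attractive Y : Prop :=
  exists2 V, class_nbhs Y V & forall X, solution X -> V (X 0) ->
    forall U, class_nbhs Y U -> \forall t \near +oo, U (X t).

Definition asymptotically_stable Y : Prop :=
  lyapunov_stable Y /\ attractive Y.

End Kuramoto.
End MatrixGroups.

(* Main.v *)
Require Import Defs.
From HB Require Import structures.
From mathcomp Require Import all_boot all_order all_algebra.
From mathcomp Require Import all_classical all_reals all_analysis.
From mathcomp Require Import complex ring lra.

Import Order.TTheory GRing.Theory Num.Theory.
Import numFieldNormedType.Exports.

(** Both halves of the statement come from one linearisation.  The coupling is
    invariant under right multiplication and depends on the configuration only
    through the ratios [X j *m invmx (X i)].  Near the identity [f] is its
    value at [1] plus [f'(1)] times the displacement, with a remainder whose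
    Lipschitz constant is proportional to the radius, and a ratio is, to first
    order, a difference.  Hence near the constant configuration the coupling is
    [f'(1)] times the graph Laplacian up to a small Lipschitz error
    ([coupling_linear]).  All estimates are made in a real-valued
    submultiplicative norm [nrm] on matrices, uniform in the base field.

    Fixed point.  In the coordinates [Y i = expmx (eps *: P i)] the equation
    reads [eps (Omega + f'(1) Lap P + rem P) = 0], where the remainder is
    Lipschitz of order [eps] and vanishes at [P = 0] ([exp_coupling]).  It is
    equivalent to [P = Q - f'(1)^-1 Lap^+ (rem P)] with [f'(1) Lap Q = - Omega],
    and the right-hand side is a contraction near [Q], for which the fixed point
    satisfies [P - Q = O(eps)] ([kuramoto_fixed_point]).  This takes place among
    zero-sum configurations of the Lie algebra.  The Lie algebra is a closed
    real subspace, by the product formula ([lieD]) and continuity of the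
    exponential; the coupling takes its values there because each
    [Z ^+ p - invmx Z ^+ p] does ([coupling_lie]), and it has sum zero because
    it is antisymmetric.  The simple eigenvalue makes [Lap] invertible on
    zero-sum vectors ([laplacian_pinv]).

    Stability.  Fix a node [o].  The class of [X] modulo right multiplication is
    described by the ratios [X i *m invmx (X o)], which move with velocity
    [F i *m w i - w i *m F o].  Let [u] be the difference between these ratios
    and those of the fixed point.  To first order this velocity is
    [f'(1) Lap u] plus a term common to all nodes.  The quadratic form [disag],
    which sums the squares of the differences between nodes, does not see the
    common term, and it decreases along [Lap u] because of the spectral gap
    ([laplacian_gap]).  In a small enough neighbourhood the errors cost less
    than half of the gap ([ratio_lyapunov]).  So [spread], the value of [disag]
    on [u], is a strict Lyapunov function; its sublevel sets are a basis of
    invariant neighbourhoods of the class of the fixed point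
    ([spread_ball_basis]).

    Every solution that starts in a small sublevel set stays there, and its
    spread tends to [0], by a differential inequality ([decay_small]).  That
    such solutions exist for all times is shown with the exponential Euler
    scheme [X i |-> expmx (s *: F X i) *m X i]: its iterates remain in the group
    since [F X i] is in the Lie algebra, they do not leave the sublevel set
    ([exp_euler_spread]), and they grow at most exponentially, so that dyadic
    refinement converges on every bounded time interval ([euler_solution]). *)

Set Implicit Arguments.
Unset Strict Implicit.
Unset Printing Implicit Defensive.

Local Open Scope classical_set_scope.
Local Open Scope ring_scope.

(** * Real and complex scalars *)

Section Scalars.
Variables (R : realType) (k : base_field).
Local Notation K := (scalars R k).

Fact of_real_is_zmod_morphism : zmod_morphism (@of_real R k).
Proof. by case: k => x y //=; rewrite rmorphB. Qed.

Fact of_real_is_monoid_morphism : monoid_morphism (@of_real R k).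
Proof. by case: k; split => //= x y; rewrite rmorphM. Qed.

HB.instance Definition _ :=
  GRing.isZmodMorphism.Build R K (of_real k) of_real_is_zmod_morphism.
HB.instance Definition _ :=
  GRing.isMonoidMorphism.Build R K (of_real k) of_real_is_monoid_morphism.

(** Real part for [false] and imaginary part for [true]; on the reals the
    imaginary part is [0], so that both base fields are treated at once. *)
Definition part (b : bool) : K -> R :=
  match k return scalars R k -> R with
  | Reals => fun x => if b then 0 else x
  | Complexes => fun x => let: Complex u v := x in if b then v else u
  end.

Fact part_is_zmod_morphism b : zmod_morphism (part b).
Proof.
by rewrite /part; case: k b => [] [] x y /=; rewrite ?subr0 //;
  case: x; case: y.
Qed.

HB.instance Definition _ b :=
  GRing.isZmodMorphism.Build K R (part b) (part_is_zmod_morphism b).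

Lemma partZ b (t : R) (x : K) : part b (of_real k t * x) = t * part b x.
Proof.
rewrite /part; case: k b x => [] [] x /=; rewrite ?mulr0 //;
  by case: x => u v /=; rewrite !mul0r ?addr0 ?subr0.
Qed.

(** Equivalent to the modulus, but real-valued over both base fields, whereas
    the modulus of a complex number is itself a complex number. *)
Definition l1 (x : K) : R := `|part false x| + `|part true x|.

Lemma l1_ge0 x : 0 <= l1 x. Proof. exact: addr_ge0. Qed.

Lemma l1D x y : l1 (x + y) <= l1 x + l1 y.
Proof.
rewrite /l1 !raddfD /= addrACA; apply: lerD; exact: ler_normD.
Qed.

Lemma l1N x : l1 (- x) = l1 x.
Proof. by rewrite /l1 !raddfN /= !normrN. Qed.

Lemma l10 : l1 0 = 0.
Proof. by rewrite /l1 !raddf0 !normr0 addr0. Qed.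

Lemma l1Z (t : R) (x : K) : l1 (of_real k t * x) = `|t| * l1 x.
Proof. by rewrite /l1 !partZ !normrM mulrDr. Qed.

Lemma l1M x y : l1 (x * y) <= l1 x * l1 y.
Proof.
rewrite /l1 /part; case: k x y => /= [x y|[a b] [c d] /=].
  by rewrite !normr0 !addr0 normrM.
have h1 := ler_normB (a * c) (b * d).
have h2 := ler_normD (a * d) (b * c).
rewrite !normrM in h1 h2.
by apply: (le_trans (lerD h1 h2)); rewrite mulrDr !mulrDl; lra.
Qed.

Lemma norm_le_l1 x : `|x| <= of_real k (l1 x).
Proof.
rewrite /l1 /part; case: k x => /= [x|[a b]] /=.
  by rewrite normr0 addr0.
rewrite normc_def /= lecR -(ler_sqr _ (addr_ge0 (normr_ge0 _) (normr_ge0 _)));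
  last by rewrite nnegrE sqrtr_ge0.
rewrite sqr_sqrtr ?addr_ge0 ?sqr_ge0 // sqrrD !real_normK ?num_real //.
by rewrite lerD2r lerDl mulrn_wge0 // mulr_ge0.
Qed.

Lemma l1_le_norm x (c : R) : `|x| <= of_real k c -> l1 x <= c *+ 2.
Proof.
rewrite /l1 /part; case: k x => /= [x|[a b]] /=.
  rewrite normr0 addr0 mulr2n => h.
  by apply: (le_trans h); rewrite lerDl (le_trans _ h).
rewrite normc_def /= lecR mulr2n => h.
by apply: lerD; apply: le_trans h; rewrite -sqrtr_sqr ler_sqrt
  ?addr_ge0 ?sqr_ge0 // ?lerDl ?lerDr sqr_ge0.
Qed.

Lemma of_real_le (x y : R) : (of_real k x <= of_real k y) = (x <= y).
Proof. by case: k => //=; rewrite lecR. Qed.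

Lemma of_real_lt (x y : R) : (of_real k x < of_real k y) = (x < y).
Proof. by case: k => //=; rewrite ltcR. Qed.

Lemma pos_of_real (e : K) : 0 < e -> exists2 c : R, 0 < c & e = of_real k c.
Proof.
case: k e => /= [e e0|[a b]]; first by exists e.
by rewrite ltcE /= => /andP[/eqP -> a0]; exists a.
Qed.

Lemma l1_eq0 x : l1 x = 0 -> x = 0.
Proof.
move=> h; apply/eqP; rewrite -normr_eq0 eq_le normr_ge0 andbT.
by rewrite (le_trans (norm_le_l1 x)) // h rmorph0.
Qed.

Lemma of_parts (u v : R) :
  (k = Reals -> v = 0) -> exists x : K, part false x = u /\ part true x = v.
Proof.
rewrite /part; case: k => /= [/(_ erefl) ->|_]; first by exists u.
by exists (Complex u v).
Qed.

Lemma part_true_Reals : k = Reals -> forall x, part true x = 0.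
Proof. by rewrite /part; case: k. Qed.

End Scalars.

(** * Real-valued norms and convergence *)

(** Only the additive structure is normed, which lets one notion serve for
    scalars, matrices and configurations; scaling by reals is a separate
    hypothesis where it matters. *)
Record is_norm (R : realType) (E : zmodType) (nu : E -> R) : Prop := IsNorm {
  nu_eq0 : forall x, nu x = 0 -> x = 0;
  nu_ge0 : forall x, 0 <= nu x;
  nu0 : nu 0 = 0;
  nuN : forall x, nu (- x) = nu x;
  nuD : forall x y, nu (x + y) <= nu x + nu y }.

Definition null (R : realType) (b : nat -> R) :=
  forall e : R, 0 < e -> exists N : nat, forall p, (N <= p)%N -> b p <= e.

Lemma null_sum (R : realType) (I : Type) (r : seq I) (b : I -> nat -> R) :
  (forall i, null (b i)) -> null (fun p => \sum_(i <- r) b i p).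
Proof.
move=> nb; elim: r => [|i r IH] e e0.
  by exists 0%N => p _; rewrite big_nil ltW.
have e2 : 0 < e / 2 by rewrite divr_gt0.
have [N hN] := nb i _ e2; have [N' hN'] := IH _ e2; exists (maxn N N') => p.
rewrite geq_max => /andP[/hN h /hN' h'].
by rewrite big_cons [leRHS](splitr e) lerD.
Qed.

Lemma null_inv (R : realType) (c : R) : 0 <= c -> null (fun p => c / p.+1%:R).
Proof.
move=> c0 e e0; exists (Num.trunc (c / e)) => p Np.
rewrite ler_pdivrMr ?ltr0Sn // mulrC -ler_pdivrMr //.
have h : c / e < (Num.trunc (c / e)).+1%:R.
  by apply: truncnS_gt; rewrite divr_ge0 // ltW.
by apply: ltW (lt_le_trans h _); rewrite ler_nat.
Qed.

Section Norms.
Variables (R : realType) (E : zmodType) (nu : E -> R).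

Definition converges (u : nat -> E) (l : E) := null (fun p => nu (u p - l)).

Definition cauchy_seq (u : nat -> E) :=
  forall e : R, 0 < e -> exists N : nat,
    forall p q, (N <= p)%N -> (p <= q)%N -> nu (u q - u p) <= e.

Definition is_complete := forall u, cauchy_seq u -> exists l, converges u l.

Hypothesis nuP : is_norm nu.

Lemma nuB x y : nu (x - y) <= nu x + nu y.
Proof. by rewrite -[nu y](nuN nuP); exact: nuD. Qed.

Lemma nu_distC x y : nu (x - y) = nu (y - x).
Proof. by rewrite -(nuN nuP) opprB. Qed.

Lemma nu_dist_trans y x z : nu (x - z) <= nu (x - y) + nu (y - z).
Proof. by rewrite -[x - z](subrKA y) (nuD nuP). Qed.

Lemma nu_le_dist x y : nu x <= nu y + nu (x - y).
Proof. by rewrite -{1}[x](subrK y) addrC (nuD nuP). Qed.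

Lemma nu_sum (I : Type) (r : seq I) (P : pred I) (F : I -> E) :
  nu (\sum_(i <- r | P i) F i) <= \sum_(i <- r | P i) nu (F i).
Proof.
elim/big_rec2: _ => [|i a b _ h]; first by rewrite (nu0 nuP).
by rewrite (le_trans (nuD nuP _ _)) // lerD2l.
Qed.

Lemma converges_le u l c N0 :
  converges u l -> (forall p, (N0 <= p)%N -> nu (u p) <= c) -> nu l <= c.
Proof.
move=> cu uc; apply/ler_addgt0Pr => e /cu[N hN].
have h := hN _ (leq_maxl N N0); have h' := uc _ (leq_maxr N N0).
by rewrite (le_trans (nu_le_dist l (u (maxn N N0)))) // lerD // nu_distC.
Qed.

Lemma converges_le_dist u l x c N0 :
  converges u l -> (forall p, (N0 <= p)%N -> nu (u p - x) <= c) ->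
  nu (l - x) <= c.
Proof.
move=> cu uc; apply: (@converges_le (fun p => u p - x) _ _ N0) => //.
by move=> e /cu[N hN]; exists N => p /hN; rewrite opprB addrA subrK.
Qed.

Lemma converges_unique u l l' : converges u l -> converges u l' -> l = l'.
Proof.
move=> cl cl'; apply/eqP; rewrite -subr_eq0; apply/eqP/(nu_eq0 nuP).
apply/le_anti; rewrite (nu_ge0 nuP) andbT; apply/ler_addgt0Pr => e e0.
have [N hN] := cl' _ e0; rewrite add0r.
by apply: (converges_le_dist cl) => p; apply: hN.
Qed.

Lemma convergesD u v l l' : converges u l -> converges v l' ->
  converges (fun p => u p + v p) (l + l').
Proof.
move=> cl cl' e e0; have e2 : 0 < e / 2 by rewrite divr_gt0.
have [N hN] := cl _ e2; have [N' hN'] := cl' _ e2; exists (maxn N N') => p.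
rewrite geq_max => /andP[/hN h /hN' h'].
by rewrite opprD addrACA (le_trans (nuD nuP _ _)) // [leRHS](splitr e) lerD.
Qed.

Lemma convergesN u l : converges u l -> converges (fun p => - u p) (- l).
Proof.
move=> cl e /cl[N hN]; exists N => p /hN.
by rewrite -opprD (nuN nuP).
Qed.

Lemma convergesB u v l l' : converges u l -> converges v l' ->
  converges (fun p => u p - v p) (l - l').
Proof. by move=> cl /convergesN; apply: convergesD. Qed.

Lemma converges_cst l : converges (fun=> l) l.
Proof. by move=> e /ltW e0; exists 0%N => p _; rewrite subrr (nu0 nuP). Qed.

Lemma converges_shift u l j : converges u l -> converges (fun p => u (p + j)%N) l.
Proof.
move=> cl e /cl[N hN]; exists N => p Np; apply: hN.
exact: leq_trans (leq_addr _ _).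
Qed.

Lemma converges_near u v l N0 : converges u l ->
  (forall p, (N0 <= p)%N -> u p = v p) -> converges v l.
Proof.
move=> cl uv e /cl[N hN]; exists (maxn N N0) => p.
by rewrite geq_max => /andP[/hN h /uv <-].
Qed.

Lemma converges_squeeze u l (b : nat -> R) :
  null b -> (forall p, nu (u p - l) <= b p) -> converges u l.
Proof.
by move=> hb ub e /hb[N hN]; exists N => p /hN; apply: le_trans.
Qed.

(** The telescoping tail of the increments gives a rate of convergence, on
    which the uniformity in time of the Euler scheme relies. *)
Lemma geometric_converges u (c : R) : is_complete -> 0 <= c ->
  (forall p, nu (u p.+1 - u p) <= c / 2 ^+ p) ->
  exists2 l, converges u l & forall p, nu (u p - l) <= c *+ 2 / 2 ^+ p.
Proof.
move=> complete c0 uc.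
have step p j : nu (u (p + j)%N - u p) <= c *+ 2 / 2 ^+ p - c *+ 2 / 2 ^+ (p + j).
  elim: j => [|j IH]; first by rewrite addn0 !subrr (nu0 nuP).
  apply: (le_trans (nu_dist_trans (u (p + j)%N) _ _)).
  rewrite addnS; apply: (le_trans (lerD (uc _) IH)).
  suff -> : c *+ 2 / 2 ^+ (p + j).+1 = c / 2 ^+ (p + j).
    by rewrite !mulrnAl !mulr2n; set x := c / 2 ^+ (p + j); lra.
  by rewrite exprS invfM mulrA -(mulr_natr c) mulfK ?pnatr_eq0.
have step' p q : (p <= q)%N -> nu (u q - u p) <= c *+ 2 / 2 ^+ p.
  move=> /subnKC <-; apply: (le_trans (step _ _)).
  by rewrite gerBl divr_ge0 ?mulrn_wge0 // exprn_ge0.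
have small (e : R) : 0 < e -> exists N, forall p, (N <= p)%N -> c *+ 2 / 2 ^+ p <= e.
  move=> e0; exists (Num.trunc (c *+ 2 / e)).+1 => p Np.
  rewrite ler_pdivrMr ?exprn_gt0 // mulrC -ler_pdivrMr //.
  have h : c *+ 2 / e < (Num.trunc (c *+ 2 / e)).+1%:R.
    by apply: truncnS_gt; rewrite divr_ge0 ?mulrn_wge0 // ltW.
  apply: ltW (lt_le_trans h _).
  apply: (@le_trans _ _ p%:R); first by rewrite ler_nat.
  by rewrite -natrX ler_nat ltnW // ltn_expl.
have [|l cl] := complete u.
  move=> e /small[N hN]; exists N => p q Np pq.
  exact: le_trans (step' _ _ pq) (hN _ Np).
exists l => // p; rewrite nu_distC.
by apply: (converges_le_dist cl) => q; apply: step'.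
Qed.

(** The contraction principle. The factor [1/2] is what a smallness condition
    on [eps] provides. *)
Lemma contraction_fixed (S : set E) (T : E -> E) (x0 : E) :
  is_complete -> S x0 -> (forall x, S x -> S (T x)) ->
  (forall u l, (forall p, S (u p)) -> converges u l -> S l) ->
  (forall x y, S x -> S y -> nu (T x - T y) <= nu (x - y) / 2) ->
  exists2 x, S x & T x = x.
Proof.
move=> complete Sx0 ST Sclosed contr.
pose u p := iter p T x0.
have Su p : S (u p) by elim: p => //= p; apply: ST.
have [p|l cl _] := @geometric_converges u (nu (u 1%N - u 0%N)) complete (nu_ge0 nuP _).
  elim: p => [|p IH]; first by rewrite expr0 divr1.
  rewrite exprSr invfM mulrA.
  apply: (le_trans (contr _ _ (Su p.+1) (Su p))).
  by rewrite ler_pM2r ?invr_gt0.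
have Sl := Sclosed _ _ Su cl; exists l => //.
apply: (@converges_unique (fun p => u (p + 1)%N)); last exact: converges_shift.
move=> e e0; have [N hN] := cl _ e0; exists N => p /hN h; rewrite addn1 /=.
apply: (le_trans (contr _ _ (Su p) Sl)).
by rewrite ler_pdivrMr // (le_trans h) // ler_peMr ?ler1n // ltW.
Qed.

End Norms.

Lemma real_is_norm (R : realType) : is_norm (Num.norm : R -> R).
Proof.
split=> //; first exact: normr0_eq0; first exact: normr0; first exact: normrN.
exact: ler_normD.
Qed.

Lemma real_is_complete (R : realType) : is_complete (Num.norm : R -> R).
Proof.
move=> u cu.
have /cvg_ex[l ul] : cvgn u.
  apply: cauchy_cvg; apply/cauchyP => e e0.
  have [N hN] := cu _ (divr_gt0 e0 (ltr0Sn R 1)).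
  exists (u N); exists N => // p /= Np; rewrite -ball_normE /= distrC.
  apply: le_lt_trans (hN N p (leqnn N) Np) _.
  by rewrite gtr_pMr // invf_lt1 // ltr1n.
exists l => e e0; move/cvgrPdist_le : ul => /(_ _ e0)[N _ hN].
by exists N => p Np; rewrite distrC; apply: hN.
Qed.

Lemma cvgn_converges (R : realType) (u : nat -> R) l :
  u @ \oo --> l <-> converges (Num.norm : R -> R) u l.
Proof.
split => [ul e e0|cul].
  move/cvgrPdist_le : ul => /(_ _ e0)[N _ hN].
  by exists N => p Np; rewrite distrC; apply: hN.
apply/cvgrPdist_le => e /cul[N hN]; exists N => // p /hN.
by rewrite distrC.
Qed.

(** * Norms of tuples and of matrices *)

Section SumNorm.
Variables (R : realType) (E : zmodType) (nu : E -> R) (I : finType).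

Definition sum_norm (f : I -> E) : R := \sum_i nu (f i).

Lemma sum_norm_coord (nuP : is_norm nu) f i : nu (f i) <= sum_norm f.
Proof.
rewrite /sum_norm (bigD1 i) //= lerDl sumr_ge0 // => j _; exact: nu_ge0.
Qed.

Lemma sum_norm_is_norm : is_norm nu -> is_norm sum_norm.
Proof.
move=> nuP; split.
- move=> f f0; apply/funext => i; apply: (nu_eq0 nuP).
  by apply/le_anti; rewrite (nu_ge0 nuP) andbT -f0 sum_norm_coord.
- by move=> f; apply: sumr_ge0 => i _; exact: nu_ge0.
- by apply: big1 => i _; exact: nu0.
- by move=> f; apply: eq_bigr => i _; exact: nuN.
- by move=> f g; rewrite -big_split; apply: ler_sum => i _; exact: nuD.
Qed.

Lemma sum_norm_converges u l :
  (forall i, converges nu (fun p => u p i) (l i)) -> converges sum_norm u l.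
Proof. by move=> cul; apply: null_sum => i; exact: cul. Qed.

Lemma converges_coord (nuP : is_norm nu) u l i :
  converges sum_norm u l -> converges nu (fun p => u p i) (l i).
Proof.
move=> cul e /cul[N hN]; exists N => p /hN.
by apply: le_trans; apply: (sum_norm_coord nuP (u p - l)).
Qed.

Lemma sum_norm_is_complete :
  is_norm nu -> is_complete nu -> is_complete sum_norm.
Proof.
move=> nuP complete u cu.
have /choice[l cul] i : exists l, converges nu (fun p => u p i) l.
  apply: complete => e /cu[N hN]; exists N => p q Np pq.
  by apply: le_trans (hN p q Np pq); apply: (sum_norm_coord nuP (u q - u p)).
by exists l; apply: sum_norm_converges.
Qed.

End SumNorm.
Arguments sum_norm {R E} nu {I} f.

Section ScalarNorm.
Variables (R : realType) (k : base_field).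
Local Notation K := (scalars R k).

Lemma l1_is_norm : is_norm (@l1 R k).
Proof.
split; [exact: l1_eq0|exact: l1_ge0|exact: l10|exact: l1N|exact: l1D].
Qed.

Lemma l1_is_complete : is_complete (@l1 R k).
Proof.
move=> u cu.
have part_le b (x : K) : `|part b x| <= l1 x.
  by rewrite /l1; case: b; rewrite ?lerDl ?lerDr.
have /choice[l cul] b :
    exists l, converges (Num.norm : R -> R) (fun p => part b (u p)) l.
  apply: (@real_is_complete R) => e /cu[N hN]; exists N => p q Np pq.
  by apply: le_trans (hN p q Np pq); rewrite -raddfB; exact: part_le.
have [|x [xf xt]] := @of_parts R k (l false) (l true).
  move=> kR; apply: (converges_unique (@real_is_norm R) (cul true)).
  have /funext -> : (fun p => part true (u p)) =1 (fun=> 0).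
    by move=> p; rewrite part_true_Reals.
  exact: converges_cst (@real_is_norm R) _.
exists x => e e0; have e2 : 0 < e / 2 by rewrite divr_gt0.
have [N hN] := cul false _ e2; have [N' hN'] := cul true _ e2.
exists (maxn N N') => p; rewrite geq_max => /andP[/hN h /hN' h'].
by rewrite /l1 !raddfB /= xf xt [leRHS](splitr e) lerD.
Qed.

End ScalarNorm.

Section MatrixNorm.
Variables (R : realType) (k : base_field) (m : nat).
Local Notation K := (scalars R k).
Local Notation "x %:K" := (of_real k x) (at level 2, format "x %:K").
Implicit Types A B Z : 'M[K]_m.

(** The sum over all entries is submultiplicative, unlike the maximum of the
    entries that defines the topology on matrices. *)
Definition nrm A : R := \sum_i \sum_j l1 (A i j).

Lemma nrm_is_norm : is_norm nrm.
Proof.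
have hs := sum_norm_is_norm 'I_m (l1_is_norm R k).
split.
- move=> A A0; apply/matrixP => i j; rewrite mxE.
  have /(_ A0) := nu_eq0 (sum_norm_is_norm 'I_m hs) (x := A).
  by move=> /(congr1 (fun f => f i j)).
- by move=> A; apply: sumr_ge0 => i _; apply: sumr_ge0 => j _; exact: l1_ge0.
- by rewrite /nrm big1 // => i _; rewrite big1 // => j _; rewrite mxE l10.
- move=> A; apply: eq_bigr => i _; apply: eq_bigr => j _.
  by rewrite mxE l1N.
- move=> A B; rewrite -big_split; apply: ler_sum => i _.
  rewrite -big_split; apply: ler_sum => j _.
  by rewrite mxE l1D.
Qed.

Lemma nrm_is_complete : is_complete nrm.
Proof.
have hs := sum_norm_is_norm 'I_m (l1_is_norm R k).
have hc := sum_norm_is_complete (I := 'I_m) (l1_is_norm R k) (@l1_is_complete R k).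
move=> u cu.
have [|l cl] := sum_norm_is_complete (I := 'I_m) hs hc (u := fun p => u p : 'I_m -> 'I_m -> K).
  move=> e /cu[N hN]; exists N => p q Np pq; apply: le_trans (hN p q Np pq).
  by apply: ler_sum => i _; apply: ler_sum => j _; rewrite !mxE.
exists (\matrix_(i, j) l i j) => e /cl[N hN]; exists N => p /hN.
apply: le_trans; apply: ler_sum => i _; apply: ler_sum => j _.
by rewrite !mxE.
Qed.

Lemma l1_le_nrm A i j : l1 (A i j) <= nrm A.
Proof.
rewrite /nrm (bigD1 i) //= (bigD1 j) //= -addrA lerDl addr_ge0 //.
  by apply: sumr_ge0 => *; exact: l1_ge0.
by apply: sumr_ge0 => *; apply: sumr_ge0 => *; exact: l1_ge0.
Qed.

Lemma nrmM A B : nrm (A *m B) <= nrm A * nrm B.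
Proof.
rewrite {1 2}/nrm mulr_suml; apply: ler_sum => i _; rewrite mulr_suml.
have h j : l1 ((A *m B) i j) <= \sum_l l1 (A i l) * l1 (B l j).
  rewrite mxE (le_trans (nu_sum (l1_is_norm R k) _ _ _)) //.
  by apply: ler_sum => l _; exact: l1M.
apply: (le_trans (ler_sum _ (fun j _ => h j))).
rewrite exchange_big; apply: ler_sum => l _.
rewrite -mulr_sumr ler_wpM2l ?l1_ge0 // /nrm [leRHS](bigD1 l) //= lerDl.
by apply: sumr_ge0 => *; apply: sumr_ge0 => *; exact: l1_ge0.
Qed.

Lemma nrmZ (t : R) A : nrm (t%:K *: A) = `|t| * nrm A.
Proof.
rewrite /nrm mulr_sumr; apply: eq_bigr => i _; rewrite mulr_sumr.
by apply: eq_bigr => j _; rewrite mxE l1Z.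
Qed.

Lemma norm_le_nrm A : `|A| <= (nrm A)%:K.
Proof.
have [->|A0] := eqVneq `|A| 0.
  by rewrite -(rmorph0 (of_real k)) of_real_le; exact: nu_ge0 nrm_is_norm _.
have [ij Aij] := mx_norm_neq0 A0; rewrite [leLHS]/Num.norm /= Aij.
by rewrite (le_trans (norm_le_l1 _)) // of_real_le l1_le_nrm.
Qed.

(** There are [m * m] entries, each with two coordinates; one more keeps the
    ratio positive when [m = 0]. *)
Definition norm_ratio : R := (m * m * 2).+1%:R.

Lemma norm_ratio_gt0 : 0 < norm_ratio. Proof. exact: ltr0Sn. Qed.

Lemma nrm_le_norm A (c : R) : `|A| <= c%:K -> nrm A <= norm_ratio * c.
Proof.
move=> Ac; have c0 : 0 <= c.
  by rewrite -(of_real_le k) rmorph0 (le_trans _ Ac).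
have h i j : l1 (A i j) <= c *+ 2.
  apply: l1_le_norm; apply: le_trans Ac.
  rewrite [leRHS]/Num.norm /= mx_normE -[leLHS]nngE num_le.
  exact: (le_bigmax _ (fun ij : 'I_m * 'I_m => `|A ij.1 ij.2|%:nng) (i, j)).
apply: (@le_trans _ _ (\sum_(i < m) \sum_(j < m) c *+ 2)).
  by apply: ler_sum => i _; apply: ler_sum => j _.
rewrite !sumr_const !card_ord -!mulrnA -mulr_natl ler_wpM2r // ler_nat.
by apply: leqW; rewrite mulnC.
Qed.

(** Both norms define the same convergence, which turns topological limits into
    real estimates. *)
Lemma cvg_nrm {T : Type} {F : set_system T} {FF : Filter F} (f : T -> 'M[K]_m) (l : 'M[K]_m) :
  f @ F --> l <-> forall e : R, 0 < e -> \forall t \near F, nrm (f t - l) <= e.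
Proof.
rewrite cvgrPdistC_le; split => h.
  move=> e e0; have /h : 0 < (e / norm_ratio)%:K.
    by rewrite -(rmorph0 (of_real k)) of_real_lt divr_gt0 // norm_ratio_gt0.
  apply: filterS => t /nrm_le_norm; rewrite mulrC divfK //.
  by rewrite gt_eqF // norm_ratio_gt0.
move=> _ /pos_of_real[e e0 ->]; apply: filterS (h e e0) => t te.
by rewrite (le_trans (norm_le_nrm _)) // of_real_le.
Qed.

Lemma cvgn_nrm (u : nat -> 'M[K]_m) (l : 'M[K]_m) : u @ \oo --> l <-> converges nrm u l.
Proof.
rewrite cvg_nrm; split=> h e e0.
  by have [N _ hN] := h e e0; exists N.
by have [N hN] := h e e0; exists N.
Qed.

Lemma limn_nrm (u : nat -> 'M[K]_m) l : converges nrm u l -> limn u = l.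
Proof. by move/cvgn_nrm/cvg_lim; apply; exact: norm_hausdorff. Qed.

Lemma closure_nrm (G : set 'M[K]_m) (u : nat -> 'M[K]_m) l :
  (forall p, G (u p)) -> converges nrm u l -> closure G l.
Proof.
move=> Gu /cvgn_nrm ul B /ul[N _ hN]; exists (u N); split => //.
by apply: hN => /=.
Qed.

End MatrixNorm.

(** * Powers and power series near the identity *)

Section PowerEstimates.
Variables (R : realType) (A : pzRingType) (nu : A -> R).
Hypothesis nuP : is_norm nu.
Hypothesis nuM : forall x y, nu (x * y) <= nu x * nu y.

Lemma expr_mul_le q y z p : 0 <= q -> (forall z, nu (z * y) <= q * nu z) ->
  nu (z * y ^+ p) <= q ^+ p * nu z.
Proof.
move=> q0 hy; elim: p => [|p IH]; first by rewrite !expr0 mulr1 mul1r.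
by rewrite exprSr mulrA (le_trans (hy _)) // exprS -mulrA ler_wpM2l.
Qed.

(** Telescoping. The factors are controlled through their action by
    multiplication, not through their norm: the identity matrix has norm [m],
    but a matrix at distance [rho] from it multiplies norms by at most
    [1 + rho]. *)
Lemma expr_dist q x y p : 0 <= q ->
  (forall z, nu (x * z) <= q * nu z) -> (forall z, nu (z * y) <= q * nu z) ->
  nu (x ^+ p.+1 - y ^+ p.+1) <= p.+1%:R * q ^+ p * nu (x - y).
Proof.
move=> q0 hx hy; elim: p => [|p IH]; first by rewrite !expr1 expr0 !mul1r.
have -> : x ^+ p.+2 - y ^+ p.+2 =
    x * (x ^+ p.+1 - y ^+ p.+1) + (x - y) * y ^+ p.+1.
  by rewrite mulrBr mulrBl -!exprS addrA subrK.
apply: (le_trans (nuD nuP _ _)).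
apply: (le_trans (lerD (hx _) (expr_mul_le (x - y) p.+1 q0 hy))).
have h : q * nu (x ^+ p.+1 - y ^+ p.+1) <= q * (p.+1%:R * q ^+ p * nu (x - y)).
  by rewrite ler_wpM2l.
apply: (le_trans (lerD h (lexx _))).
by rewrite [q ^+ p.+1]exprS -[p.+2]addn1 natrD; lra.
Qed.

Lemma mulr_near1l rho x z : nu (x - 1) <= rho -> nu (x * z) <= (1 + rho) * nu z.
Proof.
move=> hx; have -> : x * z = z + (x - 1) * z by rewrite mulrBl mul1r subrKC.
rewrite [leRHS]mulrDl mul1r (le_trans (nuD nuP _ _)) // lerD2l (le_trans (nuM _ _)) //.
by rewrite ler_wpM2r // (nu_ge0 nuP).
Qed.

Lemma mulr_near1r rho x z : nu (x - 1) <= rho -> nu (z * x) <= (1 + rho) * nu z.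
Proof.
move=> hx; have -> : z * x = z + z * (x - 1) by rewrite mulrBr mulr1 subrKC.
rewrite [leRHS]mulrDl mul1r (le_trans (nuD nuP _ _)) // lerD2l (le_trans (nuM _ _)) // mulrC.
by rewrite ler_wpM2r // (nu_ge0 nuP).
Qed.

(** Second-order Taylor estimate of [x ^+ p] at [1], in Lipschitz form. *)
Lemma expr_dist1 rho x y p : nu (x - 1) <= rho -> nu (y - 1) <= rho ->
  nu (x ^+ p - y ^+ p - (x - y) *+ p) <=
    p%:R ^+ 2 * rho * (1 + rho) ^+ p * nu (x - y).
Proof.
move=> hx hy; have r0 : 0 <= rho := le_trans (nu_ge0 nuP _) hx.
have q0 : 0 <= 1 + rho by rewrite addr_ge0.
have q1 : 1 <= 1 + rho by rewrite lerDl.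
have hy1 j : nu (y ^+ j - 1) <= j%:R * rho * (1 + rho) ^+ j.
  elim: j => [|j IH]; first by rewrite expr0 subrr (nu0 nuP) !mul0r.
  have -> : y ^+ j.+1 - 1 = (y ^+ j - 1) * y + (y - 1).
    by rewrite mulrBl mul1r -exprSr subrKA.
  apply: (le_trans (nuD nuP _ _)).
  apply: (le_trans (lerD (mulr_near1r _ hy) hy)).
  have h : (1 + rho) * nu (y ^+ j - 1) <=
      (1 + rho) * (j%:R * rho * (1 + rho) ^+ j) by rewrite ler_wpM2l.
  have h' : rho <= rho * (1 + rho) ^+ j.+1 by rewrite ler_peMr // exprn_ege1.
  apply: (le_trans (lerD h h')).
  by rewrite [(1 + rho) ^+ j.+1]exprS -[j.+1]addn1 natrD; lra.
have hxy j : nu (x ^+ j - y ^+ j) <= j%:R * (1 + rho) ^+ j * nu (x - y).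
  case: j => [|j]; first by rewrite subrr (nu0 nuP) !mul0r.
  have h z : nu (x * z) <= (1 + rho) * nu z by exact: mulr_near1l.
  have h' z : nu (z * y) <= (1 + rho) * nu z by exact: mulr_near1r.
  apply: (le_trans (expr_dist j q0 h h')).
  rewrite ler_wpM2r ?(nu_ge0 nuP) // ler_wpM2l // exprS ler_peMl //.
  exact: exprn_ge0.
elim: p => [|p IH].
  by rewrite !expr0 mulr0n !subr0 subrr (nu0 nuP) expr0n !mul0r.
have -> : x ^+ p.+1 - y ^+ p.+1 - (x - y) *+ p.+1 =
    (x ^+ p - y ^+ p - (x - y) *+ p) + (x - 1) * (x ^+ p - y ^+ p)
    + (x - y) * (y ^+ p - 1).
  have -> : x ^+ p.+1 - y ^+ p.+1 =
      (x - 1) * (x ^+ p - y ^+ p) + (x ^+ p - y ^+ p) +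
      ((x - y) * (y ^+ p - 1) + (x - y)).
    rewrite [_ * (y ^+ p - 1)]mulrBr mulr1 subrK mulrBl mul1r subrK.
    by rewrite mulrBr mulrBl -!exprS subrKA.
  rewrite mulrS addrA addrKA [X in X + _ - _]addrC addrAC.
  by congr (_ + _); rewrite addrAC.
apply: (le_trans (nuD nuP _ _)).
apply: (le_trans (lerD (nuD nuP _ _) (lexx _))).
have h1 : nu ((x - 1) * (x ^+ p - y ^+ p)) <=
    rho * (p%:R * (1 + rho) ^+ p * nu (x - y)).
  by apply: (le_trans (nuM _ _)); rewrite ler_pM // (nu_ge0 nuP).
have h2 : nu ((x - y) * (y ^+ p - 1)) <=
    nu (x - y) * (p%:R * rho * (1 + rho) ^+ p).
  by apply: (le_trans (nuM _ _)); rewrite ler_pM // (nu_ge0 nuP).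
apply: (le_trans (lerD (lerD IH h1) h2)).
have -> : p%:R ^+ 2 * rho * (1 + rho) ^+ p * nu (x - y) +
    rho * (p%:R * (1 + rho) ^+ p * nu (x - y)) +
    nu (x - y) * (p%:R * rho * (1 + rho) ^+ p) =
    (p%:R ^+ 2 + p%:R *+ 2) * (rho * (1 + rho) ^+ p * nu (x - y)) by ring.
have -> : p.+1%:R ^+ 2 * rho * (1 + rho) ^+ p.+1 * nu (x - y) =
    p.+1%:R ^+ 2 * (rho * (1 + rho) ^+ p.+1 * nu (x - y)) by ring.
apply: ler_pM.
- by rewrite addr_ge0 ?exprn_ge0 ?mulrn_wge0.
- by rewrite !mulr_ge0 ?exprn_ge0 ?(nu_ge0 nuP).
- by rewrite -[p.+1]addn1 natrD; lra.
- rewrite ler_wpM2r ?(nu_ge0 nuP) // ler_wpM2l // exprS ler_peMl //.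
  exact: exprn_ge0.
Qed.

End PowerEstimates.

Section Series.
Variable R : realType.

(** Comparison test of Weierstrass. *)
Lemma partial_sum_converges (E : zmodType) (nu : E -> R) (T : nat -> E)
    (b : nat -> R) (B : R) (i0 : nat) :
  is_norm nu -> is_complete nu -> (forall p, nu (T p) <= b p) ->
  (forall N, \sum_(i0 <= p < N) b p <= B) ->
  exists2 l, converges nu (fun N => \sum_(i0 <= p < N) T p) l & nu l <= B.
Proof.
move=> nuP complete Tb bB.
have b0 p : 0 <= b p by exact: le_trans (nu_ge0 nuP _) (Tb p).
pose s N := \sum_(i0 <= p < N) b p.
have sT N N' : (N <= N')%N ->
    nu (\sum_(i0 <= p < N') T p - \sum_(i0 <= p < N) T p) <= s N' - s N.
  move=> /subnKC <-; elim: (N' - N)%N => [|j IH].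
    by rewrite addn0 !subrr (nu0 nuP).
  rewrite addnS; have [ij|ij] := leqP i0 (N + j).
    rewrite /s !big_nat_recr //= [X in nu X]addrAC [leRHS]addrAC.
    by rewrite (le_trans (nuD nuP _ _)) // lerD.
  have iN : (N <= i0)%N by rewrite (leq_trans (leq_addr j N)) // ltnW.
  by rewrite /s !(big_geq ij) !(big_geq iN) !subrr (nu0 nuP).
have s_ndecr : {homo s : p q / (p <= q)%N >-> p <= q}.
  move=> p q pq; rewrite -subr_ge0; apply: le_trans (sT _ _ pq); exact: nu_ge0.
have /cvg_ex[l /cvgn_converges sl] : cvgn s.
  by apply: nondecreasing_is_cvgn => //; exists B => _ [N _ <-]; exact: bB.
have [|L cL] := complete (fun N => \sum_(i0 <= p < N) T p).
  move=> e e0; have [N hN] := sl _ (divr_gt0 e0 (ltr0Sn R 1)).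
  exists N => p q Np pq; apply: (le_trans (sT _ _ pq)).
  rewrite -(subrKA l) [leRHS]splitr lerD //.
    by rewrite (le_trans (ler_norm _)) // hN // (leq_trans Np).
  by rewrite (le_trans (ler_norm _)) // distrC hN.
exists L => //; apply: (converges_le (N0 := 0%N) nuP cL) => N _.
apply: le_trans (bB N); apply: (le_trans (nu_sum nuP _ _ _)).
by apply: ler_sum.
Qed.

Lemma exp_partial_le (x : R) N : 0 <= x ->
  \sum_(0 <= p < N) (p`!%:R)^-1 * x ^+ p <= expR x.
Proof.
move=> x0; have -> : \sum_(0 <= p < N) (p`!%:R)^-1 * x ^+ p = series (exp_coeff x) N.
  by rewrite /series /=; apply: eq_bigr => p _; rewrite /exp_coeff /= mulrC.
rewrite /expR; apply: nondecreasing_cvgn_le; last exact: is_cvg_series_exp_coeff.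
by apply: nondecreasing_series => p _ _; exact: exp_coeff_ge0.
Qed.

Lemma expR_remainder (y : R) : 0 <= y -> expR y - (1 + y) <= y ^+ 2 * expR y.
Proof.
move=> y0; have h := expR_ge1Dx (- y).
have h1 : expR y - 1 <= y * expR y.
  have : (1 - y) * expR y <= expR (- y) * expR y.
    by rewrite ler_wpM2r // expR_ge0.
  rewrite -expRD addNr expR0; lra.
have h2 : y * (expR y - 1) <= y * (y * expR y) by rewrite ler_wpM2l.
by rewrite expr2; lra.
Qed.

(** Quantitative form of the limit of [(1 + a / n) ^+ n]; the matrix version is
    dominated by it term by term. *)
Lemma expR_compound (a : R) (n : nat) : 0 <= a ->
  expR a - (1 + a / n.+1%:R) ^+ n.+1 <= a ^+ 2 * expR a / n.+1%:R.
Proof.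
move=> a0; set y := a / n.+1%:R.
have n0 : n.+1%:R != 0 :> R by rewrite pnatr_eq0.
have y0 : 0 <= y by rewrite divr_ge0.
have ea : expR a = expR y ^+ n.+1.
  by rewrite -expRM_natl /y mulrCA divff ?mulr1.
have q0 := expR_ge0 y.
have hx z : `|expR y * z| <= expR y * `|z| by rewrite normrM ger0_norm.
have hy z : `|z * (1 + y)| <= expR y * `|z|.
  rewrite normrM mulrC ler_wpM2r // ger0_norm ?expR_ge1Dx //.
  by rewrite addr_ge0.
have := expr_dist (real_is_norm R) n q0 hx hy.
rewrite -ea => /(le_trans (ler_norm _)) /le_trans; apply.
have h : `|expR y - (1 + y)| <= y ^+ 2 * expR y.
  by rewrite ger0_norm ?expR_remainder // subr_ge0 expR_ge1Dx.
apply: (le_trans (ler_wpM2l _ h)); first by rewrite mulr_ge0 // exprn_ge0.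
rewrite ea [expR y ^+ n.+1]exprSr; set e := expR y; set e' := e ^+ n; rewrite /y.
by rewrite le_eqVlt; apply/orP; left; apply/eqP; field.
Qed.

End Series.

(** * The matrix exponential *)

Section MatrixExp.
Variables (R : realType) (k : base_field) (m : nat).
Local Notation K := (scalars R k).
Local Notation "x %:K" := (of_real k x) (at level 2, format "x %:K").
Local Notation nrm := (@nrm R k m).
Local Notation nrmP := (@nrm_is_norm R k m).
Implicit Types A B C Z : 'M[K]_m.

Lemma nrm_mul A B : nrm (A * B) <= nrm A * nrm B. Proof. exact: nrmM. Qed.

Lemma nrm_ge0 A : 0 <= nrm A. Proof. exact: nu_ge0 nrmP _. Qed.

Lemma nrmX_le A p : nrm (A ^+ p) <= nrm A ^+ p * nrm 1.
Proof.
rewrite -[A ^+ p]mul1r; apply: expr_mul_le; first exact: nrm_ge0.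
by move=> Z; rewrite mulrC; exact: nrm_mul.
Qed.

Lemma fact_inv_of_real p : (p`!%:R)^-1 = ((p`!%:R)^-1)%:K :> K.
Proof. by rewrite fmorphV rmorph_nat. Qed.

Lemma exprZ_mx (t : K) A p : (t *: A) ^+ p = t ^+ p *: A ^+ p.
Proof.
elim: p => [|p IH]; first by rewrite !expr0 scale1r.
by rewrite !exprS IH -!mulmxE -scalemxAl -scalemxAr scalerA.
Qed.

Definition exp_series A N : 'M[K]_m :=
  \sum_(0 <= p < N) ((p`!%:R)^-1 : R)%:K *: A ^+ p.

Lemma expmx_converges A : converges nrm (exp_series A) (expmx A).
Proof.
have [|N|l cl _] := @partial_sum_converges R _ nrm
  (fun p => ((p`!%:R)^-1 : R)%:K *: A ^+ p)
  (fun p => ((p`!%:R)^-1 * nrm A ^+ p) * nrm 1) (expR (nrm A) * nrm 1) 0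
  nrmP (@nrm_is_complete R k m).
- move=> p; rewrite nrmZ ger0_norm ?invr_ge0 ?ler0n // -mulrA.
  by rewrite ler_wpM2l ?invr_ge0 ?ler0n // nrmX_le.
- rewrite -mulr_suml ler_wpM2r ?nrm_ge0 //.
  by apply: exp_partial_le; exact: nrm_ge0.
- suff -> : expmx A = l by [].
  apply: limn_nrm; apply: (converges_near (N0 := 0%N) cl) => N _.
  by apply: eq_bigr => p _; rewrite fact_inv_of_real.
Qed.

Lemma expmx0 : expmx (0 : 'M[K]_m) = 1.
Proof.
apply: (converges_unique nrmP (expmx_converges 0)).
apply: (converges_near (N0 := 1%N) (converges_cst nrmP 1)) => -[//|N] _.
rewrite /exp_series big_nat_recl //= fact0 invr1 rmorph1 scale1r expr0.
rewrite big1_seq ?addr0 // => p _.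
by rewrite exprS mul0r scaler0.
Qed.

Lemma fact_succ_le p : ((p.+1)`!%:R)^-1 * p.+1%:R = (p`!%:R)^-1 :> R.
Proof.
rewrite factS natrM invfM mulrAC mulVf ?mul1r // pnatr_eq0.
Qed.

(** The constant and linear terms of the series cancel; [expr_dist] bounds the
    others, with a factor [q] to spare. *)
Lemma expmx_dist q A B : nrm A <= q -> nrm B <= q ->
  nrm (expmx A - expmx B - (A - B)) <= q * expR q * nrm (A - B).
Proof.
move=> hA hB; have q0 : 0 <= q := le_trans (nrm_ge0 _) hA.
have hl Z : nrm (A * Z) <= q * nrm Z.
  by rewrite (le_trans (nrm_mul _ _)) // ler_wpM2r ?nrm_ge0.
have hr Z : nrm (Z * B) <= q * nrm Z.
  by rewrite (le_trans (nrm_mul _ _)) // mulrC ler_wpM2r ?nrm_ge0.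
have cAB := convergesB nrmP (expmx_converges A) (expmx_converges B).
apply: (converges_le_dist (N0 := 2%N) nrmP cAB) => -[//|[//|N]] _.
rewrite /exp_series -sumrB 2?big_nat_recl //= !expr0 subrr add0r.
rewrite !expr1 factS fact0 muln1 invr1 rmorph1 !scale1r.
rewrite addrC addKr; apply: (le_trans (nu_sum nrmP _ _ _)).
apply: (@le_trans _ _ (\sum_(0 <= p < N) (q * nrm (A - B)) *
   ((p`!%:R)^-1 * q ^+ p))).
  apply: ler_sum => p _; rewrite -scalerBr nrmZ ger0_norm ?invr_ge0 ?ler0n //.
  have h := expr_dist nrmP p.+1 q0 hl hr.
  apply: (le_trans (ler_wpM2l _ h)); first by rewrite invr_ge0.
  rewrite !mulrA fact_succ_le exprS.
  have hf : ((p.+1)`!%:R)^-1 <= (p`!%:R)^-1 :> R.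
    by rewrite lef_pV2 ?posrE ?ltr0n ?fact_gt0 // ler_nat factS leq_pmull.
  have := ler_wpM2r (_ : 0 <= q * q ^+ p * nrm (A - B)) hf.
  rewrite !mulr_ge0 ?exprn_ge0 ?nrm_ge0 // => /(_ isT).
  by rewrite !mulrA => /le_trans; apply; rewrite le_eqVlt; apply/orP; left;
    apply/eqP; ring.
rewrite -mulr_sumr [leRHS]mulrAC ler_wpM2l ?mulr_ge0 ?nrm_ge0 //.
exact: exp_partial_le.
Qed.

Lemma expmx_near1 q A : nrm A <= q -> nrm (expmx A - 1 - A) <= q * expR q * nrm A.
Proof.
move=> hA; have := @expmx_dist q A 0 hA; rewrite (nu0 nrmP) expmx0 !subr0.
by apply; exact: le_trans (nrm_ge0 _) hA.
Qed.

Lemma binom_fact_le (n p : nat) :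
  ('C(n, p))%:R / n%:R ^+ p <= (p`!%:R)^-1 :> R.
Proof.
have [->|n0] := eqVneq n 0%N.
  case: p => [|p]; first by rewrite bin0 expr0 fact0 divr1 invr1.
  by rewrite bin0n mul0r invr_ge0.
have np : 0 < n%:R ^+ p :> R by rewrite exprn_gt0 // ltr0n lt0n.
rewrite ler_pdivrMr // -div1r mulrAC mul1r ler_pdivlMr ?ltr0n ?fact_gt0 //.
rewrite -natrM -natrX ler_nat bin_ffact.
elim: p {np} => [|p IH]; first by rewrite ffactn0.
by rewrite ffactnSr expnSr leq_mul // leq_subr.
Qed.

(** The coefficients ['C(n, p) / n ^+ p] lie below those of the exponential
    series, so the error is at most the error of the same limit at the real
    number [nrm C]. *)
Lemma compound_converges C :
  converges nrm (fun n => (1 + (n.+1%:R^-1)%:K *: C) ^+ n.+1) (expmx C).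
Proof.
set a := nrm C; have a0 : 0 <= a := nrm_ge0 C.
apply: (converges_squeeze (b := fun n => a ^+ 2 * expR a / n.+1%:R)).
  by apply: null_inv; rewrite mulr_ge0 ?exprn_ge0 ?expR_ge0.
move=> n; rewrite nu_distC; last exact: nrmP.
apply: le_trans (expR_compound n a0).
apply: (converges_le_dist (N0 := n.+2) nrmP (expmx_converges C)) => P nP.
pose b p : R := ('C(n.+1, p))%:R / n.+1%:R ^+ p.
have bX (t : R) : (1 + t / n.+1%:R) ^+ n.+1 = \sum_(0 <= p < P) b p * t ^+ p.
  rewrite addrC exprD1n big_mkord (big_ord_widen P (fun p => (t / n.+1%:R) ^+ p *+ 'C(n.+1, p))) //.
  rewrite big_mkcond /=; apply: eq_bigr => p _; rewrite /b.
  case: ltnP => pn; last by rewrite bin_small // !mul0r.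
  by rewrite exprMn exprVn -mulr_natl mulrA mulrAC -mulrA mulrCA mulrA.
have bC : (1 + (n.+1%:R^-1)%:K *: C) ^+ n.+1 = \sum_(0 <= p < P) (b p)%:K *: C ^+ p.
  rewrite addrC exprD1n big_mkord (big_ord_widen P (fun p => ((n.+1%:R^-1)%:K *: C) ^+ p *+ 'C(n.+1, p))) //.
  rewrite big_mkcond /=; apply: eq_bigr => p _; rewrite /b.
  case: ltnP => pn; last by rewrite bin_small // mul0r rmorph0 scale0r.
  by rewrite exprZ_mx -scaler_nat scalerA rmorphM rmorph_nat -exprVn rmorphXn.
rewrite bX bC /exp_series -sumrB.
apply: (le_trans (nu_sum nrmP _ _ _)).
apply: (@le_trans _ _ (\sum_(0 <= p < P) ((p`!%:R)^-1 - b p) * a ^+ p)).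
  apply: ler_sum => -[|p] _.
    by rewrite /b fact0 bin0 expr0 !divr1 invr1 subrr rmorph1 subrr (nu0 nrmP) mul0r.
  rewrite -scalerBl -rmorphB nrmZ ger0_norm; last by rewrite subr_ge0 binom_fact_le.
  rewrite ler_wpM2l ?subr_ge0 ?binom_fact_le //.
  rewrite exprS [a ^+ _]exprSr -[C in C ^+ p]/C.
  apply: (@expr_mul_le _ _ nrm a); first exact: nrm_ge0.
  by move=> Z; rewrite mulrC; exact: nrm_mul.
under eq_bigr do rewrite mulrBl.
by rewrite sumrB lerD2r exp_partial_le.
Qed.

(** Chernoff-type product formula: first-order approximations of [1 + C / n]
    have the same [n]-fold powers in the limit. *)
Lemma expmx_limit C (c : nat -> 'M[K]_m) (K0 : R) :
  (forall n, nrm (c n - (1 + (n.+1%:R^-1)%:K *: C)) <= K0 / n.+1%:R ^+ 2) ->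
  converges nrm (fun n => c n ^+ n.+1) (expmx C).
Proof.
move=> hc; set a := nrm C; have a0 : 0 <= a := nrm_ge0 C.
have K00 : 0 <= K0.
  by have := hc 0%N; rewrite expr1n divr1; apply: le_trans; exact: nrm_ge0.
pose d n := 1 + (n.+1%:R^-1)%:K *: C.
have cd : converges nrm (fun n => c n ^+ n.+1 - d n ^+ n.+1) 0.
  apply: (converges_squeeze (b := fun n => K0 * expR (a + K0) / n.+1%:R)).
    by apply: null_inv; rewrite mulr_ge0 ?expR_ge0.
  move=> n; rewrite subr0.
  have n0 : (0 : R) < n.+1%:R by rewrite ltr0n.
  pose r := (a + K0) / n.+1%:R.
  have r0 : 0 <= r by rewrite divr_ge0 ?addr_ge0 // ltW.
  have dr : nrm (d n - 1) <= a / n.+1%:R.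
    by rewrite /d [1 + _]addrC addrK nrmZ ger0_norm ?invr_ge0 // mulrC.
  have dr' : nrm (d n - 1) <= r.
    by rewrite (le_trans dr) // ler_wpM2r ?invr_ge0 // lerDl.
  have cr : nrm (c n - 1) <= r.
    rewrite (le_trans (nu_dist_trans nrmP (d n) _ _)) // /r mulrDl addrC lerD //.
    apply: (le_trans (hc n)); rewrite ler_wpM2l // lef_pV2 ?posrE ?exprn_gt0 //.
    by rewrite expr2 ler_peMl ?ler1n // ltW.
  have q0 : 0 <= 1 + r by rewrite addr_ge0.
  have h := expr_dist nrmP n q0 (fun z => mulr_near1l nrmP nrm_mul z cr)
    (fun z => mulr_near1r nrmP nrm_mul z dr').
  apply: (le_trans h).
  have qn : (1 + r) ^+ n <= expR (a + K0).
    have -> : expR (a + K0) = expR r ^+ n.+1.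
      by rewrite -expRM_natl /r mulrCA divff ?mulr1 // gt_eqF.
    apply: (@le_trans _ _ ((1 + r) ^+ n.+1)).
      by rewrite exprS ler_peMl ?exprn_ge0 // lerDl.
    by rewrite lerXn2r ?nnegrE ?expR_ge0 // expR_ge1Dx.
  have -> : K0 * expR (a + K0) / n.+1%:R =
      n.+1%:R * expR (a + K0) * (K0 / n.+1%:R ^+ 2).
    by field; rewrite gt_eqF.
  apply: ler_pM (hc n); rewrite ?nrm_ge0 ?mulr_ge0 ?exprn_ge0 //.
  by rewrite ler_wpM2l.
have := convergesD nrmP cd (compound_converges C); rewrite add0r => h.
by apply: (converges_near (N0 := 0%N) h) => n _; rewrite subrK.
Qed.

Lemma convergesM (u v : nat -> 'M[K]_m) l l' :
  converges nrm u l -> converges nrm v l' -> converges nrm (fun n => u n * v n) (l * l').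
Proof.
move=> cu cv e e0; set s := 1 + nrm l + nrm l'.
have s0 : 0 < s by have := nrm_ge0 l; have := nrm_ge0 l'; rewrite /s; lra.
pose e' := Num.min 1 (e / s).
have e'0 : 0 < e' by rewrite lt_min ltr01 divr_gt0.
have [N hN] := cu _ e'0; have [N' hN'] := cv _ e'0; exists (maxn N N') => p.
rewrite geq_max => /andP[/hN h /hN' h'].
have -> : u p * v p - l * l' =
    (u p - l) * (v p - l') + (u p - l) * l' + l * (v p - l').
  by rewrite -mulrDr subrK mulrBl mulrBr subrKA.
have e'1 : e' <= 1 by rewrite ge_min lexx.
have := ge_min (e / s) 1 (e / s); rewrite lexx orbT => e's.
apply: (@le_trans _ _ (e' * s)); last by rewrite -ler_pdivlMr.
have h1 : nrm ((u p - l) * (v p - l')) <= e' * 1.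
  by rewrite (le_trans (nrm_mul _ _)) // ler_pM ?nrm_ge0 // (le_trans h').
have h2 : nrm ((u p - l) * l') <= e' * nrm l'.
  by rewrite (le_trans (nrm_mul _ _)) // ler_wpM2r ?nrm_ge0.
have h3 : nrm (l * (v p - l')) <= nrm l * e'.
  by rewrite (le_trans (nrm_mul _ _)) // ler_wpM2l ?nrm_ge0.
rewrite (le_trans (nuD nrmP _ _)) // (le_trans (lerD (nuD nrmP _ _) h3)) //.
by rewrite (le_trans (lerD (lerD h1 h2) (lexx _))) // /s; lra.
Qed.

(** The product of [1 + A / n] and [1 - A / n] differs from [1] by
    [O(1 / n ^+ 2)], hence its [n]-th powers tend to [expmx 0]. *)
Lemma expmxN A : expmx A * expmx (- A) = 1.
Proof.
have cA := convergesM (compound_converges A) (compound_converges (- A)).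
apply: (converges_unique nrmP cA); rewrite -[X in converges _ _ X]expmx0.
pose c n := (1 + (n.+1%:R^-1)%:K *: A) * (1 + (n.+1%:R^-1)%:K *: - A).
have cE n : c n = 1 - (n.+1%:R^-1 ^+ 2)%:K *: A ^+ 2.
  rewrite /c scalerN mulrBr mulr1 mulrDl mul1r opprD addrA addrK.
  by rewrite -expr2 exprZ_mx rmorphXn.
apply: (converges_near (N0 := 0%N) (u := fun n => c n ^+ n.+1)).
  apply: (@expmx_limit _ _ (nrm (A ^+ 2))) => n.
  rewrite scaler0 addr0 cE addrAC subrr add0r (nuN nrmP) nrmZ.
  by rewrite ger0_norm ?exprn_ge0 ?invr_ge0 // mulrC exprVn.
move=> n _; rewrite /c exprMn_comm // /GRing.comm scalerN.
rewrite mulrBr mulrBl; congr (_ - _); first by rewrite mulr1 mul1r.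
by rewrite mulrDr mulrDl mulr1 mul1r.
Qed.

Lemma expmx_unit A : expmx A \in unitmx.
Proof. by have /mulmx1_unit[] := expmxN A. Qed.

Lemma expmx_continuous (u : nat -> 'M[K]_m) l :
  converges nrm u l -> converges nrm (fun n => expmx (u n)) (expmx l).
Proof.
move=> cu e e0; set q := nrm l + 1.
have q0 : 0 < q by rewrite ltr_wpDl ?nrm_ge0.
have s0 : 0 < 1 + q * expR q by rewrite ltr_pwDl // mulr_ge0 ?expR_ge0 // ltW.
have [N hN] := cu _ (divr_gt0 e0 s0); have [N' hN'] := cu _ ltr01.
exists (maxn N N') => p; rewrite geq_max => /andP[/hN h /hN' h'].
have uq : nrm (u p) <= q by rewrite (le_trans (nu_le_dist nrmP _ l)) // lerD2l.
have lq : nrm l <= q by rewrite lerDl.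
apply: (le_trans (nu_le_dist nrmP _ (u p - l))).
apply: (le_trans (lerD (lexx _) (expmx_dist uq lq))).
rewrite -[X in X + _]mul1r -mulrDl mulrC.
by rewrite -ler_pdivlMr.
Qed.

End MatrixExp.

(** * The Lie algebra of a matrix group *)

Section LieAlgebra.
Variables (R : realType) (k : base_field) (m : nat).
Local Notation K := (scalars R k).
Local Notation "x %:K" := (of_real k x) (at level 2, format "x %:K").
Local Notation nrm := (@nrm R k m).
Local Notation nrmP := (@nrm_is_norm R k m).
Implicit Types A B C Z : 'M[K]_m.
Variable G : set 'M[K]_m.
Hypothesis Glie : matrix_lie_group G.
Local Notation g := (lie_algebra G).

Lemma lie_group_unit Z : G Z -> Z \in unitmx. Proof. by case: Glie => h _ _ _ _ /h. Qed.
Lemma lie_group1 : G 1. Proof. by case: Glie. Qed.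
Lemma lie_groupM A Z : G A -> G Z -> G (A *m Z).
Proof. by case: Glie => _ _ h _ _; exact: h. Qed.
Lemma lie_groupV Z : G Z -> G (invmx Z).
Proof. by case: Glie => _ _ _ h _; exact: h. Qed.

Lemma lie_groupX Z p : G Z -> G (Z ^+ p).
Proof.
move=> GZ; elim: p => [|p IH]; first by rewrite expr0; exact: lie_group1.
by rewrite exprS; exact: lie_groupM.
Qed.

(** The group is closed among invertible matrices only, so invertibility of the
    limit has to come from elsewhere. *)
Lemma lie_group_limit (u : nat -> 'M[K]_m) Z : (forall p, G (u p)) ->
  converges nrm u Z -> Z \in unitmx -> G Z.
Proof.
case: Glie => _ _ _ _ h Gu uZ Zu; apply: h; split => //.
exact: closure_nrm Gu uZ.
Qed.

Lemma lie0 : g 0.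
Proof. by move=> t; rewrite scaler0 expmx0; exact: lie_group1. Qed.

Lemma lieZ (s : R) A : g A -> g (s%:K *: A).
Proof. by move=> gA t; rewrite scalerA -rmorphM; exact: gA. Qed.

Lemma lieN A : g A -> g (- A).
Proof. by move=> /(lieZ (-1)); rewrite rmorphN1 scaleN1r. Qed.

Lemma lie_converges (u : nat -> 'M[K]_m) A :
  (forall p, g (u p)) -> converges nrm u A -> g A.
Proof.
move=> gu cu t; apply: (@lie_group_limit (fun p => expmx (t%:K *: u p))) => [p||].
- exact: gu.
- apply: expmx_continuous => e e0.
  have s0 : 0 < 1 + `|t| by rewrite ltr_pwDl.
  have [N hN] := cu _ (divr_gt0 e0 s0); exists N => p /hN h.
  rewrite -scalerBr nrmZ; apply: (@le_trans _ _ ((1 + `|t|) * nrm (u p - A))).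
    by rewrite ler_wpM2r ?nrm_ge0 // lerDr.
  by rewrite mulrC -ler_pdivlMr.
- exact: expmx_unit.
Qed.

(** Trotter's product formula keeps one-parameter subgroups of a sum in [G]. *)
Lemma lieD A B : g A -> g B -> g (A + B).
Proof.
move=> gA gB t.
pose c n := expmx ((n.+1%:R^-1 * t)%:K *: A) * expmx ((n.+1%:R^-1 * t)%:K *: B).
apply: (@lie_group_limit (fun n => c n ^+ n.+1)); last exact: expmx_unit.
  by move=> n; apply/lie_groupX/lie_groupM; [exact: gA|exact: gB].
set s := `|t| * nrm A + `|t| * nrm B; set s' := s + s ^+ 2 * expR s.
have sA0 : 0 <= `|t| * nrm A by rewrite mulr_ge0 ?nrm_ge0.
have sB0 : 0 <= `|t| * nrm B by rewrite mulr_ge0 ?nrm_ge0.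
have s0 : 0 <= s by rewrite addr_ge0.
apply: (@expmx_limit _ _ _ _ _ (s ^+ 2 * expR s + s ^+ 2 * expR s + s' ^+ 2)) => n.
set i := n.+1%:R^-1; have i0 : 0 <= i :> R by rewrite invr_ge0.
have i1 : i <= 1 :> R by rewrite invf_le1 ?ltr0n // ler1n.
have near D : `|t| * nrm D <= s ->
    nrm (expmx ((i * t)%:K *: D) - 1 - (i * t)%:K *: D) <= i ^+ 2 * (s ^+ 2 * expR s)
    /\ nrm (expmx ((i * t)%:K *: D) - 1) <= i * s'.
  move=> Ds; set X := _ *: D.
  have hX : nrm X <= i * s.
    by rewrite /X nrmZ normrM ger0_norm // -mulrA ler_wpM2l.
  have is0 : 0 <= i * s by rewrite mulr_ge0.
  have iss : i * s <= s by rewrite ler_piMl.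
  have h1 : nrm (expmx X - 1 - X) <= i ^+ 2 * (s ^+ 2 * expR s).
    apply: (le_trans (expmx_near1 hX)).
    have -> : i ^+ 2 * (s ^+ 2 * expR s) = i * s * expR s * (i * s) by ring.
    by rewrite ler_pM ?nrm_ge0 ?mulr_ge0 ?expR_ge0 // ler_wpM2l // ler_expR.
  split => //; apply: (le_trans (nu_le_dist nrmP _ X)).
  apply: (le_trans (lerD hX h1)); rewrite [leRHS]mulrDr lerD2l.
  by rewrite ler_wpM2r ?mulr_ge0 ?exprn_ge0 ?expR_ge0 // expr2 ler_piMl.
have [|A1 A2] := near A; first by rewrite lerDl.
have [|B1 B2] := near B; first by rewrite lerDr.
rewrite /c -/i scalerA -rmorphM scalerDr.
set X := expmx _ in A1 A2 *; set Y := expmx _ in B1 B2 *.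
have -> : X * Y - (1 + ((i * t)%:K *: A + (i * t)%:K *: B)) =
    (X - 1 - (i * t)%:K *: A) + (Y - 1 - (i * t)%:K *: B) + (X - 1) * (Y - 1).
  rewrite mulrBl mul1r mulrBr mulr1.
  set P := X * Y; set U := _ *: A; set V := _ *: B.
  clearbody P U V X Y; move: (1 : 'M[K]_m) => I1.
  by apply/matrixP => a b; rewrite !mxE; ring.
apply: (le_trans (nuD nrmP _ _)).
apply: (le_trans (lerD (nuD nrmP _ _) (nrm_mul _ _))).
apply: (le_trans (lerD (lerD A1 B1) (_ : _ <= (i * s') * (i * s')))).
  exact: ler_pM (nrm_ge0 _) (nrm_ge0 _) A2 B2.
rewrite -exprVn -/i le_eqVlt; apply/orP; left; apply/eqP; ring.
Qed.

Lemma lieB A B : g A -> g B -> g (A - B).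
Proof. by move=> gA /lieN; exact: lieD. Qed.

Lemma lie_sum (I : Type) (r : seq I) (F : I -> 'M[K]_m) :
  (forall i, g (F i)) -> g (\sum_(i <- r) F i).
Proof. move=> gF; apply: (big_ind g) => [||i _]; [exact: lie0|exact: lieD|exact: gF]. Qed.

End LieAlgebra.

(** * Analytic functions of matrices near the identity *)

Section AnalyticFunction.
Variables (R : realType) (a : nat -> R).
Hypothesis a_analytic : analytic_past_one a.

(** A disc around [1] on which even the twice differentiated series converges
    absolutely: [p ^+ 2 * (1 + d) ^+ p] is [O(r ^+ p)] as soon as
    [(1 + d) ^+ 3 <= r]. *)
Lemma analytic_radius : exists d M : R, [/\ 0 < d, 0 <= M,
  (forall N, \sum_(1 <= p < N) `|a p| * (1 + d) ^+ p <= M) &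
  (forall N, \sum_(1 <= p < N) `|a p| * (p%:R ^+ 2 * (1 + d) ^+ p) <= M)].
Proof.
case: a_analytic => r r1 cvr.
have r0 : 0 <= r := le_trans ler01 (ltW r1).
pose d := Num.min 1 ((r - 1) / 7).
have d0 : 0 < d by rewrite lt_min ltr01 divr_gt0 // subr_gt0.
have d1 : d <= 1 by rewrite ge_min lexx.
have dr : d <= (r - 1) / 7 by rewrite ge_min lexx orbT.
set q := 1 + d; have q1 : 1 <= q by rewrite /q lerDl ltW.
have q0 : 0 <= q by rewrite (le_trans _ q1).
have q3r : q ^+ 3 <= r.
  have h2 : d * d <= d by rewrite ler_piMl // ltW.
  have h3 : d * (d * d) <= d by rewrite (le_trans _ h2) // ler_wpM2l // ltW.
  have -> : q ^+ 3 = 1 + 3 * d + 3 * (d * d) + d * (d * d) by rewrite /q; ring.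
  lra.
have pq (p : nat) : p%:R * d <= q ^+ p.
  elim: p => [|p IH]; first by rewrite mul0r expr0.
  rewrite exprS {1}/q mulrDl mul1r -[p.+1]addn1 natrD mulrDl mul1r lerD //.
  by rewrite ler_peMr ?exprn_ege1 // ltW.
have key (p : nat) : p%:R ^+ 2 * q ^+ p <= r ^+ p / d ^+ 2.
  rewrite ler_pdivlMr ?exprn_gt0 // mulrAC -exprMn.
  apply: (@le_trans _ _ ((q ^+ p) ^+ 2 * q ^+ p)).
    rewrite ler_wpM2r ?exprn_ge0 // lerXn2r ?nnegrE ?exprn_ge0 //.
    by rewrite mulr_ge0 // ltW.
  by rewrite -exprSr -exprM mulnC exprM lerXn2r ?nnegrE ?exprn_ge0 //.
have key1 (p : nat) : q ^+ p <= r ^+ p.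
  rewrite lerXn2r ?nnegrE //.
  by apply: le_trans q3r; rewrite exprS ler_peMr ?exprn_ege1.
set S := fun N => \sum_(1 <= p < N) `|a p| * r ^+ p in cvr.
have Sle N : S N <= limn S.
  apply: nondecreasing_cvgn_le => // p p' pp'.
  rewrite /S; have [p1|p1] := leqP 1 p.
    rewrite [leRHS](big_cat_nat (n := p)) //= lerDl sumr_ge0 // => j _.
    by rewrite mulr_ge0 // exprn_ge0 //.
  rewrite big_geq; last by rewrite leq_eqVlt p1 orbT.
  by rewrite sumr_ge0 // => j _; rewrite mulr_ge0 // exprn_ge0 //.
have S0 : 0 <= limn S by have := Sle 0%N; rewrite /S big_geq.
exists d, (limn S + limn S / d ^+ 2); split => //.
- by rewrite addr_ge0 // divr_ge0 ?exprn_ge0 // ltW.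
- move=> N; apply: (@le_trans _ _ (S N)).
    by apply: ler_sum => p _; rewrite ler_wpM2l.
  by rewrite (le_trans (Sle N)) // lerDl divr_ge0 ?exprn_ge0 // ltW.
- move=> N; apply: (@le_trans _ _ (S N / d ^+ 2)).
    rewrite /S mulr_suml; apply: ler_sum => p _.
    by rewrite -mulrA ler_wpM2l.
  rewrite (le_trans (ler_wpM2r _ (Sle N))) ?invr_ge0 ?exprn_ge0 ?lerDr //.
  exact: ltW.
Qed.

(** The estimate [expr_dist1] summed against the coefficients. Its scalar case
    identifies the linear coefficient, the sum of the [p * a p], with the
    derivative. *)
Lemma matrix_fun_linear : exists d M : R, [/\ 0 < d, 0 <= M &
  forall (k : base_field) (m : nat),
    (forall Z : 'M[scalars R k]_m, nrm (Z - 1) <= d ->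
       converges (@nrm R k m) (matrix_series a Z) (matrix_fun a Z)) /\
    (forall rho (Z Z' : 'M[scalars R k]_m), rho <= d ->
       nrm (Z - 1) <= rho -> nrm (Z' - 1) <= rho ->
       nrm (matrix_fun a Z - matrix_fun a Z' -
            of_real k (derive1 (scalar_fun a) 1) *: (Z - Z')) <=
       M * rho * nrm (Z - Z'))].
Proof.
have [d [M [d0 M0 sum1 sum2]]] := analytic_radius.
have qp p : 1 <= (1 + d) ^+ p by rewrite exprn_ege1 // lerDl ltW.
have q0 p : 0 <= (1 + d) ^+ p by rewrite (le_trans _ (qp p)).
have bound N : \sum_(1 <= p < N) `|a p * p%:R| <= M.
  apply: le_trans (sum2 N); apply: ler_sum => p _.
  rewrite normrM ler_wpM2l // ger0_norm //.
  case: p => [|p]; first by rewrite mulr_ge0.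
  rewrite (@le_trans _ _ (p.+1%:R ^+ 2 * 1)) ?ler_wpM2l ?exprn_ge0 //.
  by rewrite mulr1 expr2 ler_peMl // ler1n.
have [fp cfp _] := partial_sum_converges (real_is_norm R) (@real_is_complete R)
  (fun p => lexx _) bound.
have Tsum rho D N : 0 <= rho -> rho <= d -> 0 <= D ->
    \sum_(1 <= p < N) `|a p| * (p%:R ^+ 2 * rho * (1 + rho) ^+ p * D) <= M * rho * D.
  move=> r0 rd D0; rewrite -mulrA.
  apply: (@le_trans _ _ (\sum_(1 <= p < N) (`|a p| * (p%:R ^+ 2 * (1 + d) ^+ p)) * (rho * D))).
    apply: ler_sum => p _; rewrite -[leRHS]mulrA ler_wpM2l //.
    have -> : p%:R ^+ 2 * rho * (1 + rho) ^+ p * D = p%:R ^+ 2 * (1 + rho) ^+ p * (rho * D) by ring.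
    rewrite ler_wpM2r ?mulr_ge0 // ler_wpM2l ?exprn_ge0 // lerXn2r ?nnegrE ?addr_ge0 ?lerD2l //.
    exact: ltW.
  by rewrite -mulr_suml ler_wpM2r ?mulr_ge0.
have fpE : derive1 (scalar_fun a) 1 = fp.
  have cvs x : `|x - 1| <= d -> converges (Num.norm : R -> R) (scalar_series a x) (scalar_fun a x).
    move=> xd; have [|//|l cl _] := @partial_sum_converges R _ Num.norm (fun p => a p * x ^+ p)
      (fun p => `|a p| * (1 + d) ^+ p) M 1 (real_is_norm R) (@real_is_complete R).
      move=> p; rewrite normrM normrX ler_wpM2l // lerXn2r ?nnegrE ?addr_ge0 // ?(ltW d0) //.
      by rewrite -[x](subrKC 1) (le_trans (ler_normD _ _)) // normr1 lerD2l.
    suff -> : scalar_fun a x = l by [].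
    by apply: cvg_lim => //; apply/cvgn_converges.
  have est x : `|x - 1| <= d ->
      `|scalar_fun a x - scalar_fun a 1 - fp * (x - 1)| <= M * `|x - 1| * `|x - 1|.
    move=> xd; have x1 : `|1 - 1 : R| <= d by rewrite subrr normr0 ltW.
    have cfpx : converges (Num.norm : R -> R)
        (fun N => \sum_(1 <= p < N) a p * p%:R * (x - 1)) (fp * (x - 1)).
      move=> e e0; have s0 : 0 < 1 + `|x - 1| by rewrite ltr_pwDl.
      have [N hN] := cfp _ (divr_gt0 e0 s0); exists N => p /hN h.
      rewrite -mulr_suml -mulrBl normrM.
      apply: le_trans (_ : _ <= e / (1 + `|x - 1|) * (1 + `|x - 1|)) _.
        by rewrite ler_pM // lerDr.
      by rewrite divfK // gt_eqF.
    have := convergesB (real_is_norm R) (convergesB (real_is_norm R) (cvs _ xd) (cvs _ x1)) cfpx.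
    move=> /(converges_le (N0 := 0%N) (real_is_norm R)); apply => N _.
    rewrite /scalar_series -!sumrB; apply: le_trans (Tsum _ _ N _ xd _) => //.
    apply: (le_trans (ler_norm_sum _ _ _)); apply: ler_sum => p _.
    rewrite -mulrBr -mulrA -mulrBr normrM ler_wpM2l // mulr_natl.
    apply: (expr_dist1 (real_is_norm R)) => //; last by rewrite subrr normr0.
    by move=> u v; rewrite normrM.
  rewrite derive1E; apply: cvg_lim => //; apply/cvgrPdist_le => e e0.
  have s0 : 0 < 1 + M by rewrite ltr_pwDl.
  exists (Num.min d (e / (1 + M))); first by rewrite /= lt_min d0 divr_gt0.
  move=> h /=; rewrite sub0r normrN lt_min => /andP[hd he] h0.
  rewrite distrC [h *: 1]mulr1.
  have hE : h + 1 - 1 = h by rewrite addrK.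
  have := est (h + 1); rewrite hE => /(_ (ltW hd)) hest.
  have -> : h^-1 *: (scalar_fun a (h + 1) - scalar_fun a 1) - fp =
      h^-1 * (scalar_fun a (h + 1) - scalar_fun a 1 - fp * h).
    by rewrite -[_ *: _]/(_ * _) [RHS]mulrBr mulrCA mulVf // mulr1.
  rewrite normrM normfV ler_pdivrMl ?normr_gt0 //; apply: (le_trans hest).
  rewrite [leRHS]mulrC ler_wpM2r // (@le_trans _ _ (`|h| * (1 + M))) //.
    by rewrite [leLHS]mulrC ler_wpM2l // lerDr.
  by rewrite -ler_pdivlMr // ltW.
exists d, M; split => // k m; rewrite fpE.
have cvm (Z : 'M[scalars R k]_m) : nrm (Z - 1) <= d ->
    converges (@nrm R k m) (matrix_series a Z) (matrix_fun a Z).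
  move=> Zd; have [||l cl _] := @partial_sum_converges R _ (@nrm R k m)
    (fun p => of_real k (a p) *: Z ^+ p)
    (fun p => `|a p| * (1 + d) ^+ p * nrm (1 : 'M[scalars R k]_m))
    (M * nrm (1 : 'M[scalars R k]_m)) 1 (@nrm_is_norm R k m) (@nrm_is_complete R k m).
  - move=> p; rewrite nrmZ -mulrA ler_wpM2l // -[Z ^+ p]mul1r.
    apply: expr_mul_le => [|z]; first by rewrite addr_ge0 // ltW.
    apply: mulr_near1r => //; [exact: nrm_is_norm|exact: nrm_mul].
  - by move=> N; rewrite -mulr_suml ler_wpM2r ?nrm_ge0.
  - suff -> : matrix_fun a Z = l by [].
    exact: limn_nrm.
split => // rho Z Z' rd Zr Z'r.
have nP := @nrm_is_norm R k m.
have r0 : 0 <= rho := le_trans (nrm_ge0 _) Zr.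
have cfpx : converges (@nrm R k m)
    (fun N => \sum_(1 <= p < N) of_real k (a p * p%:R) *: (Z - Z'))
    (of_real k fp *: (Z - Z')).
  move=> e e0; have s0 : 0 < 1 + nrm (Z - Z') by rewrite ltr_pwDl // nrm_ge0.
  have [N hN] := cfp _ (divr_gt0 e0 s0); exists N => p /hN h.
  rewrite -scaler_suml -rmorph_sum -scalerBl -rmorphB nrmZ.
  apply: le_trans (_ : _ <= e / (1 + nrm (Z - Z')) * (1 + nrm (Z - Z'))) _.
    by rewrite ler_pM ?nrm_ge0 // lerDr.
  by rewrite divfK // gt_eqF.
have := convergesB nP (convergesB nP (cvm _ (le_trans Zr rd)) (cvm _ (le_trans Z'r rd))) cfpx.
move=> /(converges_le (N0 := 0%N) nP); apply => N _.
rewrite /matrix_series -!sumrB; apply: le_trans (Tsum _ _ N r0 rd (nrm_ge0 _)).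
apply: (le_trans (nu_sum nP _ _ _)); apply: ler_sum => p _.
rewrite rmorphM rmorph_nat -scalerA -!scalerBr nrmZ ler_wpM2l //.
rewrite scaler_nat; apply: (expr_dist1 nP) => //; exact: nrm_mul.
Qed.

End AnalyticFunction.

(** * Spectrum of the graph Laplacian *)

(** The algebraic multiplicity of the eigenvalue [0] dominates the geometric
    one: after Gaussian elimination the last [n - \rank A] rows of ['X - A] are
    multiples of ['X]. *)
Lemma Xn_dvd_char_poly (F : fieldType) n (A : 'M[F]_n) :
  'X^(n - \rank A) %| char_poly A.
Proof.
set r := \rank A; set C := col_ebase A; set E := row_ebase A.
have uC : C \in unitmx := col_ebase_unit A.
have uE : E \in unitmx := row_ebase_unit A.
pose toP := map_mx (@polyC F) : 'M[F]_n -> 'M[{poly F}]_n.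
have [M ME] : exists M, M = invmx C *m invmx E by eexists.
pose d : 'rV[{poly F}]_n := \row_i (if (i < r)%N then 1 else 'X).
pose M' : 'M[{poly F}]_n :=
  \matrix_(i, j) (if (i < r)%N then (M i j) *: 'X - (i == j)%:R else (M i j)%:P).
have -> : char_poly A = \det (toP C) * (\det (diag_mx d) * \det M') * \det (toP E).
  rewrite -!det_mulmx /char_poly; congr (\det _).
  have -> : diag_mx d *m M' = 'X *: toP M - toP (pid_mx r).
    apply/matrixP => i j; rewrite mul_diag_mx !mxE.
    case: ltnP => ir; last by rewrite andbF polyC0 subr0.
    by rewrite mul1r -mul_polyC mulrC andbT polyC_natr.
  rewrite mulmxBr mulmxBl -scalemxAr -scalemxAl /toP -!map_mxM.
  rewrite mulmx_ebase ME mulmxA mulmxV // mul1mx mulVmx // /char_poly_mx.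
  by rewrite map_mx1 scalemx1.
rewrite det_diag dvdp_mulr // dvdp_mull // dvdp_mulr //.
under eq_bigr do rewrite mxE.
rewrite (eq_bigr (fun i : 'I_n => if (r <= i)%N then 'X else 1)).
  rewrite -big_mkcond /= prodr_const /=.
  suff -> : #|[pred i : 'I_n | (r <= i)%N]| = (n - r)%N by [].
  rewrite -sum1_card -(big_mkord (fun i => (r <= i)%N) (fun=> 1%N)).
  by rewrite -(big_nat_widenl _ _ _ predT) // sum_nat_const_nat muln1.
by move=> i _; rewrite ltnNge; case: (r <= i)%N.
Qed.

Section LaplacianTheory.
Variables (R : realType) (n : nat) (gamma : 'I_n -> 'I_n -> R).
Local Notation L := (laplacian gamma).
Hypothesis gammaC : forall i j, gamma i j = gamma j i.
Hypothesis L_simple : simple_eigenvalue L 0.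

(** Stated for any biadditive scaling, so as to apply to real vectors and to
    configurations of matrices alike. *)
Lemma laplacian_act (V : zmodType) (sc : R -> V -> V) (x : 'I_n -> V) i :
  (forall a b v, sc (a + b) v = sc a v + sc b v) ->
  (forall a v w, sc a (v + w) = sc a v + sc a w) ->
  \sum_j sc (L i j) (x j) = \sum_j sc (gamma i j) (x j - x i).
Proof.
move=> scDl scDr.
have sc0 v : sc 0 v = 0 by apply: (addIr (sc 0 v)); rewrite -scDl !add0r.
have sc0r a : sc a 0 = 0 by apply: (addIr (sc a 0)); rewrite -scDr !add0r.
have scNl a v : sc (- a) v = - sc a v.
  by apply/eqP; rewrite -addr_eq0 -scDl addNr sc0.
have scNr a v : sc a (- v) = - sc a v.
  by apply/eqP; rewrite -addr_eq0 -scDr addNr sc0r.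
have scsum (I : Type) (s : seq I) (P : pred I) (F : I -> R) v :
    sc (\sum_(j <- s | P j) F j) v = \sum_(j <- s | P j) sc (F j) v.
  by elim/big_rec2: _ => [|j a b _ <-]; rewrite ?sc0 // scDl.
rewrite (bigD1 i) //= mxE eqxx scNl scsum.
rewrite [RHS](bigD1 i) //= subrr sc0r add0r -sumrN -big_split /=.
by apply: eq_bigr => j ji; rewrite mxE eq_sym (negPf ji) scDr scNr addrC.
Qed.

Lemma laplacian_sym : L^T = L.
Proof.
apply/matrixP => i j; rewrite !mxE eq_sym; case: eqP => [->|_]; rewrite // gammaC.
Qed.

Lemma laplacian_symE i j : L i j = L j i.
Proof. by rewrite -[L in LHS]laplacian_sym; exact: mxE. Qed.

Let ones : 'rV[R]_n := const_mx 1.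
Let J : 'M[R]_n := const_mx (n%:R^-1).

Lemma graph_nonempty : (0 < n)%N.
Proof.
case: n gamma L_simple => [|//] g.
rewrite /simple_eigenvalue.
have -> : char_poly (laplacian g) = 1 by rewrite /char_poly det_mx00.
by rewrite mupNroot // rootC oner_eq0.
Qed.

Let n0 : n%:R != 0 :> R. Proof. by rewrite pnatr_eq0 -lt0n graph_nonempty. Qed.

Lemma onesL : ones *m L = 0.
Proof.
apply/rowP => j; rewrite !mxE (eq_bigr (fun i => L j i * 1)); last first.
  by move=> i _; rewrite -[in RHS]laplacian_sym [in RHS]mxE mxE mul1r mulr1.
rewrite (@laplacian_act R *%R (fun=> 1)).
- by rewrite big1 // => i _; rewrite subrr mulr0.
- by move=> *; rewrite mulrDl.
- by move=> *; rewrite mulrDr.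
Qed.

(** The kernel is a line because the geometric multiplicity is at most the
    algebraic one. *)
Lemma laplacian_ker (x : 'rV[R]_n) : x *m L = 0 -> exists c, x = c *: ones.
Proof.
move=> xL; have rk : (n - \rank L <= 1)%N.
  rewrite -L_simple /= mup_geq ?monic_neq0 ?char_poly_monic //.
  by rewrite subr0 Xn_dvd_char_poly.
have sub_ones : (ones <= kermx L)%MS by apply/sub_kermxP; exact: onesL.
have rones : \rank ones = 1%N.
  rewrite rank_rV; suff -> : ones != 0 by [].
  apply/eqP => /rowP/(_ (Ordinal graph_nonempty)); rewrite !mxE.
  by move/eqP; rewrite oner_eq0.
have : (kermx L <= ones)%MS.
  by rewrite -(geq_leqif (mxrank_leqif_sup sub_ones)) mxrank_ker rones.
move=> h; have /submx_trans/(_ h) : (x <= kermx L)%MS by apply/sub_kermxP.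
by case/sub_rVP => c ->; exists c.
Qed.

(** [J - L] is invertible: it is the identity on constants and [- L] on
    zero-sum vectors. Then [J - (J - L)^-1] is the Moore-Penrose inverse. *)
Lemma laplacian_pinv : exists B : 'M[R]_n,
  [/\ L *m B = 1%:M - J, B *m L = 1%:M - J & J *m B = 0].
Proof.
have JL : J *m L = 0.
  apply/matrixP => i j; have /rowP/(_ j) := onesL; rewrite !mxE => h.
  rewrite -[RHS](mulr0 (n%:R^-1)) -[in RHS]h mulr_sumr.
  by apply: eq_bigr => l _; rewrite !mxE mul1r.
have LJ : L *m J = 0.
  by rewrite -[L]laplacian_sym -[J]trmxK -trmx_mul trmx_const JL trmx0.
have JJ : J *m J = J.
  apply/matrixP => i j; rewrite !mxE (eq_bigr (fun=> n%:R^-1 * n%:R^-1)).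
    by rewrite sumr_const card_ord -[_ *+ n]mulr_natr mulfVK.
  by move=> l _; rewrite !mxE.
pose N := J - L.
have uN : N \in unitmx.
  rewrite -row_free_unit -kermx_eq0; apply/rowV0P => x /sub_kermxP xN.
  have xJ : x *m J = 0.
    by rewrite -(subr0 J) -LJ -{1}JJ -mulmxBl mulmxA xN mul0mx.
  have [c xE] : exists c, x = c *: ones.
    apply: laplacian_ker; move: xN; rewrite mulmxBr xJ sub0r => /eqP.
    by rewrite oppr_eq0 => /eqP.
  move: xJ => /rowP/(_ (Ordinal graph_nonempty)); rewrite xE !mxE.
  rewrite (eq_bigr (fun=> c * n%:R^-1)); last by move=> l _; rewrite !mxE mulr1.
  rewrite sumr_const card_ord -[_ *+ n]mulr_natr mulfVK // => ->.
  by rewrite scale0r.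
have NJ : N *m J = J by rewrite mulmxBl JJ LJ subr0.
have JN : J *m N = J by rewrite mulmxBr JJ JL subr0.
have VJ : invmx N *m J = J by rewrite -{1}NJ mulKmx.
have JV : J *m invmx N = J by rewrite -{1}JN mulmxK.
have LE : L = J - N by rewrite /N subKr.
exists (J - invmx N); split.
- by rewrite mulmxBr LJ sub0r LE mulmxBl JV mulmxV // opprB.
- by rewrite mulmxBl JL sub0r LE mulmxBr VJ mulVmx // opprB.
- by rewrite mulmxBr JJ JV subrr.
Qed.

Hypothesis L_nsd : negative_semidefinite L.

(** Spectral gap, without diagonalising: minimise the positive semidefinite
    form of [- L] along the line through [v] in the direction [- v *m B], on
    which the form is explicit. *)
Lemma laplacian_gap_centered : exists2 beta : R, 0 < beta &
  forall v : 'rV[R]_n, v *m J = 0 ->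
    (v *m v^T) 0 0 <= - beta * (v *m L *m v^T) 0 0.
Proof.
have [B [LB BL JB]] := laplacian_pinv.
pose b := \sum_i \sum_j `|B i j|.
have b0 : 0 <= b by rewrite !sumr_ge0 // => i _; rewrite sumr_ge0.
exists (b + 1); first by rewrite ltr_wpDl.
move=> v vJ; set s := (v *m v^T) 0 0; set q := (v *m L *m v^T) 0 0.
have sE : s = \sum_i v 0 i ^+ 2.
  by rewrite /s mxE; apply: eq_bigr => i _; rewrite mxE expr2.
have s0 : 0 <= s by rewrite sE sumr_ge0 // => i _; rewrite sqr_ge0.
have sqr_le i : v 0 i ^+ 2 <= s.
  by rewrite sE (bigD1 i) //= lerDl sumr_ge0 // => j _; rewrite sqr_ge0.
have Bs : `|(v *m B *m v^T) 0 0| <= b * s.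
  rewrite mxE (le_trans (ler_norm_sum _ _ _)) // /b exchange_big mulr_suml.
  apply: ler_sum => j _; rewrite !mxE mulr_suml mulr_suml.
  rewrite (le_trans (ler_norm_sum _ _ _)) //; apply: ler_sum => i _.
  rewrite !normrM [_ * `|B i j|]mulrC -mulrA ler_wpM2l //.
  have := sqr_le i; have := sqr_le j; rewrite -normrM.
  have := sqr_ge0 (v 0 i - v 0 j); have := sqr_ge0 (v 0 i + v 0 j).
  by rewrite ler_norml; nra.
pose t := (b + 1)^-1.
have t0 : 0 < t by rewrite invr_gt0 ltr_wpDl.
pose y := v *m B.
have yL : y *m L = v by rewrite /y -mulmxA BL mulmxBr mulmx1 vJ subr0.
have Ly : L *m y^T = v^T.
  by rewrite -[L in L *m _]laplacian_sym -trmx_mul yL.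
have vy : (v *m y^T) 0 0 = (v *m B *m v^T) 0 0.
  have -> : v *m y^T = (v *m B *m v^T)^T by rewrite [RHS]trmx_mul trmxK.
  by rewrite mxE.
have := L_nsd (v + t *: y)^T; rewrite trmxK.
have -> : (v + t *: y) *m L *m (v + t *: y)^T =
    v *m L *m v^T + t *: (v *m v^T) + (t *: (v *m v^T) + t ^+ 2 *: (v *m y^T)).
  rewrite linearD linearZ /= [(v + _) *m L]mulmxDl -scalemxAl yL.
  rewrite mulmxDr 2!mulmxDl -!scalemxAl -!scalemxAr -[v *m L *m y^T]mulmxA Ly.
  by rewrite scalerA expr2.
have entry (X Y Z : 'M[R]_1) : (X + t *: Y + (t *: Y + t ^+ 2 *: Z)) 0 0 =
    X 0 0 + t * Y 0 0 + (t * Y 0 0 + t ^+ 2 * Z 0 0) by rewrite !mxE.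
rewrite entry vy -/s -/q.
set w := (v *m B *m v^T) 0 0 in Bs *.
have bt : b * t <= 1.
  by rewrite ler_pdivrMr ?mul1r ?lerDl // ltr_wpDl.
have ws : - (b * s) <= w by move: Bs; rewrite ler_norml => /andP[].
have h1 : t ^+ 2 * - (b * s) <= t ^+ 2 * w by rewrite ler_wpM2l ?sqr_ge0.
have h2 : (b * t) * (t * s) <= t * s.
  by rewrite ler_piMl // mulr_ge0 // ltW.
move=> h; have : t * s <= - q by rewrite expr2 in h1 h; nra.
have bp : 0 < b + 1 by rewrite ltr_wpDl.
by rewrite mulNr -mulrN -ler_pdivrMl.
Qed.

(** The sum of the squared differences is [2 * n] times the squared norm of the
    centred vector, to which the previous estimate applies. *)
Lemma laplacian_gap : exists2 lam : R, 0 < lam &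
  forall x : 'I_n -> R, \sum_i x i * (\sum_j L i j * x j) <=
    - lam * \sum_i \sum_j (x i - x j) ^+ 2.
Proof.
have [beta beta0 gap] := laplacian_gap_centered.
exists ((beta * n%:R) *+ 2)^-1.
  by rewrite invr_gt0 pmulrn_lgt0 // mulr_gt0 // ltr0n graph_nonempty.
move=> x; pose mean := (\sum_i x i) / n%:R.
pose v : 'rV[R]_n := \row_i (x i - mean).
have vsum : \sum_i v 0 i = 0.
  under eq_bigr do rewrite mxE.
  by rewrite sumrB sumr_const card_ord -[_ *+ n]mulr_natr divfK ?subrr.
have vJ : v *m J = 0.
  apply/rowP => j; rewrite !mxE.
  under eq_bigr => i _ do rewrite [J i j]mxE.
  by rewrite -mulr_suml vsum mul0r.
have quadE : \sum_i x i * (\sum_j L i j * x j) = (v *m L *m v^T) 0 0.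
  have LvE i : \sum_j L i j * x j = (v *m L) 0 i.
    rewrite (@laplacian_act R *%R x); [|by move=> *; rewrite mulrDl|by move=> *; rewrite mulrDr].
    have -> : (v *m L) 0 i = \sum_j L i j * v 0 j.
      by rewrite mxE; apply: eq_bigr => j _; rewrite mulrC laplacian_symE.
    rewrite (@laplacian_act R *%R (v 0)); [|by move=> *; rewrite mulrDl|by move=> *; rewrite mulrDr].
    by apply: eq_bigr => j _; rewrite !mxE; congr (_ * _); ring.
  rewrite mxE (eq_bigr (fun i => v 0 i * (v *m L) 0 i + mean * (v *m L) 0 i)).
    rewrite big_split /= -mulr_sumr.
    have -> : \sum_i (v *m L) 0 i = (v *m L *m ones^T) 0 0.
      rewrite [RHS]mxE; apply: eq_bigr => i _.
      by rewrite [ones^T i 0]mxE [ones 0 i]mxE mulr1.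
    rewrite -mulmxA -[L]laplacian_sym -trmx_mul onesL trmx0 mulmx0 [_ 0 0]mxE.
    by rewrite mulr0 addr0; apply: eq_bigr => i _; rewrite mulrC; congr (_ * _); rewrite [RHS]mxE.
  by move=> i _; rewrite -mulrDl LvE [v 0 i]mxE subrK.
have distE : \sum_i \sum_j (x i - x j) ^+ 2 = (v *m v^T) 0 0 * (n%:R *+ 2).
  have -> : (v *m v^T) 0 0 = \sum_i v 0 i ^+ 2.
    by rewrite mxE; apply: eq_bigr => i _; rewrite expr2; congr (_ * _); rewrite [LHS]mxE.
  transitivity (\sum_i \sum_j (v 0 i ^+ 2 + v 0 j ^+ 2 - (v 0 i * v 0 j) *+ 2)).
    by apply: eq_bigr => i _; apply: eq_bigr => j _; rewrite !mxE; ring.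
  under eq_bigr => i _ do rewrite sumrB big_split /= sumr_const card_ord sumrMnl
    -mulr_sumr vsum mulr0 mul0rn subr0.
  rewrite big_split /= sumr_const card_ord sumrMnl.
  by set S := \sum_i v 0 i ^+ 2; rewrite -[S *+ n]mulr_natr; ring.
rewrite quadE distE; have := gap _ vJ.
set s := (v *m v^T) 0 0; set q := (v *m L *m v^T) 0 0 => h.
have n1 : 0 < n%:R :> R by rewrite ltr0n graph_nonempty.
have -> : - ((beta * n%:R) *+ 2)^-1 * (s * (n%:R *+ 2)) = - (s / beta).
  by field; rewrite n0 gt_eqF.
by rewrite lerNr ler_pdivrMr // mulNr mulrC -mulNr.
Qed.

End LaplacianTheory.

(** * Inverses and ratios near the identity *)

Section Inverses.
Variables (R : realType) (k : base_field) (m : nat).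
Local Notation K := (scalars R k).
Local Notation nrm := (@nrm R k m).
Local Notation nrmP := (@nrm_is_norm R k m).
Implicit Types A B : 'M[K]_m.

Lemma invmx_dist A B : A \in unitmx -> B \in unitmx ->
  invmx A - invmx B = invmx A *m (B - A) *m invmx B.
Proof.
move=> uA uB; rewrite mulmxBr mulmxBl mulVmx // mul1mx.
by rewrite -mulmxA mulmxV // mulmx1.
Qed.

Lemma invmx_near1 rho A : A \in unitmx -> rho <= 2^-1 -> nrm (A - 1) <= rho ->
  nrm (invmx A - 1) <= 2 * rho.
Proof.
move=> uA r2 hA.
have E : invmx A - 1 = (1 - A) + (1 - A) * (invmx A - 1).
  rewrite mulrBr mulr1 [RHS]addrC subrK mulrBl mul1r -[A * _]/(A *m _).
  by rewrite mulmxV.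
have h : nrm (invmx A - 1) <= rho + rho * nrm (invmx A - 1).
  rewrite {1}E (le_trans (nuD nrmP _ _)) // lerD //.
    by rewrite (nu_distC nrmP).
  rewrite (le_trans (nrm_mul _ _)) // ler_wpM2r ?nrm_ge0 //.
  by rewrite (nu_distC nrmP).
have := ler_wpM2r (nrm_ge0 (invmx A - 1)) r2.
by move: h; move: (nrm _) => x; lra.
Qed.

(** The differential of the inverse at the identity is [- id]. *)
Lemma invmx_lipschitz rho A B : A \in unitmx -> B \in unitmx -> rho <= 2^-1 ->
  nrm (A - 1) <= rho -> nrm (B - 1) <= rho ->
  nrm (invmx A - invmx B + (A - B)) <= 6 * rho * nrm (A - B).
Proof.
move=> uA uB r2 hA hB; have r0 : 0 <= rho := le_trans (nrm_ge0 _) hA.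
have pA := invmx_near1 uA r2 hA; have pB := invmx_near1 uB r2 hB.
rewrite (invmx_dist uA uB); set D := A - B.
rewrite -[B - A]opprB -/D; set p := invmx A - 1 in pA; set q := invmx B - 1 in pB.
have -> : invmx A *m - D *m invmx B + D = - (p * D + D * q + p * D * q).
  have -> : invmx A = 1 + p by rewrite subrKC.
  have -> : invmx B = 1 + q by rewrite subrKC.
  rewrite mulmxN mulNmx -[(1 + p) *m D *m (1 + q)]/((1 + p) * D * (1 + q)).
  rewrite mulrDl mul1r mulrDr mulr1 mulrDl.
  move: (p * D) (D * q) (p * D * q) => X Y Z.
  by apply/matrixP => i j; rewrite !mxE; ring.
rewrite (nuN nrmP); have d0 := nrm_ge0 D.
have h1 : nrm (p * D) <= 2 * rho * nrm D.
  by rewrite (le_trans (nrm_mul _ _)) // ler_wpM2r.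
have h2 : nrm (D * q) <= 2 * rho * nrm D.
  by rewrite (le_trans (nrm_mul _ _)) // mulrC ler_wpM2r.
have h3 : nrm (p * D * q) <= 2 * rho * nrm D * (2 * rho).
  by rewrite (le_trans (nrm_mul _ _)) // ler_pM // nrm_ge0.
have h4 : 2 * rho * nrm D * (2 * rho) <= 2 * rho * nrm D.
  by rewrite ler_piMr ?mulr_ge0 //; lra.
rewrite (le_trans (nuD nrmP _ _)) // (le_trans (lerD (nuD nrmP _ _) h3)) //.
by rewrite (le_trans (lerD (lerD h1 h2) h4)) //; lra.
Qed.

Lemma ratio_near1 rho A B : B \in unitmx -> rho <= 2^-1 ->
  nrm (A - 1) <= rho -> nrm (B - 1) <= rho ->
  nrm (A *m invmx B - 1) <= 4 * rho.
Proof.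
move=> uB r2 hA hB; have r0 : 0 <= rho := le_trans (nrm_ge0 _) hA.
have pB := invmx_near1 uB r2 hB.
have -> : A *m invmx B - 1 = (A - 1) + (invmx B - 1) + (A - 1) * (invmx B - 1).
  rewrite mulrBl mul1r mulrBr mulr1 -[A * invmx B]/(A *m invmx B).
  move: (A *m invmx B) (invmx B) (1 : 'M[K]_m) => X Y I1.
  by apply/matrixP => i j; rewrite !mxE; ring.
have h3 : nrm ((A - 1) * (invmx B - 1)) <= rho * (2 * rho).
  by rewrite (le_trans (nrm_mul _ _)) // ler_pM // nrm_ge0.
have h4 : rho * (2 * rho) <= rho by rewrite ler_piMr //; lra.
rewrite (le_trans (nuD nrmP _ _)) // (le_trans (lerD (nuD nrmP _ _) h3)) //.
rewrite (le_trans (lerD (lerD hA pB) h4)) //; lra.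
Qed.

(** By the previous lemma the quotient linearises to a difference; the errors are
    products of two small displacements. *)
Lemma ratio_lipschitz rho A B A' B' : B \in unitmx -> B' \in unitmx ->
  rho <= 2^-1 -> nrm (A' - 1) <= rho ->
  nrm (B - 1) <= rho -> nrm (B' - 1) <= rho ->
  nrm (A *m invmx B - A' *m invmx B' - ((A - A') - (B - B'))) <=
    10 * rho * (nrm (A - A') + nrm (B - B')).
Proof.
move=> uB uB' r2 hA' hB hB'; have r0 : 0 <= rho := le_trans (nrm_ge0 _) hB.
have pB := invmx_near1 uB r2 hB.
have lB := invmx_lipschitz uB uB' r2 hB hB'.
set D := A - A'; set D' := B - B' in lB *.
set q := invmx B - 1 in pB; set V := invmx B - invmx B' in lB.
have -> : A *m invmx B - A' *m invmx B' - (D - D') =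
    D * q + (V + D') + (A' - 1) * V.
  rewrite /D /D' /q /V !(mulrBl, mulrBr) !mulr1 !mul1r.
  rewrite -[A * invmx B]/(A *m invmx B) -[A' * invmx B]/(A' *m invmx B).
  rewrite -[A' * invmx B']/(A' *m invmx B').
  move: (A *m invmx B) (A' *m invmx B) (A' *m invmx B') (invmx B) (invmx B') => X Y Z S T.
  by apply/matrixP => i j; rewrite !mxE; ring.
have d0 := nrm_ge0 D; have d0' := nrm_ge0 D'.
have h1 : nrm (D * q) <= 2 * rho * nrm D.
  by rewrite (le_trans (nrm_mul _ _)) // mulrC ler_wpM2r.
have V4 : nrm V <= 4 * nrm D'.
  apply: (le_trans (nu_le_dist nrmP _ (- D'))); rewrite (nuN nrmP) opprK.
  have := ler_wpM2r d0' r2; move: lB; move: (nrm _) (nrm D') => x y; lra.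
have h3 : nrm ((A' - 1) * V) <= rho * (4 * nrm D').
  by rewrite (le_trans (nrm_mul _ _)) // ler_pM // nrm_ge0.
rewrite (le_trans (nuD nrmP _ _)) // (le_trans (lerD (nuD nrmP _ _) h3)) //.
rewrite (le_trans (lerD (lerD h1 lB) (lexx _))) //.
have := mulr_ge0 r0 d0; lra.
Qed.

End Inverses.

(** * Linearisation of the coupling *)

Section RealMatrixAction.
Variables (R : realType) (k : base_field) (m n : nat).
Local Notation K := (scalars R k).
Local Notation "x %:K" := (of_real k x) (at level 2, format "x %:K").
Local Notation nrm := (@nrm R k m).
Local Notation nrmP := (@nrm_is_norm R k m).
Local Notation cnrm := (sum_norm nrm).
Implicit Types (B C : 'M[R]_n) (Q : 'I_n -> 'M[K]_m).

Definition mxact B Q : 'I_n -> 'M[K]_m := fun i => \sum_j (B i j)%:K *: Q j.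

Lemma cnrm_is_norm : is_norm (cnrm : ('I_n -> 'M[K]_m) -> R).
Proof. exact: sum_norm_is_norm nrmP. Qed.

Lemma cnrm_is_complete : is_complete (cnrm : ('I_n -> 'M[K]_m) -> R).
Proof. exact: sum_norm_is_complete nrmP (@nrm_is_complete R k m). Qed.

Lemma mxactM B C Q : mxact (B *m C) Q = mxact B (mxact C Q).
Proof.
apply/funext => i; rewrite /mxact.
under [RHS]eq_bigr do rewrite scaler_sumr.
rewrite exchange_big; apply: eq_bigr => j _.
rewrite mxE rmorph_sum scaler_suml; apply: eq_bigr => l _.
by rewrite rmorphM scalerA.
Qed.

Lemma mxactD B Q Q' : mxact B (Q + Q') = mxact B Q + mxact B Q'.
Proof.
apply/funext => i; rewrite /mxact -[RHS]big_split /=.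
by apply: eq_bigr => j _; rewrite scalerDr.
Qed.

Lemma mxactN B Q : mxact B (- Q) = - mxact B Q.
Proof.
apply/funext => i; rewrite /mxact -[RHS]sumrN.
by apply: eq_bigr => j _; rewrite scalerN.
Qed.

Lemma mxactB B Q Q' : mxact B (Q - Q') = mxact B Q - mxact B Q'.
Proof. by rewrite mxactD mxactN. Qed.

Lemma mxactZ B (t : R) Q : mxact B (fun i => t%:K *: Q i) = (fun i => t%:K *: mxact B Q i).
Proof.
apply/funext => i; rewrite /mxact scaler_sumr; apply: eq_bigr => j _.
by rewrite !scalerA mulrC.
Qed.

Definition mxnorm1 B : R := \sum_i \sum_j `|B i j|.

Lemma mxnorm1_ge0 B : 0 <= mxnorm1 B.
Proof. by rewrite !sumr_ge0 // => i _; rewrite sumr_ge0. Qed.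

Lemma cnrm_mxact B Q : cnrm (mxact B Q) <= mxnorm1 B * cnrm Q.
Proof.
rewrite /sum_norm /mxnorm1 mulr_suml; apply: ler_sum => i _.
rewrite mulr_suml (le_trans (nu_sum nrmP _ _ _)) //; apply: ler_sum => j _.
by rewrite nrmZ ler_wpM2l //; exact: (sum_norm_coord nrmP Q).
Qed.

(** [1%:M - const_mx n^-1] projects onto the configurations of sum [0]. *)
Lemma mxact_center Q : \sum_i Q i = 0 ->
  mxact (1%:M - const_mx n%:R^-1) Q = Q.
Proof.
move=> Q0; apply/funext => i; rewrite /mxact.
have -> : \sum_j ((1%:M - const_mx n%:R^-1 : 'M[R]_n) i j)%:K *: Q j =
   \sum_j (((i == j)%:R)%:K *: Q j - (n%:R^-1)%:K *: Q j).
  by apply: eq_bigr => j _; rewrite !mxE rmorphB scalerBl.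
rewrite sumrB -scaler_sumr Q0 scaler0 subr0 (bigD1 i) //= eqxx rmorph1 scale1r.
by rewrite big1 ?addr0 // => j ji; rewrite eq_sym (negPf ji) rmorph0 scale0r.
Qed.

Lemma mxact_sum0 B Q : (0 < n)%N -> (const_mx n%:R^-1 : 'M[R]_n) *m B = 0 ->
  \sum_i mxact B Q i = 0.
Proof.
move=> n0 JB; rewrite /mxact exchange_big big1 // => j _.
rewrite -scaler_suml -rmorph_sum.
have /matrixP/(_ (Ordinal n0) j) := JB; rewrite !mxE => h.
have -> : \sum_i B i j = 0; last by rewrite rmorph0 scale0r.
apply: (mulfI (_ : n%:R^-1 != 0)).
  by rewrite invr_eq0 pnatr_eq0 -lt0n.
by rewrite mulr0 -[RHS]h mulr_sumr; apply: eq_bigr => i _; rewrite mxE.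
Qed.

End RealMatrixAction.

Section Coupling.
Variables (R : realType) (k : base_field) (m n : nat).
Local Notation K := (scalars R k).
Local Notation "x %:K" := (of_real k x) (at level 2, format "x %:K").
Local Notation nrm := (@nrm R k m).
Local Notation nrmP := (@nrm_is_norm R k m).
Local Notation cnrm := (sum_norm nrm).
Local Notation config := ('I_n -> 'M[K]_m).
Variables (gamma : 'I_n -> 'I_n -> R) (a : nat -> R).
Implicit Types (X w Q : config).

Definition coupling X : config := fun i =>
  (2^-1)%:K *: \sum_j (gamma i j)%:K *:
     (matrix_fun a (X j *m invmx (X i)) - matrix_fun a (X i *m invmx (X j))).

Lemma kuramoto_rhsE eps Omega X i :
  kuramoto_rhs gamma a eps Omega X i = eps%:K *: Omega i + coupling X i.
Proof. by []. Qed.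

Lemma ratio_mulr (A B Z : 'M[K]_m) : B \in unitmx -> Z \in unitmx ->
  (A *m Z) *m invmx (B *m Z) = A *m invmx B.
Proof.
move=> uB uZ; have -> : invmx (B *m Z) = invmx Z *m invmx B.
  apply: (can_inj (mulKmx (_ : B *m Z \in unitmx))); first by rewrite unitmx_mul uB.
  rewrite mulmxV ?unitmx_mul ?uB // -mulmxA (mulmxA Z) mulmxV // mul1mx mulmxV //.
by rewrite -mulmxA (mulmxA Z) mulmxV // mul1mx.
Qed.

(** The coupling sees only the ratios between nodes. *)
Lemma coupling_mulr X Z : (forall i, X i \in unitmx) -> Z \in unitmx ->
  coupling (fun i => X i *m Z) = coupling X.
Proof.
move=> uX uZ.
pose F (r : 'I_n -> 'I_n -> 'M[K]_m) : config := fun i =>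
  (2^-1)%:K *: \sum_j (gamma i j)%:K *: (matrix_fun a (r j i) - matrix_fun a (r i j)).
have E : (fun p q => X p *m Z *m invmx (X q *m Z)) = (fun p q => X p *m invmx (X q)).
  by apply/funext => p; apply/funext => q; exact: ratio_mulr.
exact: (congr1 F E).
Qed.

Lemma coupling1 : coupling (fun=> 1) = 0.
Proof.
by apply/funext => i; rewrite /coupling big1 ?scaler0 // => j _; rewrite subrr scaler0.
Qed.

Hypothesis gammaC : forall i j, gamma i j = gamma j i.
Hypothesis gamma_ge0 : forall i j, 0 <= gamma i j.

(** The summand is antisymmetric in [i] and [j] because [gamma] is symmetric. *)
Lemma coupling_sum0 X : \sum_i coupling X i = 0.
Proof.
rewrite /coupling -scaler_sumr.
under eq_bigr => i _ do (under eq_bigr do rewrite scalerBr; rewrite sumrB).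
rewrite sumrB [X in _ - X]exchange_big /=.
under [X in _ - X]eq_bigr => i _ do under eq_bigr => j _ do rewrite gammaC.
by rewrite subrr scaler0.
Qed.

Lemma lap_actE Q i : lap_act gamma Q i = \sum_j (gamma i j)%:K *: (Q j - Q i).
Proof.
rewrite /lap_act (@laplacian_act _ _ _ _ (fun t v => t%:K *: v)) //.
  by move=> s t v; rewrite rmorphD scalerDl.
by move=> t u v; rewrite scalerDr.
Qed.

Definition near1 (rho : R) w := forall i, w i \in unitmx /\ nrm (w i - 1) <= rho.

Hypothesis a_analytic : analytic_past_one a.
Local Notation fp := (derive1 (scalar_fun a) 1).

(** On each edge [f] is linearised first, then the ratio. The difference of the
    two nodes then occurs twice, with opposite orientations, which cancels the
    factor [1/2]. *)
Lemma coupling_linear : exists rho0 C : R, [/\ 0 < rho0, rho0 <= 2^-1, 0 <= C,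
  (forall w i j, near1 rho0 w ->
     cvgn (matrix_series a (w j *m invmx (w i))) /\
     converges nrm (matrix_series a (w j *m invmx (w i)))
       (matrix_fun a (w j *m invmx (w i)))) &
  forall rho w w', rho <= rho0 -> near1 rho w -> near1 rho w' ->
    forall i, nrm (coupling w i - coupling w' i - fp%:K *: lap_act gamma (w - w') i)
      <= C * rho * cnrm (w - w')].
Proof.
have [d [M [d0 M0 /(_ k m)[fcvg flin]]]] := matrix_fun_linear a_analytic.
pose rho0 := Num.min 2^-1 (d / 4).
have rho00 : 0 < rho0 by rewrite lt_min invr_gt0 ltr0n divr_gt0.
have rho02 : rho0 <= 2^-1 by rewrite ge_min lexx.
have rho0d rho : rho <= rho0 -> 4 * rho <= d.
  move=> h; rewrite mulrC -ler_pdivlMr // (le_trans h) // ge_min lexx orbT //.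
pose c := 24 * M + 10 * `|fp|.
have c0 : 0 <= c by rewrite addr_ge0 ?mulr_ge0.
have G0 i : 0 <= \sum_j gamma i j by rewrite sumr_ge0.
exists rho0, (2 * c * \sum_i \sum_j gamma i j); split => //.
- by rewrite !mulr_ge0 // sumr_ge0.
- move=> w i j hw; have [ui hi] := hw i; have [uj hj] := hw j.
  have h : converges nrm (matrix_series a (w j *m invmx (w i)))
      (matrix_fun a (w j *m invmx (w i))).
    by apply: fcvg; apply: le_trans (ratio_near1 ui rho02 hj hi) (rho0d _ _).
  by split => //; apply/cvg_ex; eexists; apply/cvgn_nrm; exact: h.
move=> rho w w' hrho hw hw' i.
have double (U V : 'M[K]_m) : U - V - (V - U) = (2 : R)%:K *: (U - V).
  by rewrite opprB rmorph_nat scaler_nat mulr2n.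
have alg (c1 : K) (A B A' B' U V : 'M[K]_m) : A - B - (A' - B') - c1 *: (U - V) =
    (A - A' - c1 *: U) - (B - B' - c1 *: V).
  by apply/matrixP => p q; rewrite !mxE; ring.
set D := w - w'.
have rho2 : rho <= 2^-1 := le_trans hrho rho02.
have r0 : 0 <= rho by have [_] := hw i; apply: le_trans; exact: nrm_ge0.
have key p q : nrm (matrix_fun a (w q *m invmx (w p))
      - matrix_fun a (w' q *m invmx (w' p)) - fp%:K *: (D q - D p))
    <= c * rho * (nrm (D q) + nrm (D p)).
  have [up hp] := hw p; have [uq hq] := hw q.
  have [up' hp'] := hw' p; have [uq' hq'] := hw' q.
  set Z := w q *m _; set Z' := w' q *m _.
  have hZ : nrm (Z - 1) <= 4 * rho := ratio_near1 up rho2 hq hp.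
  have hZ' : nrm (Z' - 1) <= 4 * rho := ratio_near1 up' rho2 hq' hp'.
  have h1 := flin _ Z Z' (rho0d _ hrho) hZ hZ'.
  have h2 : nrm (Z - Z' - (D q - D p)) <= 10 * rho * (nrm (D q) + nrm (D p)).
    exact: ratio_lipschitz.
  set s := nrm (D q) + nrm (D p) in h2 *.
  have s0 : 0 <= s by rewrite addr_ge0 ?nrm_ge0.
  have h3 : nrm (Z - Z') <= 6 * s.
    apply: (le_trans (nu_le_dist nrmP _ (D q - D p))).
    apply: (le_trans (lerD (nuB nrmP _ _) h2)); rewrite -/s.
    have := ler_wpM2r s0 rho2; lra.
  have -> : matrix_fun a Z - matrix_fun a Z' - fp%:K *: (D q - D p) =
      (matrix_fun a Z - matrix_fun a Z' - fp%:K *: (Z - Z')) +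
      fp%:K *: (Z - Z' - (D q - D p)).
    by rewrite [X in _ = _ + X]scalerBr subrKA.
  apply: (le_trans (nuD nrmP _ _)); rewrite nrmZ.
  have h4 : M * (4 * rho) * nrm (Z - Z') <= M * (4 * rho) * (6 * s).
    by rewrite ler_wpM2l // !mulr_ge0.
  have h5 : `|fp| * nrm (Z - Z' - (D q - D p)) <= `|fp| * (10 * rho * s).
    by rewrite ler_wpM2l.
  apply: (le_trans (lerD (le_trans h1 h4) h5)); rewrite /c; lra.
have -> : coupling w i - coupling w' i - fp%:K *: lap_act gamma D i =
    (2^-1)%:K *: \sum_j (gamma i j)%:K *:
     ((matrix_fun a (w j *m invmx (w i)) - matrix_fun a (w' j *m invmx (w' i))
        - fp%:K *: (D j - D i)) -
      (matrix_fun a (w i *m invmx (w j)) - matrix_fun a (w' i *m invmx (w' j))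
        - fp%:K *: (D i - D j))).
  have -> : lap_act gamma D i =
      (2^-1)%:K *: \sum_j (gamma i j)%:K *: ((D j - D i) - (D i - D j)).
    rewrite lap_actE scaler_sumr; apply: eq_bigr => j _.
    rewrite double.
    by rewrite !scalerA -!rmorphM mulrAC mulVf ?mul1r // pnatr_eq0.
  rewrite /coupling scalerA mulrC -scalerA -!scalerBr scaler_sumr -!sumrB.
  congr (_ *: _); apply: eq_bigr => j _.
  rewrite scalerA mulrC -scalerA -!scalerBr; congr (_ *: _).
  exact: alg.
rewrite nrmZ ger0_norm ?invr_ge0 //.
rewrite ler_pdivrMl //.
apply: (le_trans (nu_sum nrmP _ _ _)).
apply: (@le_trans _ _ (\sum_j gamma i j * (2 * (c * rho * (2 * cnrm D))))).
  apply: ler_sum => j _; rewrite nrmZ ger0_norm // ler_wpM2l //.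
  have hDj : nrm (D j) <= cnrm D := sum_norm_coord nrmP D j.
  have hDi : nrm (D i) <= cnrm D := sum_norm_coord nrmP D i.
  have hs : c * rho * (nrm (D j) + nrm (D i)) <= c * rho * (2 * cnrm D).
    rewrite ler_wpM2l ?mulr_ge0 //; lra.
  apply: (le_trans (nuB nrmP _ _)).
  have := key i j; have := key j i; rewrite [nrm (D i) + _]addrC; lra.
rewrite -mulr_suml.
have -> : 2 * (2 * c * (\sum_i0 \sum_j gamma i0 j) * rho * cnrm D) =
  (\sum_i0 \sum_j gamma i0 j) * (2 * (c * rho * (2 * cnrm D))) by ring.
have c1 : 0 <= cnrm D := nu_ge0 (cnrm_is_norm R k m n) D.
rewrite ler_wpM2r ?mulr_ge0 // [leRHS](bigD1 i) //= lerDl sumr_ge0 //.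
Qed.

Section InGroup.
Variable G : set 'M[K]_m.
Hypothesis Glie : matrix_lie_group G.
Hypothesis Glohe : lohe_closed G.

(** Termwise in the power series: [Z ^+ p] is in the group, so the closure
    property applies to it, and the Lie algebra is closed under limits. *)
Lemma coupling_lie X : (forall i, G (X i)) ->
  (forall i j, converges nrm (matrix_series a (X j *m invmx (X i)))
       (matrix_fun a (X j *m invmx (X i)))) ->
  forall i, lie_algebra G (coupling X i).
Proof.
move=> GX cX i; apply: lieZ => //; apply: lie_sum => // j; apply: lieZ => //.
have uX l : X l \in unitmx by apply: (lie_group_unit Glie).
pose Z := X j *m invmx (X i); have GZ : G Z.
  by apply: (lie_groupM Glie) => //; exact: (lie_groupV Glie).
have ZV : X i *m invmx (X j) = invmx Z.
  apply: (can_inj (mulKmx (lie_group_unit Glie GZ))).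
  rewrite mulmxV ?(lie_group_unit Glie) // /Z -mulmxA (mulmxA _ (X i)) mulVmx //.
  by rewrite mul1mx mulmxV.
apply: (lie_converges Glie (u := fun N => matrix_series a Z N - matrix_series a (invmx Z) N)).
  move=> N; rewrite /matrix_series -sumrB; apply: lie_sum => // p.
  rewrite -scalerBr; apply: lieZ => //.
  have -> : invmx Z ^+ p = invmx (Z ^+ p).
    apply: (can_inj (mulKmx (lie_group_unit Glie (lie_groupX Glie p GZ)))).
    rewrite mulmxV ?(lie_group_unit Glie) //; last exact: lie_groupX.
    rewrite -[_ *m _]/(Z ^+ p * invmx Z ^+ p) -exprMn_comm.
      by rewrite -[Z * _]/(Z *m _) mulmxV ?(lie_group_unit Glie) // expr1n.
    by rewrite /GRing.comm -![_ * _]/(_ *m _) mulmxV ?mulVmx ?(lie_group_unit Glie).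
  by apply: Glohe; exact: lie_groupX.
by rewrite -ZV; apply: (convergesB nrmP); exact: cX.
Qed.

End InGroup.

End Coupling.

(** * The near-constant fixed point *)

Section FixedPoint.
Variables (R : realType) (k : base_field) (m n : nat).
Local Notation K := (scalars R k).
Local Notation "x %:K" := (of_real k x) (at level 2, format "x %:K").
Local Notation nrm := (@nrm R k m).
Local Notation nrmP := (@nrm_is_norm R k m).
Local Notation cnrm := (sum_norm nrm).
Local Notation cnrmP := (cnrm_is_norm R k m n).
Local Notation config := ('I_n -> 'M[K]_m).
Variables (G : set 'M[K]_m) (gamma : 'I_n -> 'I_n -> R) (a : nat -> R).
Hypothesis Glie : matrix_lie_group G.
Hypothesis Glohe : lohe_closed G.
Hypothesis gammaC : forall i j, gamma i j = gamma j i.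
Hypothesis gamma_ge0 : forall i j, 0 <= gamma i j.
Hypothesis a_analytic : analytic_past_one a.
Hypothesis L_simple : simple_eigenvalue (laplacian gamma) 0.
Local Notation fp := (derive1 (scalar_fun a) 1).
Local Notation L := (laplacian gamma).
Hypothesis fp0 : 0 < fp.

Lemma lie_mxact (B : 'M[R]_n) (Q : config) :
  (forall i, lie_algebra G (Q i)) -> forall i, lie_algebra G (mxact B Q i).
Proof. by move=> gQ i; apply: lie_sum => // j; apply: lieZ. Qed.

Lemma lie_algebra0_closed (u : nat -> config) l :
  (forall p, lie_algebra0 G (u p)) -> converges cnrm u l -> lie_algebra0 G l.
Proof.
move=> gu cu; have cui i := converges_coord nrmP i cu; split.
  by move=> i; apply: (lie_converges Glie) (cui i) => p; case: (gu p).
apply: (converges_unique nrmP (u := fun p => \sum_i u p i)).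
  move=> e /cu[N hN]; exists N => p /hN; apply: le_trans.
  by rewrite -sumrB; exact: (nu_sum nrmP).
apply: (converges_near (N0 := 0%N) (converges_cst nrmP 0)) => p _.
by case: (gu p).
Qed.

(** The real pseudo-inverse acts by real linear combinations, which preserve
    the Lie algebra. *)
Lemma lap_act_surj (W : config) : lie_algebra0 G W ->
  exists2 Q, lie_algebra0 G Q & lap_act gamma Q = W.
Proof.
case=> gW W0; have [B [LB _ JB]] := laplacian_pinv gammaC L_simple.
exists (mxact B W).
  split; first exact: lie_mxact.
  exact: mxact_sum0 (graph_nonempty L_simple) JB.
rewrite -[LHS]/(mxact L (mxact B W)) -mxactM LB; exact: mxact_center.
Qed.

Lemma lap_pinvP (W : config) : lie_algebra0 G W ->
  lie_algebra0 G (lap_pinv G gamma W) /\ lap_act gamma (lap_pinv G gamma W) = W.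
Proof.
move=> gW; have WA : (lap_act gamma @` lie_algebra0 G) W.
  by have [Q gQ <-] := lap_act_surj gW; exists Q.
split; last by apply: (@pinvK _ _ (fun=> 0)); rewrite inE.
apply: (@surjpinv_image_sub _ _ (fun=> 0) (lie_algebra0 G)
  (lap_act gamma @` lie_algebra0 G) (lap_act gamma)).
  by move=> y.
by exists W.
Qed.

Definition exp_config (eps : R) (P : config) : config :=
  fun i => expmx (eps%:K *: P i).

(** Exponential coordinates deviate from [1 + eps P] by [O(eps ^+ 2)], by
    [expmx_dist], and all ratios are within [O(eps)] of the identity, which makes
    the error of [coupling_linear] of the same order. *)
Lemma exp_coupling (M0 : R) : 0 <= M0 ->
  exists eps1 C1 : R, [/\ 0 < eps1, 0 <= C1 &
  forall eps, `|eps| <= eps1 ->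
    forall P P' : config, cnrm P <= M0 -> cnrm P' <= M0 ->
     (forall i, nrm (exp_config eps P i - 1) <= C1 * `|eps|) /\
     cnrm (coupling gamma a (exp_config eps P) - coupling gamma a (exp_config eps P')
           - (fun i => eps%:K *: (fp%:K *: lap_act gamma (P - P') i)))
       <= C1 * `|eps| ^+ 2 * cnrm (P - P')].
Proof.
move=> M00; have [rho0 [C [rho00 rho02 C0 _ clin]]] := coupling_linear k m gamma_ge0 a_analytic.
set e := expR 1 : R; have e0 : 0 <= e by exact: expR_ge0.
pose r := M0 * (1 + e) + 1; have r0 : 0 < r by rewrite ltr_wpDl ?mulr_ge0 ?addr_ge0.
pose eps1 := Num.min (rho0 / r) (M0 + 1)^-1.
have l0 := mxnorm1_ge0 L.
pose C2 := n%:R * (C * r * (1 + e)) + `|fp| * (mxnorm1 L * (M0 * e)).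
have r1 := ltW r0.
have C20 : 0 <= C2 by rewrite addr_ge0 ?mulr_ge0 // addr_ge0.
exists eps1, (r + C2); split; first by rewrite lt_min divr_gt0 // invr_gt0 ltr_wpDl.
  by rewrite addr_ge0 // ltW.
move=> eps heps P P' hP hP'; set t := `|eps|.
have t0 : 0 <= t by exact: normr_ge0.
have tr : r * t <= rho0.
  by rewrite mulrC -ler_pdivlMr // (le_trans heps) // ge_min lexx.
have tM : t * M0 <= 1.
  apply: (@le_trans _ _ (t * (M0 + 1))); first by rewrite ler_wpM2l // lerDl.
  rewrite -ler_pdivlMr ?ltr_wpDl // mul1r (le_trans heps) //.
  by rewrite ge_min lexx orbT.
have tM0 : 0 <= t * M0 by rewrite mulr_ge0.
have etM : expR (t * M0) <= e by rewrite ler_expR.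
have small (Z : config) i : cnrm Z <= M0 -> nrm (eps%:K *: Z i) <= t * M0.
  by move=> hZ; rewrite nrmZ ler_wpM2l // (le_trans (sum_norm_coord nrmP Z i)).
have near (Z : config) : cnrm Z <= M0 -> near1 (r * t) (exp_config eps Z).
  move=> hZ i; split; first exact: expmx_unit.
  have hX := small _ i hZ; set X := eps%:K *: Z i in hX.
  apply: (le_trans (nu_le_dist nrmP _ X)).
  have h1 : t * M0 * expR (t * M0) * nrm X <= 1 * e * (t * M0).
    by rewrite !ler_pM ?mulr_ge0 ?expR_ge0 ?nrm_ge0.
  have := le_trans (expmx_near1 hX) h1.
  rewrite /r; move: hX t0; rewrite /exp_config -/X; move: (nrm X) (nrm _) => x y; lra.
have hw := near _ hP; have hw' := near _ hP'.
set w := exp_config eps P in hw *; set w' := exp_config eps P' in hw' *.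
split.
  move=> i; case: (hw i) => _ /le_trans; apply; rewrite [leRHS]mulrDl lerDl.
  by rewrite mulr_ge0.
have c0 := nu_ge0 cnrmP (P - P').
have cX : cnrm (fun i => eps%:K *: (P - P') i) = t * cnrm (P - P').
  by rewrite /sum_norm mulr_sumr; apply: eq_bigr => i _; rewrite nrmZ.
have h2 : cnrm (w - w' - (fun i => eps%:K *: (P - P') i)) <=
    t ^+ 2 * (M0 * e) * cnrm (P - P').
  rewrite /sum_norm mulr_sumr; apply: ler_sum => i _.
  have -> : (w - w' - (fun i => eps%:K *: (P - P') i)) i =
      expmx (eps%:K *: P i) - expmx (eps%:K *: P' i) -
      (eps%:K *: P i - eps%:K *: P' i).
    by rewrite -scalerBr.
  apply: (le_trans (expmx_dist (small _ i hP) (small _ i hP'))).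
  rewrite -scalerBr nrmZ -/t.
  have -> : t ^+ 2 * (M0 * e) * nrm ((P - P') i) = t * M0 * e * (t * nrm (P i - P' i)).
    by rewrite -[(P - P') i]/(P i - P' i); ring.
  by rewrite ler_wpM2r ?mulr_ge0 ?nrm_ge0 // ler_wpM2l.
have h3 : cnrm (w - w') <= (1 + e) * t * cnrm (P - P').
  apply: (le_trans (nu_le_dist cnrmP _ (fun i => eps%:K *: (P - P') i))).
  rewrite cX; apply: (le_trans (lerD (lexx _) h2)).
  have : t ^+ 2 * (M0 * e) * cnrm (P - P') <= 1 * (e * t * cnrm (P - P')).
    have -> : t ^+ 2 * (M0 * e) * cnrm (P - P') = t * M0 * (e * t * cnrm (P - P')) by ring.
    by rewrite ler_wpM2r ?mulr_ge0.
  lra.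
have -> : coupling gamma a w - coupling gamma a w' -
     (fun i => eps%:K *: (fp%:K *: lap_act gamma (P - P') i)) =
   (fun i => coupling gamma a w i - coupling gamma a w' i - fp%:K *: lap_act gamma (w - w') i)
   + (fun i => fp%:K *: lap_act gamma (w - w' - (fun i => eps%:K *: (P - P') i)) i).
  apply/funext => i; rewrite -[lap_act gamma (w - w' - _)]/(mxact L (w - w' - _)).
  rewrite mxactB mxactZ.
  rewrite -[lap_act gamma (w - w')]/(mxact L (w - w')) -[lap_act gamma (P - P')]/(mxact L (P - P')).
  move: (mxact L (w - w')) (mxact L (P - P')) => U V.
  move: (coupling gamma a w) (coupling gamma a w') => F F'.
  by apply/matrixP => p q; rewrite !mxE; ring.
apply: (le_trans (nuD cnrmP _ _)).
have -> : (r + C2) * t ^+ 2 * cnrm (P - P') =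
    r * t ^+ 2 * cnrm (P - P') + (n%:R * (C * r * t * ((1 + e) * t * cnrm (P - P'))) +
    `|fp| * (mxnorm1 L * (t ^+ 2 * (M0 * e) * cnrm (P - P')))) by rewrite /C2; ring.
apply: ler_wpDl; first by rewrite !mulr_ge0 ?exprn_ge0 // ltW.
apply: lerD.
  rewrite /sum_norm; apply: (@le_trans _ _ (\sum_(i < n) C * r * t * ((1 + e) * t * cnrm (P - P')))).
    apply: ler_sum => i _; rewrite -[C * r * t]mulrA.
    apply: (le_trans (clin _ _ _ tr hw hw' i)).
    by rewrite ler_wpM2l // !mulr_ge0 // ltW.
  by rewrite sumr_const card_ord -[_ *+ n]mulr_natl.
rewrite /sum_norm (eq_bigr (fun i => `|fp| * nrm (mxact L (w - w' - (fun i => eps%:K *: (P - P') i)) i))); last first.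
  by move=> i _; rewrite nrmZ.
rewrite -mulr_sumr ler_wpM2l //; apply: le_trans (cnrm_mxact _ _) _.
by rewrite ler_wpM2l.
Qed.

(** Perturbation of the solution [Q] of the linearised equation, by the
    contraction principle in the closed set of zero-sum configurations of the
    Lie algebra. *)
Lemma kuramoto_fixed_point (Omega Q : config) :
  lie_algebra0 G Omega -> lie_algebra0 G Q ->
  (forall i, fp%:K *: lap_act gamma Q i = - Omega i) ->
  exists eps0 C : R, [/\ 0 < eps0, 0 <= C & forall eps, `|eps| <= eps0 ->
    exists P : config, [/\ lie_algebra0 G P,
      (forall i, kuramoto_rhs gamma a eps Omega (exp_config eps P) i = 0),
      (forall i, nrm (P i - Q i) <= C * `|eps|) &
      (forall i, nrm (exp_config eps P i - 1) <= C * `|eps|)]].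
Proof.
move=> gOmega gQ QE.
have [B [LB _ JB]] := laplacian_pinv gammaC L_simple.
have n0 := graph_nonempty L_simple.
set b := mxnorm1 B; have b0 : 0 <= b := mxnorm1_ge0 B.
pose M0 := cnrm Q + 1; have cQ0 := nu_ge0 cnrmP Q.
have M00 : 0 <= M0 by rewrite addr_ge0.
have [eps1 [C1 [eps10 C10 hexp]]] := exp_coupling M00.
have [rho0 [C [rho00 rho02 C0 ccvg _]]] := coupling_linear k m gamma_ge0 a_analytic.
pose D := fp^-1 * (b * C1).
have D0 : 0 <= D by rewrite !mulr_ge0 // invr_ge0 ltW.
pose s := 1 + eps1^-1 + C1 / rho0 + D * M0 + 2 * D.
have s1 : 0 <= C1 / rho0 by rewrite divr_ge0 // ltW.
have s2 : 0 <= D * M0 by rewrite mulr_ge0.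
have s3 : 0 < eps1^-1 by rewrite invr_gt0.
have s0 : 0 < s by rewrite /s; lra.
exists s^-1, (C1 + D * M0); split; [by rewrite invr_gt0|by rewrite addr_ge0|].
move=> eps heps; set t := `|eps| in heps *; have t0 : 0 <= t by exact: normr_ge0.
(* All smallness conditions on [eps] have the form [t * x <= 1] with [x] one of
   the summands of [s]. *)
have small x : x <= s -> t * x <= 1.
  move=> xs; apply: (@le_trans _ _ (t * s)); first by rewrite ler_wpM2l.
  by rewrite -ler_pdivlMr // mul1r.
have t1 : t <= eps1.
  by rewrite -[eps1]mul1r -ler_pdivrMr //; apply: small; rewrite /s; lra.
have t2 : C1 * t <= rho0.
  rewrite -[rho0]mul1r -ler_pdivrMr // mulrAC mulrC.
  by apply: small; rewrite /s; lra.
have t3 : t * (D * M0) <= 1 by apply: small; rewrite /s; lra.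
have t4 : t * (2 * D) <= 1 by apply: small; rewrite /s; lra.
pose w P := exp_config eps P.
(* [rem P] is the coupling minus its linear part, divided by [eps]; a fixed
   point of [T] solves [fp Lap P = - Omega - rem P] because [rem P] has sum
   zero. *)
pose rem P : config := fun i => (eps^-1)%:K *:
  (coupling gamma a (w P) i - eps%:K *: (fp%:K *: lap_act gamma P i)).
pose T P : config := Q - (fun i => (fp^-1)%:K *: mxact B (rem P) i).
pose S P := lie_algebra0 G P /\ cnrm (P - Q) <= 1.
have SM P : S P -> cnrm P <= M0.
  move=> [_ hP]; apply: (le_trans (nu_le_dist cnrmP _ Q)).
  by rewrite lerD2l.
have wP P : S P -> forall i, nrm (w P i - 1) <= C1 * t.
  move=> SP i; have [] := hexp eps t1 P P (SM _ SP) (SM _ SP).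
  by move=> h _; exact: h.
have near P : S P -> near1 rho0 (w P).
  move=> SP i; split; first exact: expmx_unit.
  exact: le_trans (wP _ SP i) t2.
have w0 : w 0 = fun=> 1.
  by apply/funext => i; rewrite /w /exp_config scaler0 expmx0.
have rem0 : rem 0 = 0.
  apply/funext => i; rewrite /rem w0 coupling1 // -[lap_act gamma 0]/(mxact L 0).
  have -> : mxact L (0 : config) = 0.
    by apply/funext => j; rewrite /mxact big1 // => l _; rewrite scaler0.
  by rewrite -![(0 : config) i]/(0 : 'M[K]_m) !scaler0 subr0 scaler0.
have remB P P' : cnrm P <= M0 -> cnrm P' <= M0 ->
    cnrm (rem P - rem P') <= C1 * t * cnrm (P - P').
  move=> hP hP'; have [_ h] := hexp eps t1 P P' hP hP'.
  have -> : rem P - rem P' = (fun i => (eps^-1)%:K *: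
     (coupling gamma a (w P) - coupling gamma a (w P') -
      (fun i => eps%:K *: (fp%:K *: lap_act gamma (P - P') i))) i).
    apply/funext => i; rewrite -[lap_act gamma (P - P')]/(mxact L (P - P')) mxactB.
    rewrite -[(rem P - rem P') i]/(rem P i - rem P' i) /rem -scalerBr.
    rewrite -[lap_act gamma P]/(mxact L P) -[lap_act gamma P']/(mxact L P').
    move: (mxact L P) (mxact L P') (coupling gamma a (w P)) (coupling gamma a (w P')) => U V F F'.
    by apply/matrixP => p q; rewrite !mxE; ring.
  rewrite /sum_norm; under eq_bigr do rewrite nrmZ.
  rewrite -mulr_sumr; apply: (le_trans (ler_wpM2l (normr_ge0 _) h)).
  rewrite -/t normfV -/t mulrA ler_wpM2r ?(nu_ge0 cnrmP) //.
  rewrite mulrCA ler_wpM2l //; have [->|tn0] := eqVneq t 0.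
    by rewrite invr0 mul0r.
  by rewrite expr2 mulrA mulVf // mul1r.
have TB P P' : T P - T P' = (fun i => - (fp^-1)%:K *: mxact B (rem P - rem P') i).
  apply/funext => i; rewrite mxactB /T.
  move: (mxact B (rem P)) (mxact B (rem P')) => U V.
  by apply/matrixP => p q; rewrite !mxE; ring.
have cT P : cnrm (fun i => - (fp^-1)%:K *: mxact B P i) <= fp^-1 * (b * cnrm P).
  rewrite /sum_norm; under eq_bigr do rewrite -rmorphN nrmZ.
  rewrite -mulr_sumr normrN ger0_norm ?invr_ge0 ?(ltW fp0) //.
  by rewrite ler_wpM2l ?invr_ge0 ?(ltW fp0) //; exact: cnrm_mxact.
have cTB P P' : cnrm P <= M0 -> cnrm P' <= M0 ->
    cnrm (T P - T P') <= t * D * cnrm (P - P').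
  move=> hP hP'; rewrite TB; apply: (le_trans (cT _)).
  have -> : t * D * cnrm (P - P') = fp^-1 * (b * (C1 * t * cnrm (P - P'))).
    by rewrite /D; ring.
  by rewrite ler_wpM2l ?invr_ge0 ?(ltW fp0) // ler_wpM2l // remB.
have cTQ P : cnrm P <= M0 -> cnrm (T P - Q) <= t * (D * M0).
  move=> hP; have T0 : T 0 = Q.
    rewrite /T rem0; have -> : mxact B (0 : config) = 0.
      by apply/funext => j; rewrite /mxact big1 // => l _; rewrite scaler0.
    by apply/funext => i; rewrite -[(_ - _) i]/(Q i - _) scaler0 subr0.
  have := @cTB P 0 hP; rewrite T0 subr0 (nu0 cnrmP) => /(_ M00) /le_trans; apply.
  by rewrite -mulrA ler_wpM2l // ler_wpM2l.
have gP P : S P -> forall i, lie_algebra G (rem P i).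
  move=> SP i; apply: lieZ => //; apply: lieB => //.
    apply: (coupling_lie gamma Glie Glohe) => [j|p q].
      by case: SP => -[gP _] _; exact: gP.
    by have [] := ccvg (w P) p q (near _ SP).
  apply: lieZ => //; apply: lieZ => //; apply: lie_mxact.
  by case: SP => -[].
have ST P : S P -> S (T P).
  move=> SP; split; last exact: le_trans (cTQ _ (SM _ SP)) t3.
  case: gQ => gQ Q0; split.
    move=> i; apply: lieB => //; apply: lieZ => //; apply: lie_mxact.
    exact: gP.
  rewrite sumrB Q0 -scaler_sumr (mxact_sum0 _ n0 JB) scaler0 subr0 //.
have [|//|u l Su cu|P P' SP SP'|P SP TP] :=
  contraction_fixed (S := S) (T := T) (x0 := Q) cnrmP (@cnrm_is_complete R k m n).
- by split => //; rewrite subrr (nu0 cnrmP).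
- split; first by apply: lie_algebra0_closed cu => p; case: (Su p).
  by apply: (converges_le_dist (N0 := 0%N) cnrmP cu) => p _; case: (Su p).
- apply: (le_trans (cTB _ _ (SM _ SP) (SM _ SP'))); rewrite mulrC.
  rewrite ler_wpM2l ?(nu_ge0 cnrmP) // -[2^-1]mul1r ler_pdivlMr // -mulrA.
  by rewrite [D * 2]mulrC.
have PQ : cnrm (P - Q) <= t * (D * M0) by rewrite -{1}TP; exact: cTQ (SM _ SP).
exists P; split.
- by case: SP.
- move=> i; rewrite kuramoto_rhsE.
  have rem_sum0 : \sum_i rem P i = 0.
    rewrite /rem -scaler_sumr sumrB coupling_sum0 //.
    rewrite -!scaler_sumr -[lap_act gamma P]/(mxact L P) mxact_sum0 ?scaler0 ?subr0 ?scaler0 //.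
    apply/matrixP => p q; rewrite !mxE.
    have /rowP/(_ q) := onesL gammaC; rewrite !mxE => h.
    rewrite -[RHS](mulr0 (n%:R^-1)) -[in RHS]h mulr_sumr.
    by apply: eq_bigr => l _; rewrite !mxE mul1r.
  have LP : lap_act gamma P = lap_act gamma Q - (fun i => (fp^-1)%:K *: rem P i).
    rewrite -{1}TP -![lap_act gamma _]/(mxact L _) /T mxactB mxactZ -mxactM LB.
    by rewrite mxact_center.
  have fpLP : fp%:K *: lap_act gamma P i = - Omega i - rem P i.
    rewrite LP -[(_ - _) i]/(lap_act gamma Q i - _) scalerBr QE scalerA -rmorphM.
    by rewrite divff ?gt_eqF // rmorph1 scale1r.
  have -> : coupling gamma a (w P) i = eps%:K *: (fp%:K *: lap_act gamma P i) + eps%:K *: rem P i.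
    (* At [eps = 0] the division by [eps] in [rem] loses the equation. *)
    have [e0|en0] := eqVneq eps 0.
      have -> : w P = fun=> 1.
        by apply/funext => j; rewrite /w /exp_config e0 rmorph0 scale0r expmx0.
      by rewrite coupling1 // e0 rmorph0 !scale0r addr0.
    rewrite /rem; move: (eps%:K *: (fp%:K *: lap_act gamma P i)) => U.
    by rewrite scalerA -rmorphM divff // rmorph1 scale1r subrKC.
  by rewrite fpLP scalerBr subrK scalerN subrr.
- move=> i; apply: (le_trans (sum_norm_coord nrmP (P - Q) i)).
  by apply: (le_trans PQ); rewrite mulrDl [t * _]mulrC lerDr mulr_ge0.
- move=> i; apply: (le_trans (wP _ SP i)).
  by rewrite mulrDl lerDl mulr_ge0.
Qed.

End FixedPoint.

(** * The Lyapunov form *)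

Lemma sumr_ord_const (R : realType) n (x : R) : \sum_(i < n) x = n%:R * x.
Proof. by rewrite sumr_const card_ord mulr_natl. Qed.

Lemma sum_sqr_le (R : realType) (I : finType) (f : I -> R) :
  (\sum_i `|f i|) ^+ 2 <= #|I|%:R * \sum_i f i ^+ 2.
Proof.
apply: (@le_trans _ _ (\sum_i \sum_j (f i ^+ 2 + f j ^+ 2) / 2)).
  rewrite expr2 mulr_suml; apply: ler_sum => i _.
  rewrite mulr_sumr; apply: ler_sum => j _.
  rewrite ler_pdivlMr // -[f i ^+ 2]real_normK ?num_real //.
  rewrite -[f j ^+ 2]real_normK ?num_real //.
  by have := sqr_ge0 (`|f i| - `|f j|); rewrite !expr2; lra.
under eq_bigr => i _ do rewrite -mulr_suml big_split /= sumr_const.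
rewrite -mulr_suml big_split /= sumr_const sumrMnl.
by move: (\sum_i _) => S; rewrite -[S *+ _]mulr_natl le_eqVlt; apply/orP; left; apply/eqP; field.
Qed.

Section Disagreement.
Variables (R : realType) (k : base_field) (m n : nat).
Local Notation K := (scalars R k).
Local Notation "x %:K" := (of_real k x) (at level 2, format "x %:K").
Local Notation nrm := (@nrm R k m).
Local Notation nrmP := (@nrm_is_norm R k m).
Local Notation cnrm := (sum_norm nrm).
Local Notation config := ('I_n -> 'M[K]_m).
Local Notation coords := ('I_m * 'I_m * bool)%type.
Implicit Types (c : coords) (A B : 'M[K]_m) (u v w z : config).

Definition coord c A : R := part c.2 (A c.1.1 c.1.2).

Lemma coordD c A B : coord c (A + B) = coord c A + coord c B.
Proof. by rewrite /coord mxE raddfD. Qed.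

Lemma coordB c A B : coord c (A - B) = coord c A - coord c B.
Proof. by rewrite /coord !mxE raddfB. Qed.

Lemma coord0 c : coord c 0 = 0.
Proof. by rewrite -[X in coord _ X](subrr (0 : 'M[K]_m)) coordB subrr. Qed.

Lemma coordZ c (t : R) A : coord c (t%:K *: A) = t * coord c A.
Proof. by rewrite /coord mxE partZ. Qed.

Lemma nrm_coord A : nrm A = \sum_(c : coords) `|coord c A|.
Proof.
have -> : \sum_(c : coords) `|coord c A| =
    \sum_(ij : 'I_m * 'I_m) \sum_(b : bool) `|coord (ij, b) A|.
  by rewrite pair_big; apply: eq_bigr => -[ij b] _.
rewrite (eq_bigr (fun ij : 'I_m * 'I_m => l1 (A ij.1 ij.2))).
  rewrite /nrm pair_big; by apply: eq_bigr => -[i j] _.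
by move=> ij _; rewrite big_bool /= addrC.
Qed.

(** The quadratic form of this bilinear form measures the disagreement of the
    nodes; it does not see constant configurations. *)
Definition disag u z : R :=
  \sum_(c : coords) \sum_i \sum_j coord c (u i - u j) * coord c (z i - z j).

Lemma disagC u z : disag u z = disag z u.
Proof. by do 3!(apply: eq_bigr => ? _); rewrite mulrC. Qed.

Lemma disagDr u z z' : disag u (z + z') = disag u z + disag u z'.
Proof.
rewrite /disag -big_split; apply: eq_bigr => c _.
rewrite -big_split; apply: eq_bigr => i _; rewrite -big_split.
apply: eq_bigr => j _ /=; rewrite -mulrDr -coordD; congr (_ * coord c _).
by rewrite opprD addrACA.
Qed.

Lemma disagDl u u' z : disag (u + u') z = disag u z + disag u' z.
Proof. by rewrite disagC disagDr !(disagC z). Qed.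

Lemma disagZr (t : R) u z : disag u (fun i => t%:K *: z i) = t * disag u z.
Proof.
rewrite /disag mulr_sumr; apply: eq_bigr => c _.
rewrite mulr_sumr; apply: eq_bigr => i _; rewrite mulr_sumr.
by apply: eq_bigr => j _; rewrite -scalerBr coordZ mulrCA.
Qed.

Lemma disag_cst u A : disag u (fun=> A) = 0.
Proof.
rewrite /disag big1 // => c _; rewrite big1 // => i _; rewrite big1 // => j _.
by rewrite subrr coord0 mulr0.
Qed.

Lemma disag_ge0 u : 0 <= disag u u.
Proof. by do 3!(apply: sumr_ge0 => ? _); rewrite -expr2 sqr_ge0. Qed.

Definition disag_bound : R := n%:R * (n%:R * 4).

Lemma disag_bound_ge0 : 0 <= disag_bound.
Proof. by rewrite !mulr_ge0. Qed.

Lemma disag_le u z : `|disag u z| <= disag_bound * (cnrm u * cnrm z).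
Proof.
have cn w : 0 <= cnrm w by exact: nu_ge0 (cnrm_is_norm R k m n) w.
have two w i j : nrm (w i - w j) <= 2 * cnrm w.
  apply: (le_trans (nuB nrmP _ _)).
  have := sum_norm_coord nrmP w i; have := sum_norm_coord nrmP w j; lra.
rewrite /disag exchange_big /= (le_trans (ler_norm_sum _ _ _)) //.
have -> : disag_bound * (cnrm u * cnrm z) =
    \sum_(i < n) \sum_(j < n) (2 * cnrm u) * (2 * cnrm z).
  rewrite 2!sumr_ord_const /disag_bound.
  by move: (cnrm u) (cnrm z) => x y; ring.
apply: ler_sum => i _; rewrite exchange_big /= (le_trans (ler_norm_sum _ _ _)) //.
apply: ler_sum => j _; rewrite (le_trans (ler_norm_sum _ _ _)) //.
apply: (@le_trans _ _ (nrm (u i - u j) * nrm (z i - z j))).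
  rewrite {1}nrm_coord mulr_suml; apply: ler_sum => c _.
  rewrite normrM ler_wpM2l // nrm_coord (bigD1 c) //= lerDl.
  by rewrite sumr_ge0.
by rewrite ler_pM ?nrm_ge0.
Qed.

Definition disag_coercivity : R := #|{: 'I_n * coords}|%:R.

(** Coercivity once a node is pinned: the differences with that node bound every
    coordinate. *)
Lemma disag_ge (o : 'I_n) u : u o = 0 ->
  cnrm u ^+ 2 <= disag_coercivity * disag u u.
Proof.
move=> uo.
have -> : cnrm u = \sum_(ic : 'I_n * coords) `|coord ic.2 (u ic.1)|.
  rewrite /sum_norm; under eq_bigr do rewrite nrm_coord.
  by rewrite pair_big.
apply: (le_trans (sum_sqr_le _)); rewrite ler_wpM2l ?ler0n //.
rewrite -(pair_big predT predT (fun i c => coord c (u i) ^+ 2)) /= exchange_big.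
apply: ler_sum => c _; apply: ler_sum => i _.
rewrite (bigD1 o) //= uo subr0 -expr2 lerDl sumr_ge0 // => j _.
by rewrite -expr2 sqr_ge0.
Qed.

Variable gamma : 'I_n -> 'I_n -> R.
Hypothesis gammaC : forall i j, gamma i j = gamma j i.
Hypothesis L_simple : simple_eigenvalue (laplacian gamma) 0.
Hypothesis L_nsd : negative_semidefinite (laplacian gamma).

(** Each real coordinate is a vector on the graph, to which the spectral gap
    applies; since the image of the Laplacian has sum zero, the pairwise
    form is [2 * n] times the scalar product. *)
Lemma disag_lap : exists2 kappa : R, 0 < kappa &
  forall u, disag u (lap_act gamma u) <= - kappa * disag u u.
Proof.
have [lam lam0 gap] := laplacian_gap gammaC L_simple L_nsd.
have n1 : (0 : R) < n%:R by rewrite ltr0n (graph_nonempty L_simple).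
exists (2 * n%:R * lam); first by rewrite !mulr_gt0.
move=> u; rewrite /disag mulr_sumr; apply: ler_sum => c _.
pose x i := coord c (u i); pose y i := \sum_j laplacian gamma i j * x j.
have yE i : coord c (lap_act gamma u i) = y i.
  rewrite /lap_act /y; elim/big_rec2: _ => [|j s t _ <-]; first exact: coord0.
  by rewrite coordD coordZ.
have y0 : \sum_i y i = 0.
  rewrite /y exchange_big big1 // => j _; rewrite -mulr_suml.
  have /rowP/(_ j) := onesL gammaC; rewrite !mxE.
  by under eq_bigr do rewrite mxE mul1r; move=> ->; rewrite mul0r.
under eq_bigr => i _ do under eq_bigr => j _ do rewrite !coordB !yE.
under [X in _ <= _ * X]eq_bigr => i _ do under eq_bigr => j _ do rewrite !coordB -expr2.
have -> : \sum_i \sum_j (x i - x j) * (y i - y j) = 2 * n%:R * \sum_i x i * y i.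
  transitivity (\sum_i \sum_j (x i * y i + x j * y j - x i * y j - y i * x j)).
    by apply: eq_bigr => i _; apply: eq_bigr => j _; ring.
  under eq_bigr => i _ do rewrite sumrB sumrB big_split /= sumr_const card_ord
    -!mulr_sumr y0 mulr0 subr0.
  rewrite sumrB -mulr_suml y0 mul0r subr0 big_split /= sumr_const card_ord sumrMnl.
  by rewrite -[_ *+ n]mulr_natl; ring.
apply: (le_trans (ler_wpM2l (_ : 0 <= 2 * n%:R) (gap x))); first by rewrite mulr_ge0.
by rewrite [leLHS]mulrA mulrN.
Qed.

End Disagreement.

Section Lyapunov.
Variables (R : realType) (k : base_field) (m n : nat).
Local Notation K := (scalars R k).
Local Notation "x %:K" := (of_real k x) (at level 2, format "x %:K").
Local Notation nrm := (@nrm R k m).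
Local Notation nrmP := (@nrm_is_norm R k m).
Local Notation cnrm := (sum_norm nrm).
Local Notation cnrmP := (cnrm_is_norm R k m n).
Local Notation config := ('I_n -> 'M[K]_m).
Variables (gamma : 'I_n -> 'I_n -> R) (a : nat -> R).
Hypothesis gammaC : forall i j, gamma i j = gamma j i.
Hypothesis gamma_ge0 : forall i j, 0 <= gamma i j.
Hypothesis a_analytic : analytic_past_one a.
Hypothesis L_simple : simple_eigenvalue (laplacian gamma) 0.
Hypothesis L_nsd : negative_semidefinite (laplacian gamma).
Local Notation fp := (derive1 (scalar_fun a) 1).
Hypothesis fp0 : 0 < fp.
Local Notation rhs := (kuramoto_rhs gamma a).

(** Velocity of the ratios [X i *m invmx (X o)] when [F] is the logarithmic
    velocity of [X] and [w] is the configuration of these ratios. *)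
Definition drift (F : config) (o : 'I_n) (w : config) : config :=
  fun i => F i *m w i - w i *m F o.

(** The drift is [F i - F o] plus commutator-like terms of size [rho1 * cnrm u].
    The form [disag] ignores the constant [- F o], decreases along the Laplacian
    part of [F i], and for small [rho1] the other terms cost at most half of
    that decrease. *)
Lemma ratio_lyapunov : exists rho1 kappa C1 : R,
  [/\ 0 < rho1 /\ rho1 <= 2^-1, 0 < kappa, 0 <= C1,
    (forall (w : config) i j, near1 rho1 w ->
       cvgn (matrix_series a (w j *m invmx (w i))) /\
       converges nrm (matrix_series a (w j *m invmx (w i)))
         (matrix_fun a (w j *m invmx (w i)))) &
    forall eps Omega (w y : config), near1 rho1 w -> near1 rho1 y ->
      (forall i, nrm (rhs eps Omega w i - rhs eps Omega y i) <= C1 * cnrm (w - y)) /\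
      (forall o, w o = 1 -> y o = 1 -> (forall i, rhs eps Omega y i = 0) ->
        cnrm (drift (rhs eps Omega w) o w) <= C1 * cnrm (w - y) /\
        disag (w - y) (drift (rhs eps Omega w) o w) <= - kappa * disag (w - y) (w - y))].
Proof.
have [rho0 [C [rho00 rho02 C0 ccvg clin]]] := coupling_linear k m gamma_ge0 a_analytic.
have [kap kap0 hlap] := disag_lap k m gammaC L_simple L_nsd.
have l0 := mxnorm1_ge0 (laplacian gamma); set l := mxnorm1 _ in l0.
pose CF := fp * l + C; have CF0 : 0 <= CF by rewrite addr_ge0 ?mulr_ge0 // ltW.
pose CE := 2 * C + 2 * CF; have CE0 : 0 <= CE by rewrite addr_ge0 ?mulr_ge0.
pose c0 := disag_coercivity R m n; have c00 : 0 <= c0 by exact: ler0n.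
have b0 := disag_bound_ge0 R n; set b := disag_bound R n in b0.
pose s := b * (n%:R * CE) * c0; have s0 : 0 <= s by rewrite !mulr_ge0.
pose kappa := fp * kap / 2; have kappa0 : 0 < kappa by rewrite !mulr_gt0.
pose rho1 := Num.min rho0 (kappa / (s + 1)).
have rho10 : 0 < rho1 by rewrite lt_min rho00 divr_gt0 // ltr_wpDl.
have rho1le : rho1 <= rho0 by rewrite ge_min lexx.
have rho12 : rho1 <= 2^-1 := le_trans rho1le rho02.
have rho1s : rho1 * s <= kappa.
  apply: (@le_trans _ _ (rho1 * (s + 1))); first by rewrite ler_wpM2l ?lerDl // ltW.
  by rewrite -ler_pdivlMr ?ltr_wpDl // ge_min lexx orbT.
have sub_near (w : config) : near1 rho1 w -> near1 rho0 w.
  by move=> hw i; have [u h] := hw i; split => //; exact: le_trans h rho1le.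
exists rho1, kappa, (CF + n%:R * (4 * CF)); split => //.
- by rewrite addr_ge0 ?mulr_ge0.
- by move=> w i j /sub_near; exact: ccvg.
move=> eps Omega w y hw hy.
set u := w - y; have cu0 : 0 <= cnrm u by exact: nu_ge0 cnrmP u.
pose S : config := fun i => rhs eps Omega w i - rhs eps Omega y i - fp%:K *: lap_act gamma u i.
have hS i : nrm (S i) <= C * rho1 * cnrm u.
  have -> : S i = coupling gamma a w i - coupling gamma a y i - fp%:K *: lap_act gamma u i.
    by rewrite /S !kuramoto_rhsE opprD addrACA subrr add0r.
  exact: clin.
have hF i : nrm (rhs eps Omega w i - rhs eps Omega y i) <= CF * cnrm u.
  apply: (le_trans (nu_le_dist nrmP _ (fp%:K *: lap_act gamma u i))).
  rewrite -/(S i) nrmZ ger0_norm ?(ltW fp0) // /CF mulrDl lerD //.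
    rewrite -mulrA ler_wpM2l ?(ltW fp0) //.
    apply: le_trans (cnrm_mxact _ _); exact: (sum_norm_coord nrmP).
  apply: (le_trans (hS i)); rewrite -mulrA ler_wpM2l // ler_piMl //.
  by apply: le_trans rho12 _; rewrite invf_le1 // ler1n.
split.
  move=> i; apply: (le_trans (hF i)); rewrite [leRHS]mulrDl lerDl.
  by rewrite !mulr_ge0.
move=> o wo yo y0.
have F_le i : nrm (rhs eps Omega w i) <= CF * cnrm u.
  by have := hF i; rewrite y0 subr0.
have hS' i : nrm (rhs eps Omega w i - fp%:K *: lap_act gamma u i) <= C * rho1 * cnrm u.
  by have := hS i; rewrite /S y0 subr0.
rewrite /drift; clear S hS hF y0.
move: (rhs eps Omega w) F_le hS' => F F_le hS.
pose S : config := fun i => F i - fp%:K *: lap_act gamma u i.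
have SE i : F i = fp%:K *: lap_act gamma u i + S i by rewrite /S subrKC.
pose g : config := fun i => F i *m w i - w i *m F o.
rewrite -/g.
pose E : config := fun i => S i + (F i * (w i - 1) - (w i - 1) * F o).
have gE i : g i = F i - F o + (F i * (w i - 1) - (w i - 1) * F o).
  rewrite /g -[_ *m w i]/(F i * w i) -[w i *m _]/(w i * F o).
  rewrite mulrBr mulr1 mulrBl mul1r.
  move: (F i) (F o) (F i * w i) (w i * F o) => A B A' B'.
  by apply/matrixP => p q; rewrite !mxE; ring.
have hW i : nrm (w i - 1) <= rho1 by case: (hw i).
have prods i : nrm (F i * (w i - 1) - (w i - 1) * F o) <= 2 * CF * rho1 * cnrm u.
  apply: (le_trans (nuB nrmP _ _)).
  have h1 : nrm (F i * (w i - 1)) <= CF * cnrm u * rho1.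
    by rewrite (le_trans (nrm_mul _ _)) // ler_pM ?nrm_ge0.
  have h2 : nrm ((w i - 1) * F o) <= rho1 * (CF * cnrm u).
    by rewrite (le_trans (nrm_mul _ _)) // ler_pM ?nrm_ge0.
  by apply: (le_trans (lerD h1 h2)); lra.
have hE i : nrm (E i) <= CE * rho1 * cnrm u.
  apply: (le_trans (nuD nrmP _ _)); apply: (le_trans (lerD (hS i) (prods i))).
  have := mulr_ge0 (mulr_ge0 C0 (ltW rho10)) cu0; rewrite /CE; lra.
split.
  apply: (@le_trans _ _ (\sum_(i < n) 4 * CF * cnrm u)).
    apply: ler_sum => i _; rewrite gE.
    apply: (le_trans (nuD nrmP _ _)).
    apply: (le_trans (lerD (nuB nrmP _ _) (prods i))).
    have := F_le i; have := F_le o.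
    have : 2 * CF * rho1 * cnrm u <= 2 * CF * 1 * cnrm u.
      rewrite ler_wpM2r // ler_wpM2l ?mulr_ge0 //.
      by apply: le_trans rho12 _; rewrite invf_le1 // ler1n.
    lra.
  by rewrite sumr_ord_const [leRHS]mulrDl -[n%:R * _ * _]mulrA lerDr mulr_ge0.
have -> : g =
    (fun i => fp%:K *: lap_act gamma u i) + ((fun=> - F o) + E).
  apply/funext => i; rewrite gE.
  rewrite -[(_ + (_ + _)) i]/(fp%:K *: lap_act gamma u i + (- F o + E i)) /E.
  rewrite {1}SE; move: (F o) (S i) (_ - _ * F o) (_ *: _) => A B A' B'.
  by apply/matrixP => p q; rewrite !mxE; ring.
rewrite disagDr [disag u (_ + E)]disagDr disag_cst add0r disagZr.
have cE : cnrm E <= n%:R * (CE * rho1 * cnrm u).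
  by rewrite -(sumr_ord_const n); apply: ler_sum => i _.
have h1 : fp * disag u (lap_act gamma u) <= fp * (- kap * disag u u).
  by rewrite ler_wpM2l // ltW.
have h2 : disag u E <= rho1 * s * disag u u.
  apply: (le_trans (ler_norm _)); apply: (le_trans (disag_le _ _)); rewrite -/b.
  have uo : u o = 0 by rewrite /u -[(w - y) o]/(w o - y o) wo yo subrr.
  have coerc := disag_ge uo; rewrite -/c0 in coerc.
  apply: (@le_trans _ _ (b * (n%:R * CE * rho1 * cnrm u ^+ 2))).
    rewrite ler_wpM2l // expr2 mulrA [leRHS]mulrC ler_wpM2l //.
    by apply: (le_trans cE); rewrite !mulrA.
  have -> : rho1 * s * disag u u = b * (n%:R * CE * rho1 * (c0 * disag u u)).
    by rewrite /s; ring.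
  by rewrite ler_wpM2l // ler_wpM2l // !mulr_ge0 // ltW.
have h3 : rho1 * s * disag u u <= kappa * disag u u.
  by rewrite ler_wpM2r // disag_ge0.
apply: (le_trans (lerD h1 (le_trans h2 h3))).
by rewrite le_eqVlt /kappa; apply/orP; left; apply/eqP; field.
Qed.

End Lyapunov.

(** * Differential equations through one-step methods *)

(** Identities between sums in an abelian group: the difference of both sides
    is flattened, then each atom is brought next to its opposite. *)
Ltac flatten_diff :=
  apply/eqP; rewrite -subr_eq0; apply/eqP;
  rewrite -[LHS]add0r !(opprD, opprK, addrA).
Ltac cancel t := rewrite ?(addrAC _ t) ?(addrAC _ (- t)) ?addrK ?addrNK.

(** The next three identities isolate the error terms of the Euler scheme, so
    that each estimate only has to bound the summands. *)
Lemma addr_split3 (U : zmodType) (p q r P Q S : U) :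
  p - r - (P + Q) = (q - r - P) + (p - q - S) + (S - Q).
Proof.
by flatten_diff; cancel p; cancel q; cancel r; cancel P; cancel Q; cancel S.
Qed.

Lemma addr_split_halving (U : zmodType) (p q Y Y1 Y2 v v' v1 v2 : U) :
  p - q = (Y1 - Y) + (v1 - v) + (v2 - v') +
    ((Y2 - Y1 - v1) + (p - Y2 - v2) - (q - Y - (v + v'))).
Proof.
by flatten_diff; cancel p; cancel q; cancel Y; cancel Y1; cancel Y2; cancel v;
  cancel v'; cancel v1; cancel v2.
Qed.

Lemma addr_split_limit (U : zmodType) (xt xs v Z X p q r : U) :
  xt - xs - v = (Z - X - p) + (p - q) + (q - v) + ((xt - Z) - (xs - X)).
Proof.
by flatten_diff; cancel xt; cancel xs; cancel v; cancel Z; cancel X; cancel p;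
  cancel q.
Qed.

Section EulerScheme.
Variables (R : realType) (k : base_field).
Local Notation K := (scalars R k).
Local Notation "x %:K" := (of_real k x) (at level 2, format "x %:K").
Variables (E : lmodType K) (nu : E -> R).
Hypothesis nuP : is_norm nu.
Hypothesis nuZ : forall (t : R) x, nu (t%:K *: x) = `|t| * nu x.
Hypothesis complete : is_complete nu.

(** One-step method [Phi] with dyadic steps [h0 / 2 ^+ N], started at [x0]. *)
Variables (Phi : R -> E -> E) (V : E -> E) (h0 : R) (x0 : E).
Hypothesis h00 : 0 < h0.

Definition euler_step (N : nat) : R := h0 / 2 ^+ N.
Definition euler_iter (N i : nat) : E := iter i (Phi (euler_step N)) x0.
(** Number of complete steps before time [t]. *)
Definition euler_index (N : nat) (t : R) : nat := Num.trunc (t / euler_step N).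
Definition euler_curve (N : nat) (t : R) : E := euler_iter N (euler_index N t).

Local Notation h := euler_step.
Local Notation y := euler_iter.

Lemma euler_step_gt0 N : 0 < h N.
Proof. by rewrite divr_gt0 // exprn_gt0. Qed.

Lemma euler_step_le N : h N <= h0.
Proof. by rewrite ler_pdivrMr ?exprn_gt0 // ler_peMr ?exprn_ege1 ?ler1n // ltW. Qed.

Lemma euler_stepS N : h N = 2 * h N.+1.
Proof. by rewrite /h exprS; field. Qed.

Lemma euler_index_itv N t : 0 <= t ->
  (euler_index N t)%:R * h N <= t < (euler_index N t).+1%:R * h N.
Proof.
move=> t0; have h1 := euler_step_gt0 N.
rewrite -ler_pdivlMr // -ltr_pdivrMr //; apply: truncn_itv.
by rewrite divr_ge0 // ltW.
Qed.

(** Halving the step doubles the index or adds one further short step, so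
    successive refinements can be compared at every time. *)
Lemma euler_indexS N t : 0 <= t ->
  euler_index N.+1 t = ((euler_index N t).*2)%N \/
  euler_index N.+1 t = ((euler_index N t).*2.+1)%N.
Proof.
move=> t0; have h1 := euler_step_gt0 N.+1.
have /andP[a b] := euler_index_itv N t0; set j := euler_index N t in a b *.
have ta : (j.*2)%:R <= t / h N.+1.
  by rewrite ler_pdivlMr // -muln2 natrM -mulrA -euler_stepS.
have tb : t / h N.+1 < (j.*2.+2)%:R.
  rewrite ltr_pdivrMr // -[j.*2.+2]/((j.+1).*2) -muln2 natrM -mulrA -euler_stepS.
  exact: b.
have [tc|tc] := leP (j.*2.+1)%:R (t / h N.+1).
  by right; apply: truncn_def; rewrite tc tb.
by left; apply: truncn_def; rewrite ta tc.
Qed.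

Section Horizon.
Variables (T C : R) (A : set E).
Hypothesis T0 : 0 <= T.
Hypothesis C0 : 0 <= C.
Hypothesis yA : forall N i, i%:R * h N <= T -> A (y N i).
Hypothesis consistent : forall x s, A x -> 0 < s -> s <= h0 ->
  nu (Phi s x - x - s%:K *: V x) <= C * s ^+ 2.
Hypothesis V_bounded : forall x, A x -> nu (V x) <= C.
Hypothesis V_lipschitz : forall x x', A x -> A x' -> nu (V x - V x') <= C * nu (x - x').
Hypothesis A_closed : forall u l, (forall p, A (u p)) -> converges nu u l -> A l.

Let D := C * (1 + h0).
Let D0 : 0 <= D. Proof. by rewrite mulr_ge0 // addr_ge0 // ltW. Qed.

Lemma step_size x s : A x -> 0 < s -> s <= h0 -> nu (Phi s x - x) <= D * s.
Proof.
move=> Ax s0 sh; apply: (le_trans (nu_le_dist nuP _ (s%:K *: V x))).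
apply: (le_trans (lerD (lexx _) (consistent Ax s0 sh))).
rewrite nuZ gtr0_norm //.
have h1 : s * nu (V x) <= s * C by rewrite ler_wpM2l ?V_bounded // ltW.
have h2 : C * s ^+ 2 <= C * (h0 * s).
  by rewrite ler_wpM2l // expr2 ler_wpM2r // ltW.
rewrite /D; lra.
Qed.

Lemma euler_iter_dist N i l : (i + l)%:R * h N <= T ->
  nu (y N (i + l)%N - y N i) <= l%:R * (D * h N).
Proof.
have h1 := euler_step_gt0 N; elim: l => [|l IH] hT.
  by rewrite addn0 subrr (nu0 nuP) mul0r.
have hT' : (i + l)%:R * h N <= T.
  by apply: le_trans hT; rewrite ler_wpM2r ?ler_nat ?leq_add2l // ltW.
apply: (le_trans (nu_dist_trans nuP (y N (i + l)%N) _ _)).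
rewrite addnS -[y N _.+1]/(Phi (h N) (y N (i + l)%N)).
apply: (le_trans (lerD (step_size (yA hT') h1 (euler_step_le N)) (IH hT'))).
by rewrite -[l.+1]addn1 natrD; lra.
Qed.

Let F := C * D + C.
Let F0 : 0 <= F. Proof. by apply: addr_ge0 => //; apply: mulr_ge0. Qed.

(** During [l] steps the velocity varies by at most [C * D * (l * h N)], which
    contributes an error of second order in the elapsed time. *)
Lemma euler_iter_taylor N i l : (i + l)%:R * h N <= T ->
  nu (y N (i + l)%N - y N i - (l%:R * h N)%:K *: V (y N i)) <= F * (l%:R * h N) ^+ 2.
Proof.
have h1 := euler_step_gt0 N; elim: l => [|l IH] hT.
  by rewrite addn0 subrr mul0r rmorph0 scale0r subrr (nu0 nuP) expr2 mul0r mulr0.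
have hT' : (i + l)%:R * h N <= T.
  by apply: le_trans hT; rewrite ler_wpM2r ?ler_nat ?leq_add2l // ltW.
have hT'' : i%:R * h N <= T.
  by apply: le_trans hT'; rewrite ler_wpM2r ?ler_nat ?leq_addr // ltW.
rewrite addnS -[y N _.+1]/(Phi (h N) (y N (i + l)%N)).
have IHl := IH hT'; set z := y N (i + l)%N in IHl *; set x := y N i in IHl *.
have Az : A z by exact: yA.
have Ax : A x by exact: yA.
have -> : Phi (h N) z - x - (l.+1%:R * h N)%:K *: V x =
    (z - x - (l%:R * h N)%:K *: V x) + (Phi (h N) z - z - (h N)%:K *: V z)
    + (h N)%:K *: (V z - V x).
  rewrite -[l.+1]addn1 natrD mulrDl mul1r rmorphD scalerDl scalerBr.
  exact: addr_split3.
apply: (le_trans (nuD nuP _ _)); apply: (le_trans (lerD (nuD nuP _ _) (lexx _))).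
have g1 := consistent Az h1 (euler_step_le N).
have g2 : nu ((h N)%:K *: (V z - V x)) <= h N * (C * (l%:R * (D * h N))).
  rewrite nuZ gtr0_norm // ler_wpM2l //; first exact: ltW.
  apply: (le_trans (V_lipschitz Az Ax)); rewrite ler_wpM2l //.
  exact: euler_iter_dist.
apply: (le_trans (lerD (lerD IHl g1) g2)).
have -> : F * (l%:R * h N) ^+ 2 + C * h N ^+ 2 + h N * (C * (l%:R * (D * h N))) =
   (F * l%:R ^+ 2 + C + C * D * l%:R) * h N ^+ 2 by ring.
have -> : F * (l.+1%:R * h N) ^+ 2 = (F * l.+1%:R ^+ 2) * h N ^+ 2 by ring.
rewrite ler_wpM2r ?exprn_ge0 ?(ltW h1) // -[l.+1]addn1 natrD.
have g3 : C * D * l%:R <= F * l%:R by rewrite ler_wpM2r // lerDl.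
have g4 : C <= F by rewrite lerDr mulr_ge0.
have g5 : 0 <= F * l%:R by rewrite mulr_ge0.
have -> : F * (l%:R + 1) ^+ 2 = F * l%:R ^+ 2 + F * l%:R *+ 2 + F by ring.
lra.
Qed.

Let c := C * D + 6 * C.
Let c0 : 0 <= c. Proof. by apply: addr_ge0; apply: mulr_ge0. Qed.

(** Discrete Gronwall estimate: two half steps differ from a full one by a local
    error of second order, and each step amplifies the error that is already
    there by at most [1 + 2 * C * h N.+1]. *)
Lemma euler_halving N i : i%:R * h N <= T ->
  nu (y N.+1 i.*2 - y N i) <= i%:R * (c * h N.+1 ^+ 2) * (1 + 2 * C * h N.+1) ^+ i.
Proof.
set s := h N.+1; have s0 : 0 < s := euler_step_gt0 N.+1.
set q := 1 + 2 * C * s; have q1 : 1 <= q.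
  by rewrite lerDl mulr_ge0 ?mulr_ge0 // ltW.
have q0 : 0 <= q by rewrite (le_trans _ q1).
have hN : h N = 2 * s := euler_stepS N.
elim: i => [|i IH] hT; first by rewrite subrr (nu0 nuP) !mul0r.
have hT' : i%:R * h N <= T.
  by apply: le_trans hT; rewrite ler_wpM2r ?ler_nat // ltW // euler_step_gt0.
have hT2 : (i.*2.+1)%:R * s <= T.
  apply: le_trans hT; rewrite hN mulrA ler_wpM2r ?(ltW s0) //.
  by rewrite -natrM ler_nat muln2 doubleS.
have hT1 : (i.*2)%:R * s <= T.
  by apply: le_trans hT2; rewrite ler_wpM2r ?ler_nat // ltW.
rewrite doubleS.
have Ay := yA hT'; have Ay1 := @yA N.+1 i.*2 hT1; have Ay2 := @yA N.+1 i.*2.+1 hT2.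
have IHi := IH hT'; set d := nu (_ - _) in IHi.
set Y := y N i in Ay d IHi; set Y1 := y N.+1 i.*2 in Ay1 d IHi.
set Y2 := y N.+1 i.*2.+1 in Ay2.
rewrite -[y N.+1 i.*2.+2]/(Phi s Y2) -[y N i.+1]/(Phi (h N) Y).
have Y2E : Y2 = Phi s Y1 by [].
have ss : s <= h0 := euler_step_le N.+1.
have e1 := consistent Ay (euler_step_gt0 N) (euler_step_le N).
have e2 := consistent Ay1 s0 ss; rewrite -Y2E in e2.
have e3 := consistent Ay2 s0 ss.
have Y21 : nu (Y2 - Y1) <= D * s by rewrite Y2E step_size.
have -> : Phi s Y2 - Phi (h N) Y =
    (Y1 - Y) + s%:K *: (V Y1 - V Y) + s%:K *: (V Y2 - V Y) +
    ((Y2 - Y1 - s%:K *: V Y1) + (Phi s Y2 - Y2 - s%:K *: V Y2)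
     - (Phi (h N) Y - Y - (h N)%:K *: V Y)).
  have double v : (h N)%:K *: v = s%:K *: v + s%:K *: v.
    by rewrite hN -scalerDl -rmorphD -mulr2n mulr_natl.
  rewrite double !scalerBr.
  exact: addr_split_halving.
rewrite hN in e1.
have g1 : nu (s%:K *: (V Y1 - V Y)) <= s * (C * d).
  by rewrite nuZ gtr0_norm // ler_wpM2l ?(ltW s0) // V_lipschitz.
have g2 : nu (s%:K *: (V Y2 - V Y)) <= s * (C * (D * s + d)).
  rewrite nuZ gtr0_norm // ler_wpM2l ?(ltW s0) // (le_trans (V_lipschitz Ay2 Ay)) //.
  by rewrite ler_wpM2l // (le_trans (nu_dist_trans nuP Y1 _ _)) // lerD2r.
have g3 : nu ((Y2 - Y1 - s%:K *: V Y1) + (Phi s Y2 - Y2 - s%:K *: V Y2)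
     - (Phi (h N) Y - Y - (h N)%:K *: V Y)) <= C * s ^+ 2 + C * s ^+ 2 + C * (2 * s) ^+ 2.
  rewrite (le_trans (nuB nuP _ _)) // lerD //; last by rewrite hN.
  by rewrite (le_trans (nuD nuP _ _)) // lerD.
apply: (le_trans (nuD nuP _ _)).
apply: (le_trans (lerD (nuD nuP _ _) g3)).
apply: (le_trans (lerD (lerD (nuD nuP _ _) g2) (lexx _))).
apply: (le_trans (lerD (lerD (lerD (lexx _) g1) (lexx _)) (lexx _))).
rewrite -/d.
have -> : d + s * (C * d) + s * (C * (D * s + d)) +
    (C * s ^+ 2 + C * s ^+ 2 + C * (2 * s) ^+ 2) = q * d + c * s ^+ 2.
  by rewrite /q /c; ring.
have g4 : q * d <= q * (i%:R * (c * s ^+ 2) * q ^+ i) by rewrite ler_wpM2l.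
have g5 : c * s ^+ 2 <= c * s ^+ 2 * q ^+ i.+1.
  by rewrite ler_peMr ?exprn_ege1 // mulr_ge0 // exprn_ge0 // ltW.
apply: (le_trans (lerD g4 g5)).
by rewrite [q ^+ i.+1]exprS -[i.+1]addn1 natrD; lra.
Qed.

Let C2 := c * T * expR (C * T).
Let C20 : 0 <= C2. Proof. by rewrite !mulr_ge0 // expR_ge0. Qed.

Lemma euler_halving_le N i : i%:R * h N <= T -> nu (y N.+1 i.*2 - y N i) <= C2 * h N.
Proof.
move=> hT; apply: (le_trans (euler_halving hT)).
have s0 := euler_step_gt0 N.+1; have hN := euler_stepS N.
have h1 := euler_step_gt0 N.
have e1 : (1 + 2 * C * h N.+1) ^+ i <= expR (C * T).
  have u0 : 0 <= 2 * C * h N.+1 by rewrite !mulr_ge0 // ltW.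
  apply: (@le_trans _ _ (expR (2 * C * h N.+1) ^+ i)).
    by rewrite lerXn2r ?nnegrE ?addr_ge0 ?expR_ge0 // expR_ge1Dx.
  rewrite -expRM_natl ler_expR.
  have -> : i%:R * (2 * C * h N.+1) = C * (i%:R * h N) by rewrite hN; ring.
  by rewrite ler_wpM2l.
have e2 : i%:R * (c * h N.+1 ^+ 2) <= c * T * h N.
  have -> : i%:R * (c * h N.+1 ^+ 2) = c * (i%:R * h N) * (h N / 4) by rewrite hN; field.
  have i0 : 0 <= i%:R * h N by rewrite mulr_ge0 // ltW.
  have h4 : h N / 4 <= h N by rewrite ler_pdivrMr // ler_peMr ?(ltW h1) // ler1n.
  apply: ler_pM h4; [exact: mulr_ge0|by rewrite divr_ge0 // ltW|].
  by rewrite ler_wpM2l.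
rewrite /C2 [leRHS]mulrAC; apply: ler_pM => //.
  exact: mulr_ge0 (ler0n _ _) (mulr_ge0 c0 (sqr_ge0 _)).
by rewrite exprn_ge0 // addr_ge0 // mulr_ge0 ?(ltW s0) // mulr_ge0.
Qed.

Lemma euler_index_le N t : 0 <= t -> t <= T -> (euler_index N t)%:R * h N <= T.
Proof. by move=> t0; have /andP[a _] := euler_index_itv N t0; exact: le_trans. Qed.

Let C3 := (C2 + D) * h0.
Let C30 : 0 <= C3. Proof. by rewrite mulr_ge0 ?addr_ge0 // ltW. Qed.

Lemma euler_curve_converges t : 0 <= t -> t <= T ->
  exists2 l, converges nu (euler_curve^~ t) l &
    forall N, nu (euler_curve N t - l) <= C3 *+ 2 / 2 ^+ N.
Proof.
move=> t0 tT; apply: (geometric_converges nuP complete C30) => N.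
have h1 := euler_step_gt0 N; have hN := euler_stepS N.
have iT := euler_index_le N t0 tT; have iT' := euler_index_le N.+1 t0 tT.
have g := euler_halving_le iT.
have -> : C3 / 2 ^+ N = C2 * h N + D * h N by rewrite /C3 /h; ring.
rewrite /euler_curve; case: (euler_indexS N t0) => iE; rewrite iE in iT' *.
  by rewrite (le_trans g) // lerDl mulr_ge0 // ltW.
apply: (le_trans (nu_dist_trans nuP (y N.+1 (euler_index N t).*2) _ _)).
rewrite addrC; apply: lerD => //.
have s0 := euler_step_gt0 N.+1.
apply: (le_trans (step_size _ s0 (euler_step_le N.+1))).
  apply: yA; apply: le_trans iT'; rewrite ler_wpM2r ?ler_nat // ltW //.
by rewrite hN; have := mulr_ge0 D0 (ltW s0); lra.
Qed.

Lemma euler_limit_mem t l : 0 <= t -> t <= T -> converges nu (euler_curve^~ t) l -> A l.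
Proof.
move=> t0 tT cl; apply: (A_closed _ cl) => N; apply: yA.
exact: euler_index_le.
Qed.

(** Consistency passes to the limit: all the additional errors at level [N] are
    [O(2^-N)], and [W] collects their constants. *)
Lemma euler_limit_taylor s t xs xt : 0 <= s -> s <= t -> t <= T ->
  converges nu (euler_curve^~ s) xs -> converges nu (euler_curve^~ t) xt ->
  nu (xt - xs - (t - s)%:K *: V xs) <= F * (t - s) ^+ 2.
Proof.
move=> s0 st tT cs ct; have t0 := le_trans s0 st; have sT := le_trans st tT.
have rate r l : 0 <= r -> r <= T -> converges nu (euler_curve^~ r) l ->
    forall N, nu (euler_curve N r - l) <= C3 *+ 2 / 2 ^+ N.
  move=> r0 rT cl; have [l' cl' hl'] := euler_curve_converges r0 rT.
  by rewrite (converges_unique nuP cl cl').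
have As : A xs := euler_limit_mem s0 sT cs.
pose W := C3 *+ 2 * 2 + F * ((2 * T + h0) * h0) + h0 * C + T * (C * (C3 *+ 2)).
have W0 : 0 <= W.
  have h0' := ltW h00.
  rewrite !addr_ge0 //; first by rewrite mulr_ge0 // mulrn_wge0.
  - by rewrite mulr_ge0 // mulr_ge0 // addr_ge0 // mulr_ge0.
  - by rewrite mulr_ge0.
  - by rewrite !mulr_ge0 // mulrn_wge0.
suff key N : nu (xt - xs - (t - s)%:K *: V xs) <= F * (t - s) ^+ 2 + W / 2 ^+ N.
  apply/ler_addgt0Pr => e e0; have [N hN] := null_inv W0 e0.
  apply: (le_trans (key N)); rewrite lerD2l; apply: le_trans (hN N (leqnn _)).
  by rewrite ler_wpM2l // lef_pV2 ?posrE ?exprn_gt0 // -natrX ler_nat ltn_expl.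
have rs := rate _ _ s0 sT cs N; have rt := rate _ _ t0 tT ct N.
have h1 := euler_step_gt0 N; set X := euler_curve N s in rs; set Z := euler_curve N t in rt.
have AX : A X by apply: yA; exact: euler_index_le.
have /andP[is1 is2] := euler_index_itv N s0; have /andP[it1 it2] := euler_index_itv N t0.
set i := euler_index N s in is1 is2; set j := euler_index N t in it1 it2.
have ij : (i <= j)%N.
  by apply: le_truncn; rewrite ler_wpM2r // invr_ge0 ltW.
set l := (j - i)%N; have jE : j = (i + l)%N by rewrite subnKC.
have lT : (i + l)%:R * h N <= T by rewrite -jE; exact: euler_index_le.
have tay := euler_iter_taylor lT; rewrite -jE -/X -/Z in tay.
have lE : l%:R * h N = j%:R * h N - i%:R * h N by rewrite /l natrB // mulrBl.
have hl : `|l%:R * h N - (t - s)| <= h N.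
  move: is2 it2; rewrite lE ler_norml -[i.+1]addn1 -[j.+1]addn1 !natrD !mulrDl !mul1r.
  by move=> is2 it2; apply/andP; split; lra.
have -> : xt - xs - (t - s)%:K *: V xs =
   (Z - X - (l%:R * h N)%:K *: V X) + ((l%:R * h N - (t - s))%:K *: V X)
   + ((t - s)%:K *: (V X - V xs)) + ((xt - Z) - (xs - X)).
  clear hl lE; move: (t - s) (l%:R * h N) => r r'.
  rewrite rmorphB scalerBl scalerBr; exact: addr_split_limit.
have g1 : nu (Z - X - (l%:R * h N)%:K *: V X) <= F * (t - s) ^+ 2 + F * ((2 * T + h0) * h N).
  apply: (le_trans tay); rewrite -mulrDr ler_wpM2l //.
  have lu : l%:R * h N <= t - s + h N by move: hl; rewrite ler_norml => /andP[]; lra.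
  apply: (@le_trans _ _ ((t - s + h N) ^+ 2)).
    have a0 : 0 <= l%:R * h N := mulr_ge0 (ler0n _ _) (ltW h1).
    have b0 : 0 <= t - s + h N by apply: addr_ge0 (ltW h1); rewrite subr_ge0.
    by rewrite lerXn2r ?nnegrE.
  have -> : (t - s + h N) ^+ 2 = (t - s) ^+ 2 + (2 * (t - s) + h N) * h N by ring.
  rewrite lerD2l ler_wpM2r ?(ltW h1) // lerD ?euler_step_le // ler_wpM2l //.
  by rewrite lerBlDr (le_trans tT) // lerDl.
have g2 : nu ((l%:R * h N - (t - s))%:K *: V X) <= h N * C.
  by rewrite nuZ ler_pM ?(nu_ge0 nuP) // V_bounded.
have g3 : nu ((t - s)%:K *: (V X - V xs)) <= T * (C * (C3 *+ 2 / 2 ^+ N)).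
  rewrite nuZ ger0_norm ?subr_ge0 // ler_pM ?subr_ge0 ?(nu_ge0 nuP) //.
    by rewrite lerBlDr (le_trans tT) // lerDl.
  by rewrite (le_trans (V_lipschitz AX As)) // ler_wpM2l.
have g4 : nu ((xt - Z) - (xs - X)) <= C3 *+ 2 / 2 ^+ N + C3 *+ 2 / 2 ^+ N.
  by rewrite (le_trans (nuB nuP _ _)) // lerD // nu_distC.
apply: (le_trans (nuD nuP _ _)).
apply: (le_trans (lerD (nuD nuP _ _) g4)).
apply: (le_trans (lerD (lerD (nuD nuP _ _) g3) (lexx _))).
apply: (le_trans (lerD (lerD (lerD g1 g2) (lexx _)) (lexx _))).
rewrite le_eqVlt; apply/orP; left; apply/eqP.
by rewrite /W /h; field.
Qed.

End Horizon.

End EulerScheme.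

Section EulerExistence.
Variables (R : realType) (k : base_field).
Local Notation K := (scalars R k).
Local Notation "x %:K" := (of_real k x) (at level 2, format "x %:K").
Variables (E : lmodType K) (nu : E -> R).
Hypothesis nuP : is_norm nu.
Hypothesis nuZ : forall (t : R) x, nu (t%:K *: x) = `|t| * nu x.
Hypothesis complete : is_complete nu.
Variables (S : R -> set E) (Phi : R -> E -> E) (V : E -> E) (h0 M : R).
Hypothesis h00 : 0 < h0.
Hypothesis M0 : 0 <= M.
Hypothesis S_mono : forall rho rho' x, rho <= rho' -> S rho x -> S rho' x.
Hypothesis Phi_S : forall rho x s, 0 <= rho -> S rho x -> 0 < s -> s <= h0 ->
  S (rho * expR (M * s)) (Phi s x).
Hypothesis S_closed : forall rho u l,
  (forall p, S rho (u p)) -> converges nu u l -> S rho l.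
Hypothesis S_local : forall rho, 0 <= rho -> exists2 C : R, 0 <= C &
  [/\ forall x s, S rho x -> 0 < s -> s <= h0 ->
        nu (Phi s x - x - s%:K *: V x) <= C * s ^+ 2,
      forall x, S rho x -> nu (V x) <= C &
      forall x x', S rho x -> S rho x' -> nu (V x - V x') <= C * nu (x - x')].

(** Global existence for [x' = V x] from a consistent one-step method under
    which the sets [S rho] are invariant up to an exponential growth of [rho];
    on a bounded time interval the iterates then stay in a single [S rho], where
    the local estimates are uniform. *)
Lemma euler_solution rho0 x0 : 0 <= rho0 -> S rho0 x0 ->
  exists x : R -> E, [/\ x 0 = x0,
    forall t, 0 <= t -> exists2 rho, 0 <= rho & S rho (x t) &
    forall t, 0 <= t -> forall e : R, 0 < e -> exists2 d : R, 0 < d &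
      forall s, 0 <= s -> `|s - t| < d ->
        nu (x s - x t - (s - t)%:K *: V (x t)) <= e * `|s - t|].
Proof.
move=> r0 Sx0; pose rho T := rho0 * expR (M * T).
have rho_ge0 T : 0 <= rho T by rewrite mulr_ge0 ?expR_ge0.
have yS T N i : i%:R * euler_step h0 N <= T ->
    S (rho T) (euler_iter Phi h0 x0 N i).
  move=> hT; apply: (@S_mono (rho (i%:R * euler_step h0 N))).
    by rewrite ler_wpM2l // ler_expR ler_wpM2l.
  elim: i {hT} => [|i IH]; first by rewrite /rho mul0r mulr0 expR0 mulr1.
  have -> : rho (i.+1%:R * euler_step h0 N) =
      rho (i%:R * euler_step h0 N) * expR (M * euler_step h0 N).
    rewrite /rho -mulrA -expRD; congr (_ * expR _).
    by rewrite -natr1; ring.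
  by apply: Phi_S; [exact: rho_ge0|exact: IH|exact: euler_step_gt0|exact: euler_step_le].
have /choice[x cx] t : exists l, 0 <= t -> converges nu (euler_curve Phi h0 x0 ^~ t) l.
  have [t0|t0] := leP 0 t; last by exists x0.
  have [C C0 [h1 h2 h3]] := S_local (rho_ge0 t).
  have [l cl _] := euler_curve_converges nuP nuZ complete h00 t0 C0 (@yS t) h1 h2 h3 t0 (lexx t).
  by exists l.
exists x; split.
- apply: (converges_unique nuP (cx _ (lexx 0))).
  apply: (converges_near (N0 := 0%N) (converges_cst nuP x0)) => N _.
  by rewrite /euler_curve /euler_index mul0r truncn0.
- move=> t t0; exists (rho t) => //.
  apply: (@euler_limit_mem _ _ _ nu Phi h0 x0 h00 t (S (rho t)) (@yS t)) t0 (lexx t) (cx t t0).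
  exact: S_closed.
move=> t t0 e e0; pose T := t + 1; have T0 : 0 <= T by rewrite addr_ge0.
have [C C0 [h1 h2 h3]] := S_local (rho_ge0 T).
have clos := @S_closed (rho T).
pose F := C * (C * (1 + h0)) + C.
have F0 : 0 <= F by rewrite addr_ge0 // mulr_ge0 // mulr_ge0 // addr_ge0 // ltW.
have taylor s r : 0 <= s -> s <= r -> r <= T ->
    nu (x r - x s - (r - s)%:K *: V (x s)) <= F * (r - s) ^+ 2.
  move=> s0 sr rT.
  exact: (euler_limit_taylor nuP nuZ complete h00 T0 C0 (@yS T) h1 h2 h3 clos
    s0 sr rT (cx s s0) (cx r (le_trans s0 sr))).
have mem s : 0 <= s -> s <= T -> S (rho T) (x s).
  move=> s0 sT.
  exact: (euler_limit_mem h00 (@yS T) clos s0 sT (cx s s0)).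
pose F' := F + C * (F + C).
have FF' : F <= F' by rewrite lerDl mulr_ge0 // addr_ge0.
have F'0 : 0 <= F' := le_trans F0 FF'.
have F'1 : 0 < F' + 1 by rewrite ltr_wpDl.
exists (Num.min 1 (e / (F' + 1))); first by rewrite lt_min ltr01 divr_gt0.
move=> s s0; rewrite lt_min => /andP[st1 ste].
have small : F' * `|s - t| ^+ 2 <= e * `|s - t|.
  rewrite expr2 mulrA ler_wpM2r // (@le_trans _ _ (`|s - t| * (F' + 1))) //.
    by rewrite mulrC ler_wpM2l // lerDl.
  by rewrite -ler_pdivlMr // ltW.
apply: le_trans small; have [ts|st] := leP t s.
  rewrite ger0_norm ?subr_ge0 //; rewrite ger0_norm ?subr_ge0 // in st1.
  apply: (le_trans (taylor _ _ t0 ts _)); first by rewrite /T; lra.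
  by rewrite ler_wpM2r // sqr_ge0.
have ts0 : 0 <= t - s by rewrite subr_ge0 ltW.
rewrite distrC ger0_norm //; rewrite distrC ger0_norm // in st1.
have tT : t <= T by rewrite lerDl.
have sT : s <= T := le_trans (ltW st) tT.
have tay := taylor _ _ s0 (ltW st) tT.
(* The scheme only gives expansions forward in time; for [s < t] the expansion
   at [s] is used and the velocity is moved from [s] to [t]. *)
have -> : x s - x t - (s - t)%:K *: V (x t) =
   - (x t - x s - (t - s)%:K *: V (x s)) + (t - s)%:K *: (V (x t) - V (x s)).
  rewrite -[s - t]opprB rmorphN scaleNr scalerBr.
  move: (x t) (x s) (_ *: V (x t)) (_ *: V (x s)) => P Q U W.
  by flatten_diff; cancel P; cancel Q; cancel U; cancel W.
apply: (le_trans (nuD nuP _ _)); rewrite (nuN nuP) nuZ ger0_norm //.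
have sq : F * (t - s) ^+ 2 <= F * (t - s).
  by rewrite ler_wpM2l // expr2 ler_piMl // ltW.
have dx : nu (x t - x s) <= (F + C) * (t - s).
  apply: (le_trans (nu_le_dist nuP _ ((t - s)%:K *: V (x s)))).
  rewrite nuZ ger0_norm //.
  have := ler_wpM2l ts0 (h2 _ (mem s s0 sT)); lra.
have dV := le_trans (h3 _ _ (mem t t0 tT) (mem s s0 sT)) (ler_wpM2l C0 dx).
have := ler_wpM2l ts0 dV.
have -> : F' * (t - s) ^+ 2 = F * (t - s) ^+ 2 + (t - s) * (C * ((F + C) * (t - s))).
  by rewrite /F'; ring.
lra.
Qed.

End EulerExistence.

(** * Configurations modulo right multiplication *)

Section Ratios.
Variables (R : realType) (k : base_field) (m n : nat).
Local Notation K := (scalars R k).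
Local Notation "x %:K" := (of_real k x) (at level 2, format "x %:K").
Local Notation nrm := (@nrm R k m).
Local Notation nrmP := (@nrm_is_norm R k m).
Local Notation cnrm := (sum_norm nrm).
Local Notation cnrmP := (cnrm_is_norm R k m n).
Local Notation config := ('I_n -> 'M[K]_m).
Implicit Types (X w u z F : config).

Lemma cnrmZ (t : R) X : cnrm (t%:K *: X) = `|t| * cnrm X.
Proof. by rewrite /sum_norm mulr_sumr; apply: eq_bigr => i _; rewrite nrmZ. Qed.

(** Representative of the class of [X] modulo right multiplication. *)
Definition ratios X (o : 'I_n) : config := fun i => X i *m invmx (X o).

Lemma ratio_base X o : X o \in unitmx -> ratios X o o = 1.
Proof. by move=> u; rewrite /ratios mulmxV. Qed.

Lemma ratio_unit X o : (forall i, X i \in unitmx) -> forall i, ratios X o i \in unitmx.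
Proof. by move=> uX i; rewrite /ratios unitmx_mul uX unitmx_inv uX. Qed.

Lemma ratio_mulr_inv X Z o : X o \in unitmx -> Z \in unitmx ->
  ratios (fun i => X i *m Z) o = ratios X o.
Proof. by move=> uX uZ; apply/funext => i; exact: ratio_mulr. Qed.

Lemma kuramoto_rhs_ratio gamma a eps Omega X o : (forall i, X i \in unitmx) ->
  kuramoto_rhs gamma a eps Omega (ratios X o) = kuramoto_rhs gamma a eps Omega X.
Proof.
move=> uX; have uV : invmx (X o) \in unitmx by rewrite unitmx_inv.
have E := coupling_mulr gamma a uX uV.
exact: (congr1 (fun (f : config) i => eps%:K *: Omega i + f i) E).
Qed.

(** First-order expansion of the ratios when [X] moves to [X'], with [h] the
    elapsed time and [F] the logarithmic velocities. *)
Lemma ratio_step (h eta : R) X X' F o :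
  (forall i, X i \in unitmx) -> X' o \in unitmx ->
  (forall i, nrm ((X' i - X i) *m invmx (X o) - h%:K *: (F i *m ratios X o i)) <= eta) ->
  `|h| * nrm (F o) + eta <= 2^-1 ->
  forall j, nrm (ratios X' o j - ratios X o j - h%:K *: drift F o (ratios X o) j) <=
    2 * (1 + nrm (ratios X o j)) * eta +
    2 * `|h| * nrm (drift F o (ratios X o) j) * (`|h| * nrm (F o) + eta).
Proof.
move=> uX uX' hp hs j; set w := ratios X o in hp *.
have eta0 : 0 <= eta := le_trans (nrm_ge0 _) (hp o).
pose p i := (X' i - X i) *m invmx (X o) - h%:K *: (F i *m w i).
pose b i := X' i *m invmx (X o).
have wo : w o = 1 by exact: ratio_base.
have bE i : b i = w i + h%:K *: (F i *m w i) + p i.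
  rewrite /p mulmxBl /b -/(ratios X o i) -/w.
  move: (X' i *m _) (w i) (_ *: _) => P Q U.
  by flatten_diff; cancel P; cancel Q; cancel U.
have {}hp i : nrm (p i) <= eta := hp i.
clearbody p.
have ub : b o \in unitmx by rewrite /b unitmx_mul uX' unitmx_inv uX.
have bo : nrm (b o - 1) <= `|h| * nrm (F o) + eta.
  have -> : b o - 1 = h%:K *: F o + p o.
    by rewrite bE wo mulmx1 [1 + _]addrC addrAC addrK.
  by rewrite (le_trans (nuD nrmP _ _)) // nrmZ lerD2l; exact: hp.
have inv1 := invmx_near1 ub hs bo.
set c := `|h| * nrm (F o) + eta in hs bo inv1 *.
have c0 : 0 <= c := le_trans (nrm_ge0 _) bo.
have ratioE : ratios X' o j = b j *m invmx (b o).
  by rewrite /b ratio_mulr // unitmx_inv.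
have -> : ratios X' o j - w j - h%:K *: drift F o w j =
   (p j - w j *m p o) *m invmx (b o) + h%:K *: (drift F o w j *m (invmx (b o) - 1)).
  have -> : ratios X' o j = w j + (b j - w j *m b o) *m invmx (b o).
    by rewrite ratioE mulmxBl (mulmxK ub) subrKC.
  have -> : b j - w j *m b o = h%:K *: drift F o w j + (p j - w j *m p o).
    rewrite !bE wo mulmx1 2!mulmxDr mulmx1 /drift scalerBr -scalemxAr.
    move: (w j) (h%:K *: (F j *m w j)) (p j) (h%:K *: (w j *m F o)) (w j *m p o) => P Q U V W.
    by flatten_diff; cancel P; cancel Q; cancel U; cancel V; cancel W.
  rewrite [X in w j + X]mulmxDl [_ *m (invmx (b o) - 1)]mulmxBr mulmx1.
  rewrite [in RHS]scalerBr -scalemxAl.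
  move: (w j) (h%:K *: drift F o w j) ((p j - w j *m p o) *m invmx (b o))
    (h%:K *: (drift F o w j *m invmx (b o))).
  by move=> P Q U V; flatten_diff; cancel P; cancel Q; cancel U; cancel V.
have pE : nrm (p j - w j *m p o) <= (1 + nrm (w j)) * eta.
  apply: (le_trans (nuB nrmP _ _)); rewrite [leRHS]mulrDl mul1r.
  apply: lerD; first exact: hp.
  by apply: (le_trans (nrmM _ _)); apply: ler_wpM2l (hp o); exact: nrm_ge0.
have p0 : 0 <= (1 + nrm (w j)) * eta := le_trans (nrm_ge0 _) pE.
apply: (le_trans (nuD nrmP _ _)); apply: lerD.
  have -> : (p j - w j *m p o) *m invmx (b o) =
     (p j - w j *m p o) + (p j - w j *m p o) *m (invmx (b o) - 1).
    by rewrite mulmxBr mulmx1 subrKC.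
  apply: (le_trans (nuD nrmP _ _)).
  have h1 : nrm ((p j - w j *m p o) *m (invmx (b o) - 1)) <=
      ((1 + nrm (w j)) * eta) * 1.
    rewrite (le_trans (nrmM _ _)) // ler_pM ?nrm_ge0 // (le_trans inv1) //.
    by move: hs; lra.
  by apply: (le_trans (lerD pE h1)); rewrite mulr1; lra.
rewrite nrmZ -!mulrA mulrCA ler_wpM2l //.
apply: (le_trans (nrmM _ _)); rewrite mulrCA ler_wpM2l ?nrm_ge0 //.
Qed.

(** Only the inverse of [X o] has to be bounded: [X'] enters through its
    ratios. *)
Lemma ratio_dist X X' o (r N1 : R) :
  X' o \in unitmx -> X o \in unitmx -> nrm (invmx (X o)) <= r ->
  (forall j, nrm (ratios X' o j) <= N1) ->
  forall j, nrm (ratios X o j - ratios X' o j) <= (1 + N1) * cnrm (X - X') * r.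
Proof.
move=> uX' uX hr hN j.
have r0 : 0 <= r := le_trans (nrm_ge0 _) hr.
have -> : ratios X o j - ratios X' o j =
    ((X j - X' j) - ratios X' o j *m (X o - X' o)) *m invmx (X o).
  have E : ratios X' o j *m X' o = X' j by rewrite /ratios mulmxKV.
  by rewrite mulmxBr E opprB addrA subrK mulmxBl (mulmxK uX).
apply: (le_trans (nrmM _ _)); apply: ler_pM; rewrite ?nrm_ge0 //.
apply: (le_trans (nuB nrmP _ _)); rewrite mulrDl mul1r.
have hj i : nrm (X i - X' i) <= cnrm (X - X') := sum_norm_coord nrmP (X - X') i.
rewrite lerD //; apply: (le_trans (nrmM _ _)).
by rewrite ler_pM ?nrm_ge0.
Qed.

Lemma disag_shift u z : disag (u + z) (u + z) = disag u u + 2 * disag u z + disag z z.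
Proof. by rewrite disagDr !disagDl [disag z u]disagC; ring. Qed.

Lemma disag_dist u z :
  `|disag u u - disag z z| <= disag_bound R n * (cnrm (u - z) * (cnrm u + cnrm z)).
Proof.
have -> : disag u u - disag z z = disag (u - z) u + disag z (u - z).
  have H v : disag (z + v) (z + v) - disag z z = disag v (z + v) + disag z v.
    by rewrite disag_shift disagDr [disag v z]disagC; ring.
  by have := H (u - z); rewrite subrKC.
apply: (le_trans (ler_normD _ _)); rewrite mulrDr mulrDr lerD ?disag_le //.
by rewrite [cnrm (u - z) * _]mulrC disag_le.
Qed.

Section Quotient.
Variables (y : config) (o : 'I_n).

(** Lyapunov function: invariant under right multiplication, and vanishing
    exactly on the class of the configurations with ratios [y]. *)
Definition spread X : R := disag (ratios X o - y) (ratios X o - y).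

Lemma spread_ge0 X : 0 <= spread X. Proof. exact: disag_ge0. Qed.

Lemma spread_mulr X Z : X o \in unitmx -> Z \in unitmx ->
  spread (fun i => X i *m Z) = spread X.
Proof. by move=> uX uZ; rewrite /spread ratio_mulr_inv. Qed.

Lemma spread_coercive X : X o \in unitmx -> y o = 1 ->
  cnrm (ratios X o - y) ^+ 2 <= disag_coercivity R m n * spread X.
Proof.
move=> uX yo; apply: (disag_ge (o := o)).
by rewrite -[(_ - _) o]/(ratios X o o - y o) ratio_base // yo subrr.
Qed.

End Quotient.
End Ratios.

(** * Decay along a differential inequality *)

Section Decay.
Variable R : realType.

(** [w] has derivative [D] on [[0, +oo[], one-sided at [0]. *)
Definition has_rate (w D : R -> R) := forall t, 0 <= t -> forall e, 0 < e ->
  exists2 d, 0 < d & forall s, 0 <= s -> `|s - t| < d ->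
    `|w s - w t - (s - t) * D t| <= e * `|s - t|.

Variables (w D : R -> R).
Hypothesis wD : has_rate w D.

Lemma rate_continuous t : 0 <= t -> forall e, 0 < e ->
  exists2 d, 0 < d & forall s, 0 <= s -> `|s - t| < d -> `|w s - w t| <= e.
Proof.
move=> t0 e e0; have [d d0 hd] := wD t0 ltr01.
have c0 : 0 < 1 + `|D t| by rewrite ltr_pwDl.
exists (Num.min d (e / (1 + `|D t|))); first by rewrite lt_min d0 divr_gt0.
move=> s s0; rewrite lt_min => /andP[sd se]; have := hd s s0 sd; rewrite mul1r => h.
rewrite -[w s - w t](subrK ((s - t) * D t)) (le_trans (ler_normD _ _)) //.
apply: (le_trans (lerD h (lexx _))); rewrite normrM.
have -> : `|s - t| + `|s - t| * `|D t| = `|s - t| * (1 + `|D t|) by ring.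
by rewrite -ler_pdivlMr // ltW.
Qed.

Lemma rate_derive (t : R) : 0 < t -> is_derive t 1 w (D t).
Proof.
move=> t0; have cv : h^-1 *: (w (h *: 1 + t) - w t) @[h --> 0^'] --> D t.
  apply/cvgrPdist_le => e e0; have [d d0 hd] := wD (ltW t0) e0.
  exists (Num.min d t); first by rewrite /= lt_min d0.
  move=> h /=; rewrite sub0r normrN lt_min => /andP[hd1 ht] h0.
  rewrite distrC [h *: 1]mulr1.
  have hE : h + t - t = h by rewrite addrK.
  have := hd (h + t); rewrite hE => /(_ _ hd1) H.
  have {}H := H (ltW _); rewrite -(ler_pM2l (_ : 0 < `|h|^-1)) in H; last by rewrite invr_gt0 normr_gt0.
  have -> : h^-1 *: (w (h + t) - w t) - D t = h^-1 * (w (h + t) - w t - h * D t).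
    by rewrite -[_ *: _]/(_ * _) [RHS]mulrBr mulKf.
  rewrite normrM normfV; apply: le_trans (H _) _.
    by move: ht; rewrite ltr_norml => /andP[]; lra.
  by rewrite mulrCA mulVf ?mulr1 // normr_eq0.
by apply: DeriveDef; [apply/cvg_ex; exists (D t)|apply: cvg_lim].
Qed.

(** Monotonicity of [w r + c * r], from the sign of its derivative. *)
Lemma rate_mean_value c s t : 0 <= s -> s <= t ->
  (forall r, s <= r -> r <= t -> D r <= - c) -> w t <= w s - c * (t - s).
Proof.
move=> s0 st hD.
pose f := fun r : R => w r + c * r.
have df (r : R) : 0 < r -> is_derive r 1 f (D r + c).
  move=> r0; have h1 := rate_derive r0.
  have h2 : is_derive r 1 (fun r : R => c * r) (c *: (1 : R)).
    by apply: is_deriveZ.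
  rewrite -[c in D r + c]mulr1; exact: is_deriveD.
have : f t <= f s.
  apply: (@ler0_derive1_le_cc _ f s t).
  - by move=> r; rewrite in_itv /= => /andP[sr _]; have [] := df r (le_lt_trans s0 sr).
  - move=> r; rewrite in_itv /= => /andP[sr rt].
    have h := df r (le_lt_trans s0 sr); rewrite derive1E derive_val.
    by have := hD r (ltW sr) (ltW rt); lra.
  - apply/subspace_continuousP => r /=; rewrite in_itv /= => /andP[sr rt].
    have r0 := le_trans s0 sr.
    apply: cvgD; last first.
      by apply: cvg_within_filter; apply: cvgMr; exact: cvg_id.
    apply/cvgrPdist_le => e e0; have [d d0 hd] := rate_continuous r0 e0.
    exists d => // r' /= rr'; rewrite in_itv /= => /andP[sr' _].
    by rewrite distrC; apply: hd; [exact: le_trans sr'|rewrite distrC].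
  - by rewrite in_itv /= lexx st.
  - by rewrite in_itv /= lexx st.
  - exact: st.
by rewrite /f; lra.
Qed.

Variables (b kappa : R).
Hypothesis kappa0 : 0 < kappa.
Hypothesis w_ge0 : forall t, 0 <= t -> 0 <= w t.
Hypothesis wb : w 0 < b.
Hypothesis D_neg : forall t, 0 <= t -> w t <= b -> D t <= - kappa * w t.

(** The sublevel set [w < b] cannot be left, because [w] decreases in it. *)
Lemma decay_bounded t : 0 <= t -> w t < b.
Proof.
move=> t0; rewrite ltNge; apply/negP => bt.
pose B : set R := [set r | 0 <= r /\ b <= w r].
have Bt : B t by [].
have lbB : lbound B 0 by move=> r [].
have hasB : has_inf B by split; [exists t|exists 0].
pose ts := inf B.
have ts0 : 0 <= ts by apply: lb_le_inf => //; exists t.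
have below r : 0 <= r -> r < ts -> w r < b.
  move=> r0 rts; rewrite ltNge; apply/negP => br.
  by have := ge_inf (ex_intro _ 0 lbB) (conj r0 br); rewrite leNgt rts.
have le0 r : 0 <= r -> r < ts -> w r <= w 0.
  move=> r0 rts; have := @rate_mean_value 0 0 r (lexx 0) r0; rewrite mul0r subr0; apply.
  move=> q q0 qr; have qts := le_lt_trans qr rts.
  apply: (le_trans (D_neg q0 (ltW (below _ q0 qts)))).
  by rewrite oppr0 mulNr oppr_le0 mulr_ge0 ?w_ge0 // ltW.
have wts : w ts <= w 0.
  have [->//|tsn0] := eqVneq ts 0.
  have tsp : 0 < ts by rewrite lt_neqAle eq_sym tsn0.
  apply/ler_addgt0Pr => e e0; have [d d0 hd] := rate_continuous ts0 e0.
  pose r := Num.max 0 (ts - d / 2).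
  have r0 : 0 <= r by rewrite le_max lexx.
  have rts : r < ts by rewrite gt_max tsp; lra.
  have := hd r r0; rewrite ltr0_norm ?subr_lt0 // opprB => H.
  have {}H := H _; have : ts - d / 2 <= r by rewrite le_max lexx orbT.
  move=> h; have {}H : `|w r - w ts| <= e by apply: H; lra.
  by move: H (le0 r r0 rts); rewrite ler_norml => /andP[]; lra.
have [d d0 hd] : exists2 d, 0 < d & forall s, 0 <= s -> `|s - ts| < d -> w s < b.
  have e0 : 0 < (b - w ts) / 2 by rewrite divr_gt0 // subr_gt0 (le_lt_trans wts).
  have [d d0 hd] := rate_continuous ts0 e0; exists d => // s s0 sd.
  by have := hd s s0 sd; rewrite ler_norml => /andP[]; lra.
have [r [r0 br] rd] := inf_adherent d0 hasB.
have tsr : ts <= r := ge_inf (ex_intro _ 0 lbB) (conj r0 br).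
have h : w r < b.
  by apply: hd => //; rewrite ger0_norm ?subr_ge0 //; rewrite -/ts in rd; lra.
by move: br; rewrite leNgt h.
Qed.

Lemma decay_le s t : 0 <= s -> s <= t -> w t <= w s.
Proof.
move=> s0 st; have := @rate_mean_value 0 s t s0 st; rewrite mul0r subr0; apply.
move=> r sr rt; have r0 := le_trans s0 sr.
apply: (le_trans (D_neg r0 (ltW (decay_bounded r0)))).
by rewrite oppr0 mulNr oppr_le0 mulr_ge0 ?w_ge0 // ltW.
Qed.

(** As long as [w] exceeds [mu] its slope is at most [- kappa * mu], which cannot
    last longer than [w 0 / (kappa * mu)]. *)
Lemma decay_small mu : 0 < mu -> exists2 T, 0 <= T & forall t, T <= t -> w t <= mu.
Proof.
move=> mu0; have w0 := w_ge0 (lexx 0); have km : 0 < kappa * mu by rewrite mulr_gt0.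
have T0 : 0 <= w 0 / (kappa * mu) + 1 by rewrite addr_ge0 // divr_ge0 // ltW.
exists (w 0 / (kappa * mu) + 1) => // t Tt; have t0 := le_trans T0 Tt.
rewrite leNgt; apply/negP => mut.
have := @rate_mean_value (kappa * mu) 0 t (lexx 0) t0; rewrite subr0 => H.
have {}H : w t <= w 0 - kappa * mu * t.
  apply: H => r r0 rt; apply: (le_trans (D_neg r0 (ltW (decay_bounded r0)))).
  rewrite mulNr lerN2 ler_wpM2l ?(ltW kappa0) //.
  by apply: ltW (lt_le_trans mut _); exact: decay_le.
have : kappa * mu * (w 0 / (kappa * mu) + 1) <= kappa * mu * t by rewrite ler_wpM2l // ltW.
have -> : kappa * mu * (w 0 / (kappa * mu) + 1) = w 0 + kappa * mu.
  by field; rewrite !gt_eqF.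
by have := w_ge0 t0; lra.
Qed.

End Decay.

(** * The flow near the fixed point *)

Section Velocity.
Variables (R : realType) (k : base_field) (m : nat).
Local Notation K := (scalars R k).
Local Notation "x %:K" := (of_real k x) (at level 2, format "x %:K").
Local Notation nrm := (@nrm R k m).
Local Notation nrmP := (@nrm_is_norm R k m).

Lemma is_velocityP (c : R -> 'M[K]_m) (t : R) (D : 'M[K]_m) :
  is_velocity c t D <-> forall e : R, 0 < e -> exists2 d : R, 0 < d &
    forall s, 0 <= s -> `|s - t| < d ->
      nrm (c s - c t - (s - t)%:K *: D) <= e * `|s - t|.
Proof.
have scaled s : s != t -> nrm (((s - t)^-1)%:K *: (c s - c t) - D) =
    `|s - t|^-1 * nrm (c s - c t - (s - t)%:K *: D).
  move=> st; have st0 : s - t != 0 by rewrite subr_eq0.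
  have {1}-> : D = ((s - t)^-1)%:K *: ((s - t)%:K *: D).
    by rewrite scalerA -rmorphM mulVf // rmorph1 scale1r.
  by rewrite -scalerBr nrmZ normfV.
rewrite /is_velocity cvg_nrm; split => H e e0.
  have [d d0 hd] := H e e0; exists d => // s s0 sd.
  have [->|st] := eqVneq s t.
    by rewrite !subrr rmorph0 scale0r subr0 normr0 mulr0 (nu0 nrmP).
  have := hd s; rewrite /= distrC => /(_ sd st s0).
  rewrite scaled // ler_pdivrMl; last by rewrite normr_gt0 subr_eq0.
  by rewrite mulrC.
have [d d0 hd] := H e e0; exists d => // s /= sd st s0.
rewrite scaled // ler_pdivrMl; last by rewrite normr_gt0 subr_eq0.
by rewrite mulrC; apply: hd => //; rewrite distrC.
Qed.

Lemma expmx_small (Z : 'M[K]_m) : nrm Z <= 1 ->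
  nrm (expmx Z - 1 - Z) <= expR 1 * nrm Z ^+ 2 /\
  nrm (expmx Z - 1) <= (1 + expR 1) * nrm Z.
Proof.
move=> Z1; have z0 := nrm_ge0 Z; have e0 := expR_ge0 (1 : R).
have h1 : nrm (expmx Z - 1 - Z) <= expR 1 * nrm Z ^+ 2.
  apply: (le_trans (expmx_near1 (lexx (nrm Z)))).
  rewrite [nrm Z * _]mulrC -mulrA -expr2 ler_wpM2r ?exprn_ge0 //.
  by rewrite ler_expR.
split => //; apply: (le_trans (nu_le_dist nrmP _ Z)); rewrite mulrDl mul1r lerD2l.
apply: (le_trans h1); rewrite ler_wpM2l // expr2 ler_piMl //.
Qed.

End Velocity.

Section Flow.
Variables (R : realType) (k : base_field) (m n : nat).
Local Notation K := (scalars R k).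
Local Notation "x %:K" := (of_real k x) (at level 2, format "x %:K").
Local Notation nrm := (@nrm R k m).
Local Notation nrmP := (@nrm_is_norm R k m).
Local Notation cnrm := (sum_norm nrm).
Local Notation cnrmP := (cnrm_is_norm R k m n).
Local Notation config := ('I_n -> 'M[K]_m).
Variables (G : set 'M[K]_m) (gamma : 'I_n -> 'I_n -> R) (a : nat -> R).
Variables (eps : R) (Omega : config).
Local Notation F := (kuramoto_rhs gamma a eps Omega).
Hypothesis Glie : matrix_lie_group G.
Hypothesis Glohe : lohe_closed G.
Hypothesis gOmega : forall i, lie_algebra G (Omega i).

Variables (rho1 kappa C1 : R).
Hypothesis rho1_gt0 : 0 < rho1.
Hypothesis rho1_le : rho1 <= 2^-1.
Hypothesis kappa_gt0 : 0 < kappa.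
Hypothesis C1_ge0 : 0 <= C1.
Hypothesis series_cvg : forall (w : config) i j, near1 rho1 w ->
  cvgn (matrix_series a (w j *m invmx (w i))) /\
  converges nrm (matrix_series a (w j *m invmx (w i)))
    (matrix_fun a (w j *m invmx (w i))).
Hypothesis F_lipschitz : forall w w' : config, near1 rho1 w -> near1 rho1 w' ->
  forall i, nrm (F w i - F w' i) <= C1 * cnrm (w - w').
Variables (y : config) (o : 'I_n).
Hypothesis y_near : near1 (rho1 / 2) y.
Hypothesis y_base : y o = 1.
Hypothesis y_fixed : forall i, F y i = 0.
Hypothesis F_lyapunov : forall w : config, near1 rho1 w -> w o = 1 ->
  cnrm (drift (F w) o w) <= C1 * cnrm (w - y) /\
  disag (w - y) (drift (F w) o w) <= - kappa * disag (w - y) (w - y).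

Let c0 : R := disag_coercivity R m n.
Let c0_ge0 : 0 <= c0. Proof. exact: ler0n. Qed.

(** By coercivity, a spread below this value keeps the ratios within [rho1 / 2]
    of [y], hence in the region where the linearisation holds. *)
Definition tube_size : R := (rho1 / 2) ^+ 2 / (disag_coercivity R m n + 1).

Lemma tube_size_gt0 : 0 < tube_size.
Proof. by rewrite divr_gt0 ?exprn_gt0 ?divr_gt0 // ltr_wpDl. Qed.

Definition tube (X : config) := (forall i, G (X i)) /\ spread y o X <= tube_size.

Lemma group_units (X : config) : (forall i, G (X i)) -> forall i, X i \in unitmx.
Proof. by move=> GX i; exact: (lie_group_unit Glie). Qed.

Lemma spread_dist (X : config) d : X o \in unitmx -> 0 <= d ->
  spread y o X <= d ^+ 2 / (c0 + 1) -> cnrm (ratios X o - y) <= d.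
Proof.
move=> uX d0 hX; have c1 : 0 < c0 + 1 by rewrite ltr_wpDl.
rewrite -(@ler_pXn2r _ 2) ?nnegrE ?(nu_ge0 cnrmP) //.
apply: (le_trans (spread_coercive uX y_base)).
apply: (@le_trans _ _ ((c0 + 1) * spread y o X)).
  by rewrite ler_wpM2r ?spread_ge0 // lerDl.
by rewrite mulrC -ler_pdivlMr.
Qed.

Lemma rho1_half : rho1 / 2 <= rho1. Proof. by move: rho1_gt0; lra. Qed.

Lemma y_near1 : near1 rho1 y.
Proof.
by move=> i; have [u h] := y_near i; split => //; exact: le_trans h rho1_half.
Qed.

Section InTube.
Variable X : config.
Hypothesis tubeX : tube X.
Local Notation w := (ratios X o).
Local Notation u := (ratios X o - y).

Let GX : forall i, G (X i). Proof. by case: tubeX. Qed.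
Let uX : forall i, X i \in unitmx. Proof. exact: group_units GX. Qed.

Lemma tube_dist : cnrm u <= rho1 / 2.
Proof.
apply: spread_dist => //; first by rewrite divr_ge0 // ltW.
by case: tubeX.
Qed.

Lemma tube_dist1 : cnrm u <= 1.
Proof. by apply: (le_trans tube_dist); move: rho1_le; lra. Qed.

Lemma tube_near : near1 rho1 w.
Proof.
move=> i; split; first exact: ratio_unit.
apply: (le_trans (nu_dist_trans nrmP (y i) _ _)).
have [_ hy] := y_near i; have hu := le_trans (sum_norm_coord nrmP u i) tube_dist.
by rewrite [leRHS]splitr; exact: lerD hu hy.
Qed.

Definition unit_bound : R := nrm (1 : 'M[K]_m) + 1.

Lemma tube_ratio_le j : nrm (w j) <= unit_bound.
Proof.
apply: (le_trans (nu_le_dist nrmP _ 1)); rewrite lerD2l.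
by have [_ h] := tube_near j; apply: (le_trans h); move: rho1_le; lra.
Qed.

Lemma tube_F : F X = F w.
Proof. by rewrite kuramoto_rhs_ratio. Qed.

Lemma tube_F_le i : nrm (F X i) <= C1 * cnrm u.
Proof.
by rewrite tube_F -[X in nrm X]subr0 -(y_fixed i); apply: F_lipschitz tube_near y_near1 i.
Qed.

Lemma tube_F_le1 i : nrm (F X i) <= C1.
Proof. by apply: (le_trans (tube_F_le i)); rewrite ler_piMr // tube_dist1. Qed.

Lemma tube_drift : cnrm (drift (F X) o w) <= C1 * cnrm u /\
  disag u (drift (F X) o w) <= - kappa * spread y o X.
Proof. by rewrite tube_F; apply: F_lyapunov tube_near _; exact: ratio_base. Qed.

Lemma tube_ratio2 i j : X j *m invmx (X i) = w j *m invmx (w i).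
Proof. by rewrite /ratios ratio_mulr ?unitmx_inv. Qed.

Lemma tube_converges i j : converges nrm (matrix_series a (X j *m invmx (X i)))
    (matrix_fun a (X j *m invmx (X i))).
Proof. by rewrite tube_ratio2; have [] := series_cvg i j tube_near. Qed.

Lemma tube_phase : phase_space G a X.
Proof.
by split => // i j; rewrite tube_ratio2; have [] := series_cvg i j tube_near.
Qed.

Lemma tube_lie i : lie_algebra G (F X i).
Proof.
apply: (lieD Glie); first exact: lieZ.
by apply: coupling_lie => //; exact: tube_converges.
Qed.

End InTube.

Local Notation e1 := (expR (1 : R)).
Let e1_ge0 : 0 <= e1. Proof. exact: expR_ge0. Qed.
Let N1 := unit_bound.
Let N1_ge0 : 0 <= N1. Proof. by rewrite addr_ge0 // nrm_ge0. Qed.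

(** Exponential Euler step: it stays in the group because the right-hand side
    takes its values in the Lie algebra. *)
Definition exp_euler (s : R) (X : config) : config :=
  fun i => expmx (s%:K *: F X i) *m X i.

Let E1 := e1 * C1 ^+ 2 * N1.
Let E1_ge0 : 0 <= E1. Proof. by apply: mulr_ge0 => //; apply: mulr_ge0 => //; exact: sqr_ge0. Qed.
Let Cr := 2 * (1 + N1) * E1 + 2 * C1 * (C1 + E1).
Let Cr_ge0 : 0 <= Cr.
Proof.
have h : 0 <= 1 + N1 by rewrite addr_ge0.
have h' : 0 <= C1 + E1 by rewrite addr_ge0.
by apply: addr_ge0; apply: mulr_ge0 => //; apply: mulr_ge0.
Qed.
Let b := disag_bound R n.
Let b_ge0 : 0 <= b. Proof. exact: disag_bound_ge0. Qed.
Let nCr := n%:R * Cr.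
Let nCr_ge0 : 0 <= nCr. Proof. exact: mulr_ge0. Qed.
Let Cq := 2 * b * nCr + b * (C1 + nCr) ^+ 2.
Let Cq_ge0 : 0 <= Cq.
Proof. by apply: addr_ge0; apply: mulr_ge0 => //; [exact: mulr_ge0|exact: sqr_ge0]. Qed.

Let H := 1 + 2 * (C1 + E1) + 2 * (1 + e1) * C1 + Cq * c0 / (2 * kappa).
Let H_ge : [/\ 1 <= H, 2 * (C1 + E1) <= H, 2 * (1 + e1) * C1 <= H &
  Cq * c0 / (2 * kappa) <= H].
Proof.
have h1 : 0 <= 2 * (C1 + E1) by rewrite mulr_ge0 // addr_ge0.
have h2 : 0 <= 2 * (1 + e1) * C1 by rewrite mulr_ge0 // mulr_ge0 // addr_ge0.
have h3 : 0 <= Cq * c0 / (2 * kappa).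
  apply: divr_ge0; first exact: mulr_ge0.
  by rewrite mulr_ge0 // ltW.
by rewrite /H; split; lra.
Qed.

(** [H] bounds all the quantities that a step has to make small. *)
Definition max_step : R := H^-1.

Lemma max_step_gt0 : 0 < max_step.
Proof. by rewrite invr_gt0; case: H_ge => h _ _ _; exact: lt_le_trans h. Qed.

Lemma step_le1 s x : 0 < s -> s <= max_step -> x <= H -> s * x <= 1.
Proof.
move=> s0 sH xH; have H0 : 0 < H by rewrite -invr_gt0; exact: max_step_gt0.
apply: (@le_trans _ _ (s * H)); first by rewrite ler_wpM2l // ltW.
by rewrite -ler_pdivlMr // mul1r.
Qed.

Section Step.
Variables (s : R) (X : config).
Hypothesis s_gt0 : 0 < s.
Hypothesis s_le : s <= max_step.
Hypothesis tubeX : tube X.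
Local Notation w := (ratios X o).
Local Notation u := (ratios X o - y).
Let c := cnrm u.
Let c_ge0 : 0 <= c. Proof. exact: nu_ge0 cnrmP _. Qed.
Let c_le1 : c <= 1. Proof. exact: tube_dist1. Qed.
Let GX : forall i, G (X i). Proof. by case: tubeX. Qed.
Let uX : forall i, X i \in unitmx. Proof. exact: group_units GX. Qed.
Let s_ge0 : 0 <= s := ltW s_gt0.
Let s_le1 : s <= 1.
Proof. by rewrite -[s]mulr1; apply: step_le1 => //; case: H_ge. Qed.

Lemma exp_euler_group i : G (exp_euler s X i).
Proof. by apply: (lie_groupM Glie) => //; exact: tube_lie. Qed.

Lemma exp_euler_small i : nrm (s%:K *: F X i) <= s * (C1 * c) /\
  nrm (s%:K *: F X i) <= s * C1 /\ nrm (s%:K *: F X i) <= 1.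
Proof.
rewrite nrmZ ger0_norm //.
have h1 : s * nrm (F X i) <= s * (C1 * c) by rewrite ler_wpM2l // tube_F_le.
have h2 : s * nrm (F X i) <= s * C1 by rewrite ler_wpM2l // tube_F_le1.
split => //; split => //; apply: (le_trans h2); apply: step_le1 => //.
by case: H_ge => _ + _ _; apply: le_trans; move: C1_ge0 E1_ge0; lra.
Qed.

Lemma exp_euler_ratio j :
  nrm (ratios (exp_euler s X) o j - w j - s%:K *: drift (F X) o w j) <= Cr * s ^+ 2 * c.
Proof.
pose eta := E1 * s ^+ 2 * c.
have eta0 : 0 <= eta by apply: mulr_ge0 => //; apply: mulr_ge0 => //; exact: sqr_ge0.
have hp i : nrm ((exp_euler s X i - X i) *m invmx (X o) - s%:K *: (F X i *m w i)) <= eta.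
  have -> : (exp_euler s X i - X i) *m invmx (X o) - s%:K *: (F X i *m w i) =
      (expmx (s%:K *: F X i) - 1 - s%:K *: F X i) *m w i.
    rewrite /exp_euler /ratios !mulmxBl mul1mx -!mulmxA -scalemxAl.
    by rewrite mulmxA.
  have [h1 [_ h3]] := exp_euler_small i.
  have [h4 _] := expmx_small h3.
  apply: (le_trans (nrmM _ _)).
  have h5 : nrm (expmx (s%:K *: F X i) - 1 - s%:K *: F X i) <= e1 * (s * (C1 * c)) ^+ 2.
    apply: (le_trans h4); rewrite ler_wpM2l // lerXn2r ?nnegrE ?nrm_ge0 //.
    by apply: mulr_ge0 => //; apply: mulr_ge0.
  apply: (@le_trans _ _ (e1 * (s * (C1 * c)) ^+ 2 * N1)).
    by apply: ler_pM; rewrite ?nrm_ge0 //; exact: tube_ratio_le.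
  have -> : e1 * (s * (C1 * c)) ^+ 2 * N1 = E1 * s ^+ 2 * (c * c) by rewrite /E1; ring.
  rewrite /eta ler_wpM2l //; first by apply: mulr_ge0 => //; exact: sqr_ge0.
  by rewrite ler_piMl.
have etas : eta <= s * E1.
  apply: (@le_trans _ _ (E1 * s ^+ 2)).
    by rewrite ler_piMr //; apply: mulr_ge0 => //; exact: sqr_ge0.
  by rewrite mulrC expr2 ler_wpM2r // ler_piMl.
have hsum : s * nrm (F X o) + eta <= s * (C1 + E1).
  by rewrite mulrDr lerD // ler_wpM2l // tube_F_le1.
have hs : `|s| * nrm (F X o) + eta <= 2^-1.
  rewrite ger0_norm // (le_trans hsum) //.
  have h : s * (2 * (C1 + E1)) <= 1 by apply: step_le1 => //; case: H_ge.
  by move: h; move: (C1 + E1) => x; lra.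
have := ratio_step uX (lie_group_unit Glie (exp_euler_group o)) hp hs j.
rewrite ger0_norm // => /le_trans; apply.
have [hd _] := tube_drift tubeX.
have hdj : nrm (drift (F X) o w j) <= C1 * c.
  by apply: le_trans hd; exact: (sum_norm_coord nrmP).
have hw := tube_ratio_le tubeX j.
have -> : Cr * s ^+ 2 * c =
    2 * (1 + N1) * eta + 2 * s * (C1 * c) * (s * (C1 + E1)) by rewrite /Cr /eta; ring.
apply: lerD.
  by rewrite ler_wpM2r // ler_wpM2l // lerD2l.
apply: ler_pM => //.
- by rewrite mulr_ge0 ?nrm_ge0 // mulr_ge0.
- by rewrite addr_ge0 // mulr_ge0 // nrm_ge0.
- by rewrite ler_wpM2l // mulr_ge0.
Qed.

(** The first-order decrease and the second-order error of a step are both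
    quadratic in the distance to [y], so that below [max_step] the decrease wins
    and sublevel sets are exactly invariant. *)
Lemma exp_euler_spread : spread y o (exp_euler s X) <= spread y o X.
Proof.
set X' := exp_euler s X; set g := drift (F X) o w.
pose z := ratios X' o - w; pose r := z - s%:K *: g.
have [hg1 hg2] := tube_drift tubeX.
have sX0 := spread_ge0 y o X.
have hr : cnrm r <= nCr * s ^+ 2 * c.
  have -> : nCr * s ^+ 2 * c = n%:R * (Cr * s ^+ 2 * c) by rewrite /nCr; ring.
  by rewrite -(sumr_ord_const n); apply: ler_sum => i _; exact: exp_euler_ratio.
have zE : z = s%:K *: g + r by rewrite /r subrKC.
have -> : spread y o X' = disag (u + z) (u + z).
  rewrite /spread; have -> : ratios X' o - y = u + z; last by [].
  rewrite /z; move: (ratios X' o) w => P Q.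
  by flatten_diff; cancel P; cancel Q; cancel y.
rewrite disag_shift -/(spread y o X).
have h1 : disag u z <= - (s * kappa) * spread y o X + b * nCr * (s ^+ 2 * c ^+ 2).
  rewrite zE disagDr; apply: lerD.
    rewrite (disagZr s u g) mulNr -mulrA -mulrN -mulNr ler_wpM2l //.
  apply: (le_trans (ler_norm _)); apply: (le_trans (disag_le _ _)).
  have -> : b * nCr * (s ^+ 2 * c ^+ 2) = b * (c * (nCr * s ^+ 2 * c)) by ring.
  by rewrite ler_wpM2l // ler_wpM2l.
have hz : cnrm z <= s * ((C1 + nCr) * c).
  rewrite zE; apply: (le_trans (nuD cnrmP _ _)); rewrite cnrmZ ger0_norm //.
  have -> : s * ((C1 + nCr) * c) = s * (C1 * c) + nCr * (s * 1) * c by ring.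
  apply: lerD; first by rewrite ler_wpM2l.
  apply: (le_trans hr); rewrite ler_wpM2r // ler_wpM2l // expr2 ler_wpM2l //.
have h2 : disag z z <= b * (C1 + nCr) ^+ 2 * (s ^+ 2 * c ^+ 2).
  apply: (le_trans (ler_norm _)); apply: (le_trans (disag_le _ _)).
  have -> : b * (C1 + nCr) ^+ 2 * (s ^+ 2 * c ^+ 2) =
     b * ((s * ((C1 + nCr) * c)) * (s * ((C1 + nCr) * c))) by ring.
  rewrite ler_wpM2l //.
  by apply: ler_pM => //; exact: nu_ge0 cnrmP _.
have h3 : c ^+ 2 <= c0 * spread y o X by exact: spread_coercive.
have h4 : s * (Cq * c0) <= 2 * kappa.
  have h : s * (Cq * c0 / (2 * kappa)) <= 1 by apply: step_le1 => //; case: H_ge.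
  by move: h; rewrite mulrA ler_pdivrMr ?mulr_gt0 // mul1r.
have h5 : Cq * (s ^+ 2 * c ^+ 2) <= s * (2 * kappa) * spread y o X.
  apply: (@le_trans _ _ (Cq * (s ^+ 2 * (c0 * spread y o X)))).
    by rewrite ler_wpM2l // ler_wpM2l // sqr_ge0.
  have -> : Cq * (s ^+ 2 * (c0 * spread y o X)) = s * (s * (Cq * c0)) * spread y o X by ring.
  by rewrite ler_wpM2r // ler_wpM2l.
have h6 : 2 * disag u z + disag z z <=
    2 * (- (s * kappa) * spread y o X) + Cq * (s ^+ 2 * c ^+ 2).
  have -> : 2 * (- (s * kappa) * spread y o X) + Cq * (s ^+ 2 * c ^+ 2) =
    2 * (- (s * kappa) * spread y o X + b * nCr * (s ^+ 2 * c ^+ 2)) +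
    b * (C1 + nCr) ^+ 2 * (s ^+ 2 * c ^+ 2) by rewrite /Cq; ring.
  by apply: lerD h2; rewrite ler_wpM2l.
have h7 := le_trans h6 (lerD (lexx _) h5).
have e0 : 2 * (- (s * kappa) * spread y o X) + s * (2 * kappa) * spread y o X = 0 by ring.
by rewrite e0 in h7; rewrite -addrA gerDl.
Qed.

Lemma exp_euler_tube : tube (exp_euler s X).
Proof.
split; first exact: exp_euler_group.
by apply: (le_trans exp_euler_spread); case: tubeX.
Qed.

(** The spread does not control the configuration itself, which can drift along
    its class; this bound excludes blow-up and degeneration in finite time. *)
Lemma exp_euler_growth (rho : R) :
  (forall i, nrm (X i) <= rho /\ nrm (invmx (X i)) <= rho) ->
  forall i, nrm (exp_euler s X i) <= rho * expR (2 * (1 + e1) * C1 * s) /\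
    nrm (invmx (exp_euler s X i)) <= rho * expR (2 * (1 + e1) * C1 * s).
Proof.
move=> hX i; have [h1 h2] := hX i; have [_ [g1 g2]] := exp_euler_small i.
set A := expmx (s%:K *: F X i).
have uA : A \in unitmx := expmx_unit _.
have e10 : 0 <= 1 + e1 by rewrite addr_ge0.
have hA : nrm (A - 1) <= (1 + e1) * C1 * s.
  have [_ g3] := expmx_small g2; apply: (le_trans g3).
  by rewrite -mulrA ler_wpM2l // mulrC.
have hA2 : (1 + e1) * C1 * s <= 2^-1.
  have h : s * (2 * (1 + e1) * C1) <= 1 by apply: step_le1 => //; case: H_ge.
  move: h; move: e10; move: (1 + e1) => x; lra.
have hV := invmx_near1 uA hA2 hA.
have c0' : 0 <= (1 + e1) * C1 * s by rewrite !mulr_ge0.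
have exp_ge : 1 + 2 * ((1 + e1) * C1 * s) <= expR (2 * (1 + e1) * C1 * s).
  have -> : 2 * ((1 + e1) * C1 * s) = 2 * (1 + e1) * C1 * s by ring.
  exact: expR_ge1Dx.
have r0 : 0 <= rho := le_trans (nrm_ge0 _) h1.
have grow (B C : 'M[K]_m) : nrm (B - 1) <= 2 * ((1 + e1) * C1 * s) -> nrm C <= rho ->
    nrm C + nrm (B - 1) * nrm C <= rho * expR (2 * (1 + e1) * C1 * s).
  move=> hB hC; apply: (@le_trans _ _ ((1 + 2 * ((1 + e1) * C1 * s)) * rho)).
    by rewrite mulrDl mul1r lerD // ler_pM ?nrm_ge0.
  by rewrite mulrC ler_wpM2l.
split.
  have -> : exp_euler s X i = X i + (A - 1) *m X i.
    by rewrite mulmxBl mul1mx subrKC.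
  apply: (le_trans (nuD nrmP _ _)); apply: (le_trans (lerD (lexx _) (nrmM _ _))).
  apply: grow => //; apply: (le_trans hA).
  by move: c0'; move: (_ * s) => x; lra.
have -> : invmx (exp_euler s X i) = invmx (X i) + invmx (X i) *m (invmx A - 1).
  rewrite mulmxBr mulmx1 subrKC.
  apply: (can_inj (mulKmx (lie_group_unit Glie (exp_euler_group i)))).
  rewrite mulmxV ?(lie_group_unit Glie (exp_euler_group i)) // /exp_euler -/A.
  by rewrite -mulmxA (mulmxA (X i)) mulmxV // mul1mx mulmxV.
apply: (le_trans (nuD nrmP _ _)); apply: (le_trans (lerD (lexx _) (nrmM _ _))).
by rewrite [X in _ + X <= _]mulrC; exact: grow.
Qed.

Lemma exp_euler_consistent (rho : R) : (forall i, nrm (X i) <= rho) ->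
  cnrm (exp_euler s X - X - s%:K *: (fun i => F X i *m X i)) <=
    n%:R * (e1 * C1 ^+ 2 * rho) * s ^+ 2.
Proof.
move=> hX.
have -> : n%:R * (e1 * C1 ^+ 2 * rho) * s ^+ 2 = n%:R * (e1 * (s * C1) ^+ 2 * rho) by ring.
rewrite -(sumr_ord_const n); apply: ler_sum => i _.
have -> : (exp_euler s X - X - s%:K *: (fun i => F X i *m X i)) i =
    (expmx (s%:K *: F X i) - 1 - s%:K *: F X i) *m X i.
  by rewrite !mulmxBl mul1mx -scalemxAl.
have [_ [g1 g2]] := exp_euler_small i; have [g3 _] := expmx_small g2.
apply: (le_trans (nrmM _ _)); apply: ler_pM; rewrite ?nrm_ge0 //.
apply: (le_trans g3); rewrite ler_wpM2l // lerXn2r ?nnegrE ?nrm_ge0 //.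
exact: mulr_ge0.
Qed.

End Step.

Definition velocity (X : config) : config := fun i => F X i *m X i.

(** Bounding the inverses as well makes the set closed among all matrices and
    the velocity Lipschitz on it. *)
Definition bounded_tube (rho : R) : set config :=
  [set X | tube X /\ forall i, nrm (X i) <= rho /\ nrm (invmx (X i)) <= rho].

Lemma inv_converges (v : nat -> 'M[K]_m) l rho : (forall p, v p \in unitmx) ->
  (forall p, nrm (invmx (v p)) <= rho) -> converges nrm v l ->
  l \in unitmx /\ converges nrm (fun p => invmx (v p)) (invmx l).
Proof.
move=> uv hv cv; have r0 : 0 <= rho := le_trans (nrm_ge0 _) (hv 0%N).
have [|l' cl'] := @nrm_is_complete R k m (fun p => invmx (v p)).
  move=> e e0; have s0 : 0 < 2 * (rho ^+ 2 + 1).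
    by rewrite mulr_gt0 // ltr_wpDl // sqr_ge0.
  have [N hN] := cv _ (divr_gt0 e0 s0); exists N => p q Np pq.
  rewrite invmx_dist //.
  have h1 : nrm (v p - v q) <= 2 * (e / (2 * (rho ^+ 2 + 1))).
    apply: (le_trans (nu_dist_trans nrmP l _ _)).
    have := hN p Np; have := hN q (leq_trans Np pq); rewrite [nrm (v q - l)]nu_distC; last exact: nrmP.
    lra.
  apply: (le_trans (nrmM _ _)).
  apply: (@le_trans _ _ (rho * (2 * (e / (2 * (rho ^+ 2 + 1)))) * rho)).
    apply: ler_pM; rewrite ?nrm_ge0 //.
    apply: (le_trans (nrmM _ _)); apply: ler_pM; rewrite ?nrm_ge0 //.
  have -> : rho * (2 * (e / (2 * (rho ^+ 2 + 1)))) * rho = e * (rho ^+ 2 / (rho ^+ 2 + 1)).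
    by field; rewrite gt_eqF // ltr_wpDl // sqr_ge0.
  rewrite ler_piMr ?(ltW e0) // ler_pdivrMr ?mul1r ?lerDl //.
  by rewrite ltr_wpDl // sqr_ge0.
have prod : l * l' = 1.
  apply: (converges_unique nrmP (convergesM cv cl')).
  apply: (converges_near (N0 := 0%N) (converges_cst nrmP 1)) => p _.
  by rewrite -[_ * _]/(_ *m _) mulmxV.
have [ul _] := mulmx1_unit prod; split => //.
suff -> : invmx l = l' by [].
by rewrite -[l'](mulKmx ul) -[l *m l']/(l * l') prod mulmx1.
Qed.

Lemma ratio_cdist (X X' : config) rho : tube X' -> X o \in unitmx ->
  nrm (invmx (X o)) <= rho ->
  cnrm (ratios X o - ratios X' o) <= n%:R * ((1 + N1) * cnrm (X - X') * rho).
Proof.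
move=> tX' uX hX; have uX' : X' o \in unitmx by apply: group_units; case: tX'.
rewrite -(sumr_ord_const n); apply: ler_sum => j _.
exact: (ratio_dist uX' uX hX (tube_ratio_le tX')).
Qed.

Lemma spread_cdist (X X' : config) : tube X' ->
  cnrm (ratios X o - ratios X' o) <= 1 ->
  `|spread y o X - spread y o X'| <= b * 3 * cnrm (ratios X o - ratios X' o).
Proof.
move=> tX' hX; set d := cnrm _ in hX *.
apply: (le_trans (disag_dist _ _)); rewrite -/b -mulrA ler_wpM2l //.
have -> : ratios X o - y - (ratios X' o - y) = ratios X o - ratios X' o.
  move: (ratios X o) (ratios X' o) => P Q.
  by flatten_diff; cancel P; cancel Q; cancel y.
rewrite -/d [3 * d]mulrC ler_wpM2l ?(nu_ge0 cnrmP) //.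
have h1 := tube_dist1 tX'.
have h2 : cnrm (ratios X o - y) <= cnrm (ratios X' o - y) + d.
  apply: (le_trans (nu_dist_trans cnrmP (ratios X' o) _ _)).
  by rewrite addrC.
lra.
Qed.

Lemma bounded_tube_closed rho (v : nat -> config) l :
  (forall p, bounded_tube rho (v p)) -> converges cnrm v l -> bounded_tube rho l.
Proof.
move=> hv cv; have cvi i := converges_coord nrmP i cv.
have uv p i : v p i \in unitmx by apply: group_units; case: (hv p) => -[].
have inv i : l i \in unitmx /\ converges nrm (fun p => invmx (v p i)) (invmx (l i)).
  apply: (inv_converges (rho := rho)) (cvi i) => p //.
  by case: (hv p) => _ /(_ i)[].
have bounds i : nrm (l i) <= rho /\ nrm (invmx (l i)) <= rho.
  split; [apply: (converges_le (N0 := 0%N) nrmP (cvi i)) => p _|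
          apply: (converges_le (N0 := 0%N) nrmP (inv i).2) => p _];
  by case: (hv p) => _ /(_ i)[].
split=> //; split.
  move=> i; apply: (lie_group_limit Glie (u := fun p => v p i)) => [p||].
  - by case: (hv p) => -[].
  - exact: cvi.
  - exact: (inv i).1.
apply/ler_addgt0Pr => e e0.
have r0 : 0 <= rho := le_trans (nrm_ge0 _) (bounds o).1.
pose c := n%:R * ((1 + N1) * rho).
have c_ge0 : 0 <= c by rewrite mulr_ge0 // mulr_ge0 // addr_ge0.
have s0 : 0 < 1 + c + b * 3 * c by rewrite -addrA ltr_pwDl // addr_ge0 // mulr_ge0 // mulr_ge0.
have m0 : 0 < Num.min 1 e by rewrite lt_min ltr01.
have [N /(_ N (leqnn N)) hN] := cv _ (divr_gt0 m0 s0).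
have tv : tube (v N) by case: (hv N).
have h1 := ratio_cdist tv (inv o).1 (bounds o).2.
have h2 : n%:R * ((1 + N1) * cnrm (l - v N) * rho) <= c * (Num.min 1 e / (1 + c + b * 3 * c)).
  have -> : n%:R * ((1 + N1) * cnrm (l - v N) * rho) = c * cnrm (l - v N) by rewrite /c; ring.
  by rewrite ler_wpM2l // (nu_distC cnrmP).
have h3 := le_trans h1 h2.
have small x : 0 <= x -> x <= 1 + c + b * 3 * c ->
    x * (Num.min 1 e / (1 + c + b * 3 * c)) <= Num.min 1 e.
  move=> x0 xs; rewrite mulrCA ler_piMr // ?ler_pdivrMr // ?mul1r //.
  by rewrite le_min ler01 ltW.
have bc0 : 0 <= b * 3 * c by rewrite mulr_ge0 // mulr_ge0.
have h4 : cnrm (ratios l o - ratios (v N) o) <= 1.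
  apply: (le_trans h3); apply: le_trans (small c _ _) _ => //.
    by move: bc0 c_ge0; lra.
  by rewrite ge_min lexx.
have h5 := spread_cdist tv h4.
have h6 : b * 3 * cnrm (ratios l o - ratios (v N) o) <= e.
  apply: (le_trans (ler_wpM2l (_ : 0 <= b * 3) h3)); first by rewrite mulr_ge0.
  rewrite mulrA; apply: le_trans (small (b * 3 * c) _ _) _ => //.
    by move: bc0 c_ge0; lra.
  by rewrite ge_min lexx orbT.
have [_ h7] := tv; have := le_trans h5 h6; rewrite ler_norml => /andP[_].
by move: h7; lra.
Qed.

Lemma velocity_local rho : 0 <= rho -> exists2 C : R, 0 <= C &
  [/\ forall X s, bounded_tube rho X -> 0 < s -> s <= max_step ->
        cnrm (exp_euler s X - X - s%:K *: velocity X) <= C * s ^+ 2,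
      forall X, bounded_tube rho X -> cnrm (velocity X) <= C &
      forall X X', bounded_tube rho X -> bounded_tube rho X' ->
        cnrm (velocity X - velocity X') <= C * cnrm (X - X')].
Proof.
move=> r0.
pose A1 := n%:R * (e1 * C1 ^+ 2 * rho).
have A1_ge0 : 0 <= A1.
  by apply: mulr_ge0 => //; apply: mulr_ge0 => //; apply: mulr_ge0 => //; exact: sqr_ge0.
pose A2 := n%:R * (C1 * rho).
have A2_ge0 : 0 <= A2 by apply: mulr_ge0 => //; apply: mulr_ge0.
pose A3 := C1 + n%:R * (C1 * (n%:R * ((1 + N1) * rho)) * rho).
have A3_ge0 : 0 <= A3.
  apply: addr_ge0 => //; apply: mulr_ge0 => //; apply: mulr_ge0 => //.
  by apply: mulr_ge0 => //; apply: mulr_ge0 => //; apply: mulr_ge0 => //; apply: addr_ge0.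
exists (A1 + A2 + A3); first by apply: addr_ge0 => //; apply: addr_ge0.
split.
- move=> X s [tX hX] s0 sh.
  apply: (le_trans (exp_euler_consistent s0 sh tX (fun i => (hX i).1))).
  apply: ler_wpM2r; first exact: sqr_ge0.
  by rewrite -/A1 -[leRHS]addrA lerDl; apply: addr_ge0.
- move=> X [tX hX]; apply: (@le_trans _ _ A2); last by rewrite addrAC lerDr; apply: addr_ge0.
  rewrite /A2 -(sumr_ord_const n); apply: ler_sum => i _; apply: (le_trans (nrmM _ _)).
  by apply: ler_pM; rewrite ?nrm_ge0 //; [exact: tube_F_le1|exact: (hX i).1].
move=> X X' [tX hX] [tX' hX'].
apply: (@le_trans _ _ (A3 * cnrm (X - X'))); last first.
  by rewrite ler_wpM2r ?(nu_ge0 cnrmP) // lerDr; apply: addr_ge0.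
have uX : X o \in unitmx by apply: group_units; case: tX.
have hr := ratio_cdist tX' uX (hX o).2.
have hF i : nrm (F X i - F X' i) <= C1 * (n%:R * ((1 + N1) * cnrm (X - X') * rho)).
  rewrite (tube_F tX) (tube_F tX').
  apply: (le_trans (F_lipschitz (tube_near tX) (tube_near tX') i)).
  by rewrite ler_wpM2l.
rewrite /A3 mulrDl.
have -> : n%:R * (C1 * (n%:R * ((1 + N1) * rho)) * rho) * cnrm (X - X') =
  n%:R * (C1 * (n%:R * ((1 + N1) * cnrm (X - X') * rho)) * rho) by ring.
rewrite -(sumr_ord_const n) {1}/sum_norm mulr_sumr -big_split /=; apply: ler_sum => i _.
have -> : (velocity X - velocity X') i = F X i *m (X i - X' i) + (F X i - F X' i) *m X' i.
  by rewrite mulmxBr mulmxBl subrKA.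
apply: (le_trans (nuD nrmP _ _)); apply: lerD.
  by apply: (le_trans (nrmM _ _)); rewrite ler_wpM2r ?nrm_ge0 // tube_F_le1.
apply: (le_trans (nrmM _ _)); apply: ler_pM; rewrite ?nrm_ge0 //.
exact: (hX' i).1.
Qed.

Lemma tube_solution (X0 : config) : tube X0 ->
  exists2 X, solution G gamma a eps Omega X & X 0 = X0.
Proof.
move=> tX0; pose rho := cnrm X0 + cnrm (fun i => invmx (X0 i)).
have rho0 : 0 <= rho by rewrite addr_ge0 // (nu_ge0 cnrmP).
have bX0 : bounded_tube rho X0.
  split=> // i; split.
    by apply: (le_trans (sum_norm_coord nrmP X0 i)); rewrite lerDl (nu_ge0 cnrmP).
  apply: (le_trans (sum_norm_coord nrmP (fun i => invmx (X0 i)) i)).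
  by rewrite lerDr (nu_ge0 cnrmP).
have M0 : 0 <= 2 * (1 + e1) * C1 by rewrite mulr_ge0 // mulr_ge0 // addr_ge0.
have mono r r' X : r <= r' -> bounded_tube r X -> bounded_tube r' X.
  move=> rr [tX hX]; split=> // i; have [h1 h2] := hX i.
  by split; [exact: le_trans h1 rr|exact: le_trans h2 rr].
have inv r X s : 0 <= r -> bounded_tube r X -> 0 < s -> s <= max_step ->
    bounded_tube (r * expR (2 * (1 + e1) * C1 * s)) (exp_euler s X).
  move=> _ [tX hX] s0 sh; split; first exact: exp_euler_tube.
  exact: exp_euler_growth.
have [X [XX0 XS Xd]] := euler_solution cnrmP (@cnrmZ R k m n) (@cnrm_is_complete R k m n)
  max_step_gt0 M0 mono inv bounded_tube_closed velocity_local rho0 bX0.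
exists X => // t t0; have [r _ [tX _]] := XS t t0; split; first exact: tube_phase.
move=> i; exists (F (X t) i *m X t i); last first.
  by rewrite mulmxK //; apply: group_units; case: tX.
apply/is_velocityP => e e0; have [d d0 hd] := Xd t t0 e e0; exists d => // s s0 sd.
apply: le_trans (hd s s0 sd).
exact: (sum_norm_coord nrmP (X s - X t - (s - t)%:K *: velocity (X t)) i).
Qed.

Lemma common_radius (I : finType) (d : I -> R) : (forall i, 0 < d i) ->
  exists2 r : R, 0 < r & forall i, r <= d i.
Proof.
move=> d0; have s0 : 0 <= \sum_i (d i)^-1.
  by rewrite sumr_ge0 // => i _; rewrite invr_ge0 ltW.
exists (1 + \sum_i (d i)^-1)^-1; first by rewrite invr_gt0 ltr_pwDl.
move=> i; rewrite -[leRHS]invrK lef_pV2 ?posrE ?invr_gt0 ?ltr_pwDl //.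
rewrite (bigD1 i) //= addrCA lerDl addr_ge0 // sumr_ge0 // => j _.
by rewrite invr_ge0 ltW.
Qed.

(** The expansion [ratio_step] only asks for invertibility, so it applies along
    solutions that are not yet known to stay in the tube. *)
Lemma solution_rate (X : R -> config) : solution G gamma a eps Omega X ->
  has_rate (fun t => spread y o (X t))
    (fun t => 2 * disag (ratios (X t) o - y) (drift (F (X t)) o (ratios (X t) o))).
Proof.
move=> sX t t0 e e0; have [[GX _] vX] := sX t t0.
have uX := group_units GX.
have vel i : is_velocity (fun s => X s i) t (F (X t) i *m X t i).
  by have [D vD <-] := vX i; rewrite mulmxKV.
have [x xE] : exists x, x = X t by exists (X t).
cbv beta; rewrite -xE; rewrite -xE in GX uX vel; clear vX.
rename GX into Gx; rename uX into ux.
set Fx := F x; rewrite -/Fx in vel; clearbody Fx.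
set w := ratios x o; set u := w - y; set g := drift Fx o w.
pose r0 := nrm (invmx (x o)); have r0_ge0 : 0 <= r0 by exact: nrm_ge0.
pose NF := nrm (Fx o); have NF_ge0 : 0 <= NF by exact: nrm_ge0.
pose Ng := cnrm g; have Ng_ge0 : 0 <= Ng by exact: nu_ge0 cnrmP _.
pose Nw := cnrm w; have Nw_ge0 : 0 <= Nw by exact: nu_ge0 cnrmP _.
pose Nu := cnrm u; have Nu_ge0 : 0 <= Nu by exact: nu_ge0 cnrmP _.
pose Kc := 2 * (1 + Nw) * r0 + 2 * Ng * (NF + r0).
have Kc_ge0 : 0 <= Kc.
  by apply: addr_ge0; apply: mulr_ge0; rewrite ?addr_ge0 // mulr_ge0 // addr_ge0.
pose nK := n%:R * Kc; have nK_ge0 : 0 <= nK by exact: mulr_ge0.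
pose K2 := 2 * (b * (Nu * nK)) + b * (Ng + nK) ^+ 2.
have K2_ge0 : 0 <= K2.
  apply: addr_ge0; apply: mulr_ge0 => //; last exact: sqr_ge0.
  by apply: mulr_ge0 => //; apply: mulr_ge0.
have K21 : 0 < K2 + 1 by rewrite ltr_wpDl.
have KF1 : 0 < 2 * (NF + r0) + 1 by rewrite ltr_wpDl // mulr_ge0 // addr_ge0.
pose e' := Num.min 1 (Num.min (e / (K2 + 1)) (2 * (NF + r0) + 1)^-1).
have e'0 : 0 < e' by rewrite !lt_min ltr01 divr_gt0 // invr_gt0.
have e'1 : e' <= 1 by rewrite ge_min lexx.
have e'2 : e' * K2 <= e.
  have h : e' <= e / (K2 + 1) by rewrite !ge_min lexx orbT.
  apply: (@le_trans _ _ (e' * (K2 + 1))); first by rewrite ler_wpM2l ?lerDl // ltW.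
  by rewrite -ler_pdivlMr.
have e'3 : e' * (NF + r0) <= 2^-1.
  have h : e' <= (2 * (NF + r0) + 1)^-1 by rewrite !ge_min lexx !orbT.
  have : e' * (2 * (NF + r0) + 1) <= 1 by rewrite -ler_pdivlMr // mul1r.
  by move: e'0; lra.
have /choice[di hdi] i : exists d, 0 < d /\ forall s, 0 <= s -> `|s - t| < d ->
    nrm (X s i - X t i - (s - t)%:K *: (Fx i *m x i)) <= e' * `|s - t|.
  by have /is_velocityP/(_ _ e'0)[d d0 hd] := vel i; exists d.
have [d d0 hd] := common_radius (fun i => (hdi i).1).
exists (Num.min d e'); first by rewrite lt_min d0.
move=> s s0; rewrite lt_min => /andP[sd se].
have hs i := (hdi i).2 s s0 (lt_le_trans sd (hd i)).
have GXs : forall i, G (X s i) by have [[]] := sX s s0.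
have uXs := group_units GXs; rewrite -xE in hs.
set h := s - t in sd se hs *; move: (X s) hs GXs uXs => x' hx' Gx' ux'.
have ah : 0 <= `|h| by exact: normr_ge0.
pose eta := e' * `|h| * r0.
have eta0 : 0 <= eta by rewrite !mulr_ge0 // ltW.
have hp i : nrm ((x' i - x i) *m invmx (x o) - h%:K *: (Fx i *m w i)) <= eta.
  have -> : (x' i - x i) *m invmx (x o) - h%:K *: (Fx i *m w i) =
      (x' i - x i - h%:K *: (Fx i *m x i)) *m invmx (x o).
    by rewrite [RHS]mulmxBl -scalemxAl /w /ratios mulmxA.
  by apply: (le_trans (nrmM _ _)); rewrite ler_wpM2r.
have sum_le : `|h| * NF + eta <= e' * (NF + r0).
  rewrite mulrDr lerD //; first by rewrite ler_wpM2r // ltW.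
  rewrite /eta -mulrA ler_wpM2l ?(ltW e'0) // ler_piMl //.
  exact: le_trans (ltW se) e'1.
have hsum : `|h| * nrm (Fx o) + eta <= 2^-1 := le_trans sum_le e'3.
have step := ratio_step ux (ux' o) hp hsum.
pose z := ratios x' o - w; pose r := z - h%:K *: g.
have hr : cnrm r <= `|h| * e' * nK.
  have -> : `|h| * e' * nK = n%:R * (`|h| * e' * Kc) by rewrite /nK; ring.
  rewrite -(sumr_ord_const n); apply: ler_sum => j _; apply: (le_trans (step j)).
  have -> : `|h| * e' * Kc =
     2 * (1 + Nw) * eta + 2 * `|h| * Ng * (e' * (NF + r0)) by rewrite /Kc /eta; ring.
  apply: lerD.
    by rewrite ler_wpM2r // ler_wpM2l // lerD2l; exact: (sum_norm_coord nrmP).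
  apply: ler_pM sum_le.
  - by rewrite !mulr_ge0 // nrm_ge0.
  - by rewrite addr_ge0 // mulr_ge0.
  - by rewrite ler_wpM2l ?mulr_ge0 //; exact: (sum_norm_coord nrmP).
have zE : z = h%:K *: g + r by rewrite /r subrKC.
have cz : cnrm z <= `|h| * (Ng + nK).
  rewrite zE; apply: (le_trans (nuD cnrmP _ _)); rewrite cnrmZ mulrDr lerD2l.
  by apply: (le_trans hr); rewrite ler_wpM2r // ler_piMr.
have -> : spread y o x' = disag (u + z) (u + z).
  rewrite /spread; have -> : ratios x' o - y = u + z; last by [].
  rewrite /z /u; move: (ratios x' o) => P.
  by flatten_diff; cancel P; cancel w; cancel y.
have zu : disag u z = h * disag u g + disag u r.
  by rewrite [in LHS]zE disagDr; congr (_ + _); exact: (disagZr h u g).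
rewrite disag_shift -[spread y o x]/(disag u u) zu.
have -> : disag u u + 2 * (h * disag u g + disag u r) + disag z z - disag u u
   - h * (2 * disag u g) = 2 * disag u r + disag z z by ring.
apply: (le_trans (ler_normD _ _)).
have h1 : `|2 * disag u r| <= 2 * (b * (Nu * (`|h| * e' * nK))).
  rewrite normrM ger0_norm // ler_wpM2l //; apply: (le_trans (disag_le _ _)).
  by rewrite ler_wpM2l // ler_wpM2l.
have h2 : `|disag z z| <= b * (`|h| * e' * (Ng + nK) ^+ 2).
  apply: (le_trans (disag_le _ _)); rewrite ler_wpM2l //.
  apply: (@le_trans _ _ ((`|h| * (Ng + nK)) * (`|h| * (Ng + nK)))).
    by apply: ler_pM => //; exact: nu_ge0 cnrmP _.
  have -> : `|h| * (Ng + nK) * (`|h| * (Ng + nK)) = `|h| * `|h| * (Ng + nK) ^+ 2 by ring.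
  by rewrite ler_wpM2r ?sqr_ge0 // ler_wpM2l // ltW.
apply: (le_trans (lerD h1 h2)).
have -> : 2 * (b * (Nu * (`|h| * e' * nK))) + b * (`|h| * e' * (Ng + nK) ^+ 2) =
   (e' * K2) * `|h| by rewrite /K2; ring.
by rewrite ler_wpM2r.
Qed.

Definition spread_ball (delta : R) : set config :=
  [set X | (forall i, G (X i)) /\ spread y o X < delta].

Lemma spread_ball_tube delta : delta <= tube_size -> spread_ball delta `<=` tube.
Proof. by move=> hd X [GX sX]; split=> //; exact: ltW (lt_le_trans sX hd). Qed.

(** The displacement of the ratios is estimated by [ratio_step] with elapsed
    time [0]. *)
Lemma spread_ball_open delta : Defs.quotient_open G (spread_ball delta).
Proof.
split=> [X []//|X Z [GX sX] GZ|X [GX sX]].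
  split; first by move=> i; exact: (lie_groupM Glie).
  by rewrite spread_mulr //; [exact: (group_units GX o)|exact: (lie_group_unit Glie)].
have uX := group_units GX.
set w := ratios X o; pose Nw := cnrm w; have Nw_ge0 : 0 <= Nw by exact: nu_ge0 cnrmP _.
set u := w - y; pose Nu := cnrm u; have Nu_ge0 : 0 <= Nu by exact: nu_ge0 cnrmP _.
pose a1 := norm_ratio R m * nrm (invmx (X o)).
have a1_ge0 : 0 <= a1 by rewrite mulr_ge0 ?nrm_ge0 // ltW // norm_ratio_gt0.
pose a2 := n%:R * (2 * (1 + Nw) * a1).
have a2_ge0 : 0 <= a2 by rewrite mulr_ge0 // mulr_ge0 // mulr_ge0 // addr_ge0.
pose a3 := b * (a2 * (2 * Nu + 1)).
have a3_ge0 : 0 <= a3.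
  by apply: mulr_ge0 => //; apply: mulr_ge0 => //; rewrite addr_ge0 // mulr_ge0.
pose theta := Num.min 1 ((delta - spread y o X) / 2).
have theta0 : 0 < theta by rewrite lt_min ltr01 divr_gt0 // subr_gt0.
pose q := 1 + 2 * a1 + a2 + a3.
have q0 : 0 < q by rewrite /q; lra.
pose d := theta / q; have d0 : 0 < d by rewrite divr_gt0.
have small v : v <= q -> v * d <= theta.
  move=> vq; rewrite /d mulrCA ler_piMr ?(ltW theta0) // ler_pdivrMr // mul1r //.
have theta1 : theta <= 1 by rewrite ge_min lexx.
exists d => // X' GX' hX'; split=> //.
have uX' := group_units GX'.
have hp i : nrm ((X' i - X i) *m invmx (X o) - (0 : R)%:K *: ((0 : config) i *m ratios X o i)) <= a1 * d.
  rewrite rmorph0 scale0r subr0; apply: (le_trans (nrmM _ _)).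
  rewrite /a1 mulrAC ler_wpM2r ?nrm_ge0 //; apply: nrm_le_norm.
  exact: ltW.
have hsum : `|0 : R| * nrm ((0 : config) o) + a1 * d <= 2^-1.
  rewrite normr0 mul0r add0r.
  have : 2 * a1 * d <= theta by apply: small; rewrite /q; lra.
  by move: theta1; rewrite -mulrA; move: (a1 * d) => v; lra.
have step := ratio_step uX (uX' o) hp hsum.
set D := ratios X' o - ratios X o.
have cD : cnrm D <= a2 * d.
  have -> : a2 * d = n%:R * (2 * (1 + Nw) * (a1 * d)) by rewrite /a2; ring.
  rewrite -(sumr_ord_const n); apply: ler_sum => j _; have := step j.
  rewrite rmorph0 scale0r subr0 normr0 mulr0 mul0r mul0r addr0 => /le_trans; apply.
  apply: ler_wpM2r; first exact: mulr_ge0 a1_ge0 (ltW d0).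
  by rewrite ler_wpM2l // lerD2l; exact: (sum_norm_coord nrmP).
have cD1 : cnrm D <= 1.
  by apply: (le_trans cD); apply: le_trans theta1; apply: small; rewrite /q; lra.
have uE : ratios X' o - y - u = D.
  rewrite /u /D -/w; move: (ratios X' o) => P.
  by flatten_diff; cancel P; cancel w; cancel y.
have cu' : cnrm (ratios X' o - y) <= Nu + 1.
  by apply: (le_trans (nu_le_dist cnrmP _ u)); rewrite uE lerD2l.
have dist := disag_dist (ratios X' o - y) u.
have bound : disag_bound R n * (cnrm (ratios X' o - y - u) * (cnrm (ratios X' o - y) + cnrm u)) <= a3 * d.
  have -> : a3 * d = b * ((a2 * d) * (2 * Nu + 1)) by rewrite /a3; ring.
  rewrite uE ler_wpM2l //; apply: ler_pM cD _; rewrite ?addr_ge0 ?(nu_ge0 cnrmP) //.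
  by apply: (le_trans (lerD cu' (lexx _))); rewrite -/Nu; lra.
have h3 : a3 * d <= theta by apply: small; rewrite /q; lra.
have h4 : theta <= (delta - spread y o X) / 2 by rewrite ge_min lexx orbT.
have := le_trans dist (le_trans bound (le_trans h3 h4)).
rewrite -[disag u u]/(spread y o X) -[disag (ratios X' o - y) _]/(spread y o X').
by rewrite ler_norml => /andP[_]; move: sX; lra.
Qed.

Variable Y : config.
Hypothesis GY : forall i, G (Y i).
Hypothesis Yy : ratios Y o = y.

Lemma spread_center : spread y o Y = 0.
Proof.
rewrite /spread Yy subrr; have := disagZr 0 (0 : config) (0 : config); rewrite mul0r => <-.
by congr disag; apply/funext => i; rewrite scaler0.
Qed.

Lemma spread_ball_nbhs delta : 0 < delta -> class_nbhs G Y (spread_ball delta).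
Proof.
by move=> d0; split; [exact: spread_ball_open|split=> //; rewrite spread_center].
Qed.

(** When the spread of [X] is small, the representative of its class that agrees
    with [Y] at the node [o] is close to [Y]. *)
Lemma spread_ball_basis (U : set config) : class_nbhs G Y U ->
  exists delta, [/\ 0 < delta, delta <= tube_size & spread_ball delta `<=` U].
Proof.
move=> [[UG Umul Uopen] UY]; have [d d0 hd] := Uopen Y UY.
have uY := group_units GY.
pose d1 := d / (2 * (1 + nrm (Y o))).
have q0 : 0 < 2 * (1 + nrm (Y o)) by rewrite mulr_gt0 // ltr_pwDl // nrm_ge0.
have d10 : 0 < d1 by rewrite divr_gt0.
have c1 : 0 < c0 + 1 by rewrite ltr_wpDl.
exists (Num.min tube_size (d1 ^+ 2 / (c0 + 1))); split.
- by rewrite lt_min tube_size_gt0 divr_gt0 // exprn_gt0.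
- by rewrite ge_min lexx.
move=> X [GX]; rewrite lt_min => /andP[_ sX]; have uX := group_units GX.
have cu : cnrm (ratios X o - y) <= d1.
  by apply: spread_dist => //; exact: ltW.
pose X' : config := fun i => ratios X o i *m Y o.
have GX' i : G (X' i).
  apply: (lie_groupM Glie) => //; apply: (lie_groupM Glie) => //.
  exact: (lie_groupV Glie).
have UX' : U X'.
  apply: hd => // i; have -> : X' i - Y i = (ratios X o - y) i *m Y o.
    by rewrite mulmxBl -Yy /ratios mulmxKV.
  apply: (le_lt_trans (norm_le_nrm _)); rewrite of_real_lt.
  apply: (le_lt_trans (nrmM _ _)).
  have hi := le_trans (sum_norm_coord nrmP (ratios X o - y) i) cu.
  apply: (le_lt_trans (ler_wpM2r (nrm_ge0 _) hi)).
  rewrite /d1 mulrAC ltr_pdivrMr // ltr_pM2l //.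
  by have := nrm_ge0 (Y o); lra.
have := Umul X' (invmx (Y o) *m X o) UX'.
have -> : (fun i => X' i *m (invmx (Y o) *m X o)) = X.
  by apply/funext => i; rewrite /X' mulmxA (mulmxK (uY o)) /ratios mulmxKV.
apply; apply: (lie_groupM Glie) => //; exact: (lie_groupV Glie).
Qed.

Lemma solution_decay (X : R -> config) : solution G gamma a eps Omega X ->
  spread_ball tube_size (X 0) ->
  (forall t, 0 <= t -> spread y o (X t) <= spread y o (X 0)) /\
  (forall mu, 0 < mu -> exists2 T, 0 <= T & forall t, T <= t -> spread y o (X t) <= mu).
Proof.
move=> sX [GX0 sX0]; have rate := solution_rate sX.
have k2 : 0 < 2 * kappa by rewrite mulr_gt0.
have w0 t : 0 <= t -> 0 <= spread y o (X t) by move=> _; exact: spread_ge0.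
have neg t : 0 <= t -> spread y o (X t) <= tube_size ->
    2 * disag (ratios (X t) o - y) (drift (F (X t)) o (ratios (X t) o)) <=
    - (2 * kappa) * spread y o (X t).
  move=> t0 ht; have [[GX _] _] := sX t t0.
  have [_ h] := tube_drift (conj GX ht); move: h; lra.
split; first by move=> t t0; exact: (decay_le rate k2 w0 sX0 neg (lexx 0) t0).
by move=> mu mu0; exact: (decay_small rate k2 w0 sX0 neg mu0).
Qed.

(** Sublevel sets of the spread form a basis of neighbourhoods of the class, are
    invariant, and are entered by every solution that starts in the tube. *)
Lemma class_asymptotically_stable : asymptotically_stable G gamma a eps Omega Y.
Proof.
split.
  move=> U UY; have [delta [d0 dt dU]] := spread_ball_basis UY.
  exists (spread_ball delta); first exact: spread_ball_nbhs.
  move=> X0 VX0; split; first exact: tube_solution (spread_ball_tube dt VX0).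
  move=> X sX XX0 t t0; apply: dU; have [GX0 sX0] := VX0.
  have [|h _] := solution_decay sX.
    by rewrite XX0; split=> //; exact: lt_le_trans sX0 dt.
  split; first by have [[]] := sX t t0.
  by apply: (le_lt_trans (h t t0)); rewrite XX0.
exists (spread_ball tube_size); first exact: spread_ball_nbhs tube_size_gt0.
move=> X sX VX0 U UY; have [delta [d0 dt dU]] := spread_ball_basis UY.
have [_ h] := solution_decay sX VX0.
have [T T0 hT] := h _ (divr_gt0 d0 (ltr0Sn R 1)).
exists T; split; first exact: num_real.
move=> t Tt; apply: dU; split.
  by have [[]] := sX t (le_trans T0 (ltW Tt)).
by apply: (le_lt_trans (hT t (ltW Tt))); rewrite ltr_pdivrMr //; move: d0; lra.
Qed.

End Flow.

(** * Existence and stability of the fixed point *)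

Theorem proposition2p10 (R : realType) (k : base_field) (m n : nat)
  (G : set 'M[scalars R k]_m) (gamma : 'I_n -> 'I_n -> R) (a : nat -> R)
  (Omega : 'I_n -> 'M[scalars R k]_m) :
  matrix_lie_group G ->
  lohe_closed G ->
  (forall i j, gamma i j = gamma j i) ->
  (forall i j, 0 <= gamma i j) ->
  analytic_past_one a ->
  (forall i, lie_algebra G (Omega i)) ->
  \sum_i Omega i = 0 ->
  0 < derive1 (scalar_fun a) 1 ->
  negative_semidefinite (laplacian gamma) ->
  simple_eigenvalue (laplacian gamma) 0 ->
  let Q := fun i : 'I_n =>
    - (of_real k (derive1 (scalar_fun a) 1)^-1 *: lap_pinv G gamma Omega i) in
  exists eps0 C : R, [/\ 0 < eps0, 0 < C &
    forall eps : R, `|eps| < eps0 ->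
    exists Y : 'I_n -> 'M[scalars R k]_m,
    [/\ fixed_point G gamma a eps Omega Y,
        asymptotically_stable G gamma a eps Omega Y,
        (forall i j,
           `|Y j *m invmx (Y i) - 1%:M| <= of_real k (C * `|eps|)) &
        exists P : 'I_n -> 'M[scalars R k]_m,
        [/\ lie_algebra0 G P,
            (forall i, Y i = expmx (of_real k eps *: P i)) &
            (forall i, `|P i - Q i| <= of_real k (C * `|eps|))]]].
Proof.
move=> Glie Glohe gammaC gamma_ge0 a_an gOm Om0 fp0 nsd simple Q.
pose fp := derive1 (scalar_fun a) 1.
have gOmega : lie_algebra0 G Omega by split.
have [[gPinv Pinv0] LPinv] := lap_pinvP Glie gammaC simple gOmega.
have QE : Q = fun i => of_real k (- fp^-1) *: lap_pinv G gamma Omega i.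
  by apply/funext => i; rewrite /Q rmorphN scaleNr.
have gQ : lie_algebra0 G Q.
  rewrite QE; split=> [i|]; first exact: lieZ.
  by rewrite -scaler_sumr Pinv0 scaler0.
have LQ i : of_real k fp *: lap_act gamma Q i = - Omega i.
  rewrite QE -[lap_act gamma _]/(mxact (laplacian gamma) _) mxactZ.
  rewrite -[mxact (laplacian gamma) _]/(lap_act gamma _) LPinv scalerA -rmorphM.
  by rewrite mulrN divff ?gt_eqF // rmorphN1 scaleN1r.
pose o : 'I_n := Ordinal (graph_nonempty simple).
have [rho1 [kappa [C1 [[rho1_gt0 rho1_le] kappa_gt0 C1_ge0 series_cvg lyap]]]] :=
  ratio_lyapunov k m gammaC gamma_ge0 a_an simple nsd fp0.
have [eps1 [Cf [eps1_gt0 Cf_ge0 fixed]]] :=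
  kuramoto_fixed_point Glie Glohe gammaC gamma_ge0 a_an simple fp0 gOmega gQ LQ.
have q0 : 0 < 8 * Cf + 1 by rewrite ltr_wpDl // mulr_ge0.
exists (Num.min eps1 (rho1 / (8 * Cf + 1))), (4 * Cf + 1); split.
- by rewrite lt_min eps1_gt0 divr_gt0.
- by rewrite ltr_wpDl // mulr_ge0.
move=> eps; rewrite lt_min => /andP[eps_lt eps_lt'].
(* The bound [rho1 / (8 * Cf + 1)] on [eps] puts the ratios of [Y], which are
   within [4 * Cf * eps] of the identity, in the smaller ball [rho1 / 2]. *)
have [P [gP rhsY PQ Ynear]] := fixed eps (ltW eps_lt).
set Y := exp_config eps P in rhsY Ynear.
have eps_ge0 : 0 <= `|eps| by exact: normr_ge0.
have Ceps : 8 * (Cf * `|eps|) <= rho1.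
  have : `|eps| * (8 * Cf + 1) <= rho1 by rewrite -ler_pdivlMr // ltW.
  by move: eps_ge0; lra.
have Ceps_ge0 : 0 <= Cf * `|eps| by exact: mulr_ge0.
have Ceps2 : Cf * `|eps| <= 2^-1 by move: rho1_le Ceps Ceps_ge0; lra.
have GY i : G (Y i) by case: gP => gP _; exact: gP.
have uY i : Y i \in unitmx by exact: (lie_group_unit Glie).
have ratioY i j : nrm (Y j *m invmx (Y i) - 1) <= 4 * (Cf * `|eps|).
  exact: ratio_near1.
have y_near : near1 (rho1 / 2) (ratios Y o).
  move=> i; split; first exact: ratio_unit.
  by apply: (le_trans (ratioY o i)); move: Ceps; lra.
have y_base : ratios Y o o = 1 by exact: ratio_base.
have y_fixed i : kuramoto_rhs gamma a eps Omega (ratios Y o) i = 0.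
  by rewrite kuramoto_rhs_ratio.
have y_near1 := y_near1 rho1_gt0 y_near.
have F_lip (w w' : 'I_n -> 'M[scalars R k]_m) : near1 rho1 w -> near1 rho1 w' ->
    forall i, nrm (kuramoto_rhs gamma a eps Omega w i - kuramoto_rhs gamma a eps Omega w' i)
      <= C1 * sum_norm (@nrm R k m) (w - w').
  by move=> hw hw'; have [] := lyap eps Omega w w' hw hw'.
have F_lyap (w : 'I_n -> 'M[scalars R k]_m) : near1 rho1 w -> w o = 1 ->
    sum_norm (@nrm R k m) (drift (kuramoto_rhs gamma a eps Omega w) o w) <=
      C1 * sum_norm (@nrm R k m) (w - ratios Y o) /\
    disag (w - ratios Y o) (drift (kuramoto_rhs gamma a eps Omega w) o w) <=
      - kappa * disag (w - ratios Y o) (w - ratios Y o).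
  move=> hw wo; have [_ h] := lyap eps Omega w (ratios Y o) hw y_near1.
  exact: h.
have tubeY : tube G rho1 (ratios Y o) o Y.
  by split=> //; rewrite spread_center // ltW // tube_size_gt0.
exists Y; split.
- split=> //; exact: (tube_phase Glie rho1_gt0 series_cvg y_near y_base tubeY).
- exact: (class_asymptotically_stable Glie Glohe gOm rho1_gt0 rho1_le kappa_gt0
    C1_ge0 series_cvg F_lip y_near y_base y_fixed F_lyap GY erefl).
- move=> i j; apply: (le_trans (norm_le_nrm _)); rewrite of_real_le.
  by apply: (le_trans (ratioY i j)); move: eps_ge0; lra.
- exists P; split=> // i.
  apply: (le_trans (norm_le_nrm _)); rewrite of_real_le.
  by apply: (le_trans (PQ i)); move: eps_ge0 Ceps_ge0; lra.
Qed.
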